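(* Let $\Bbbk$ be an algebraically closed field and $n\geq 2$. Up to isomorphism of the modules involved, there are exactly $2^{n-1}$ full exceptional sequences of $B_n$-modules, and they are all of the form $$(\nabla(i_1),\dots,\nabla(i_k),L(1),\Delta(j_1),\dots,\Delta(j_l)),$$ where - $k+l=n-1$ with $0\leq k,l\leq n-1$; - $\{i_1,\dots,i_k,j_1,\dots,j_l\}=\{2,\dots,n\}$; - $i_s>i_t$ and $j_s<j_t$ for $s<t$.
   Context: Modules are finite-dimensional right modules. The algebra $B_n$ ($n\geq 2$): consider the quiver with vertices $1,2,\dots,n$ and, for each $1\leq i\leq n-1$, one arrow $i\to i+1$ and one arrow $i+1\to i$. Then $B_n$ is the quotient of the path algebra over $\Bbbk$ of this quiver by the ideal generated by the relations: any path of length three is zero; any path of length two which is not a cycle is zero; for each vertex $v$, all length two cycles which start and terminate at $v$ are equal; the length two cycle at the vertex $n$ is zero. $L(i)$ is the simple $B_n$-module associated to the vertex $i$. For $2\leq i\leq n$, $\Delta(i)$ is the (unique up to isomorphism) uniserial $B_n$-module of length two with top $L(i)$ and socle $L(i-1)$, and $\nabla(i)$ is the (unique up to isomorphism) uniserial $B_n$-module of length two with top $L(i-1)$ and socle $L(i)$. (Together with $\Delta(1)=\nabla(1)=L(1)$, these are the standard and costandard modules for the quasi-hereditary structure on $B_n$ with respect to $L(1)<\dots<L(n)$.) Let $\Lambda$ be a finite-dimensional $\Bbbk$-algebra. A $\Lambda$-module $M$ is exceptional if $\mathrm{Hom}_\Lambda(M,M)=\Bbbk$ and $\mathrm{Ext}^i_\Lambda(M,M)=0$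 for all $i>0$. A sequence $(M_1,\dots,M_k)$ of $\Lambda$-modules is an exceptional sequence if each $M_i$ is exceptional and $\mathrm{Ext}^i_\Lambda(M_t,M_s)=0$ for all $1\leq s<t\leq k$ and all $i\geq 0$. An exceptional sequence is full if it generates the (bounded) derived category of $\Lambda$-modules (as a triangulated category). *)

(* Defs.v *)
From HB Require Import structures.
From mathcomp Require Import all_boot all_order all_algebra.
From mathcomp Require Import finmap generic_quotient ring_quotient.
From mathcomp Require Import boolp.
From mathcomp Require Import monalg.
From mathcomp Require Import zify.
From Stdlib Require List.

Set Implicit Arguments.
Unset Strict Implicit.
Unset Printing Implicit Defensive.

Import GRing.Theory.
Local Open Scope ring_scope.
Local Open Scope quotient_scope.

Section Walks.
Context {m : nat} (e : rel 'I_m.+1).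

(* A path v_0 -> v_1 -> ... -> v_l of the quiver with vertex set 'I_m.+1 and
   exactly one arrow i -> j whenever e i j, encoded as (v_0, [:: v_1; ...; v_l]);
   l = 0 gives the trivial path at v_0. *)
Record walk := Walk {wval : 'I_m.+1 * seq 'I_m.+1; _ : path e wval.1 wval.2}.
HB.instance Definition _ := [isSub for wval].
(* Opaque instances: with the ones inherited from the subtype, comparing two
   elements << p >> and << q >> below unfolds the sorting of finite sets. *)
HB.instance Definition _ := gen_eqMixin walk.
HB.instance Definition _ := gen_choiceMixin walk.

Definition wsrc (p : walk) : 'I_m.+1 := (val p).1.
Definition wseq (p : walk) : seq 'I_m.+1 := (val p).2.
Definition wtgt (p : walk) : 'I_m.+1 := last (wsrc p) (wseq p).
Definition wlen (p : walk) : nat := size (wseq p).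

Definition wtriv (v : 'I_m.+1) : walk := @Walk (v, [::]) isT.

(* Only meaningful when wtgt p = wsrc q; the default p of insubd is then not
   used. *)
Definition wcat (p q : walk) : walk := insubd p (wsrc p, wseq p ++ wseq q).

Lemma val_wcat p q : wtgt p = wsrc q ->
  val (wcat p q) = (wsrc p, wseq p ++ wseq q).
Proof.
move=> pq; rewrite /wcat insubdK // unfold_in /= cat_path.
by rewrite (valP p) -/(wtgt p) pq (valP q).
Qed.

Lemma wsrc_cat p q : wtgt p = wsrc q -> wsrc (wcat p q) = wsrc p.
Proof. by move=> pq; rewrite /wsrc val_wcat. Qed.

Lemma wseq_cat p q : wtgt p = wsrc q -> wseq (wcat p q) = wseq p ++ wseq q.
Proof. by move=> pq; rewrite /wseq val_wcat. Qed.

Lemma wtgt_cat p q : wtgt p = wsrc q -> wtgt (wcat p q) = wtgt q.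
Proof.
by move=> pq; rewrite /wtgt wsrc_cat // wseq_cat // last_cat -/(wtgt p) pq.
Qed.

Lemma walk_eq p q : wsrc p = wsrc q -> wseq p = wseq q -> p = q.
Proof.
move=> e1 e2; apply: val_inj; move: e1 e2; rewrite /wsrc /wseq.
by case: (val p) (val q) => a b [c d] /= -> ->.
Qed.

Lemma wcatA p q r : wtgt p = wsrc q -> wtgt q = wsrc r ->
  wcat p (wcat q r) = wcat (wcat p q) r.
Proof.
move=> pq qr; have h1 : wtgt p = wsrc (wcat q r) by rewrite wsrc_cat.
have h2 : wtgt (wcat p q) = wsrc r by rewrite wtgt_cat.
by apply: walk_eq; rewrite ?(wsrc_cat, wseq_cat) // catA.
Qed.

End Walks.

Section BilinearProduct.
Context (k : fieldType) (K : choiceType) (b : K -> K -> {malg k[K]}).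
Implicit Types x y z : {malg k[K]}.

(* The bilinear extension of a product b of basis elements. *)
Definition bilmul x y : {malg k[K]} :=
  \sum_(p <- msupp x) \sum_(q <- msupp y) (x@_p * y@_q) *: b p q.

Lemma malg_basisE x : x = \sum_(p <- msupp x) x@_p *: << p >>.
Proof.
rewrite {1}[x]monalgE; apply: eq_bigr => p _.
by apply/malgP => q; rewrite mcoeffZ !mcoeffU mulrnAr mulr1.
Qed.

Lemma malg_lind (P : {malg k[K]} -> Prop) :
  P 0 -> (forall x y, P x -> P y -> P (x + y)) ->
  (forall c p, P (c *: << p >>)) -> forall x, P x.
Proof. by move=> P0 PD Pb x; rewrite [x]malg_basisE; elim/big_ind: _. Qed.

Lemma sum_msupp_w (V : lmodType k) (F : K -> V) (d : {fset K}) x :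
  (msupp x `<=` d)%fset ->
  \sum_(p <- msupp x) x@_p *: F p = \sum_(p <- d) x@_p *: F p.
Proof.
move=> sub; apply: big_fset_incl => // p _ pn.
by rewrite (mcoeff_outdom pn) scale0r.
Qed.

Lemma sum_msupp_linear (V : lmodType k) (F : K -> V) :
  linear (fun x => \sum_(p <- msupp x) x@_p *: F p).
Proof.
move=> c x y /=; set d := (msupp x `|` msupp y `|` msupp (c *: x + y))%fset.
rewrite (@sum_msupp_w _ F d x) ?(@sum_msupp_w _ F d y)
        ?(@sum_msupp_w _ F d (c *: x + y)).
- rewrite scaler_sumr -big_split; apply: eq_bigr => p _ /=.
  by rewrite mcoeffD mcoeffZ scalerDl scalerA.
- exact: fsubsetUr.
- by rewrite /d -fsetUA fsetUCA fsubsetUl.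
- by rewrite /d -fsetUA fsubsetUl.
Qed.

Lemma bilmul_linearl y : linear (bilmul^~ y).
Proof.
move=> c x x'; have E z : bilmul z y = \sum_(p <- msupp z) z@_p *:
    (\sum_(q <- msupp y) y@_q *: b p q).
  by apply: eq_bigr => p _; rewrite scaler_sumr; apply: eq_bigr => q _;
     rewrite scalerA.
by rewrite !E sum_msupp_linear.
Qed.

Lemma bilmul_linearr x : linear (bilmul x).
Proof.
move=> c y y'; have E z : bilmul x z = \sum_(q <- msupp z) z@_q *:
    (\sum_(p <- msupp x) x@_p *: b p q).
  rewrite /bilmul exchange_big; apply: eq_bigr => q _; rewrite scaler_sumr.
  by apply: eq_bigr => p _; rewrite scalerA mulrC.
by rewrite !E sum_msupp_linear.
Qed.

Lemma bilmulDl : left_distributive bilmul +%R.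
Proof. by move=> x y z; have := bilmul_linearl z 1 x y; rewrite !scale1r. Qed.

Lemma bilmulDr : right_distributive bilmul +%R.
Proof. by move=> x y z; have := bilmul_linearr x 1 y z; rewrite !scale1r. Qed.

Lemma bilmul0l x : bilmul 0 x = 0.
Proof. by rewrite /bilmul msupp0 big_nil. Qed.

Lemma bilmul0r x : bilmul x 0 = 0.
Proof. by rewrite /bilmul big1 // => p _; rewrite msupp0 big_nil. Qed.

Lemma bilmulZl c x y : bilmul (c *: x) y = c *: bilmul x y.
Proof. by have := bilmul_linearl y c x 0; rewrite !addr0 bilmul0l addr0. Qed.

Lemma bilmulZr c x y : bilmul x (c *: y) = c *: bilmul x y.
Proof. by have := bilmul_linearr x c y 0; rewrite !addr0 bilmul0r addr0. Qed.

Lemma bilmulbb p q : bilmul << p >> << q >> = b p q.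
Proof.
rewrite /bilmul !msuppU oner_eq0 !big_seq_fset1 /=.
by rewrite !mcoeffUU mulr1 scale1r.
Qed.

Lemma bilmulA :
  (forall p q r, bilmul << p >> (b q r) = bilmul (b p q) << r >>) ->
  associative bilmul.
Proof.
move=> bA x y z; elim/malg_lind: x => [|x x' IHx IHx'|c p].
- by rewrite !bilmul0l.
- by rewrite !bilmulDl IHx IHx'.
rewrite !bilmulZl; congr (_ *: _); elim/malg_lind: y => [|y y' IHy IHy'|d q].
- by rewrite bilmul0l bilmul0r bilmul0l.
- by rewrite !(bilmulDl, bilmulDr) IHy IHy'.
rewrite !(bilmulZl, bilmulZr) ?bilmulZl; congr (_ *: _).
elim/malg_lind: z => [|z z' IHz IHz'|f r].
- by rewrite !bilmul0r.
- by rewrite !bilmulDr IHz IHz'.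
by rewrite !bilmulZr !bilmulbb bA.
Qed.

Lemma bilmul_suml (I : finType) (F : I -> {malg k[K]}) x :
  bilmul (\sum_i F i) x = \sum_i bilmul (F i) x.
Proof. exact: (big_morph (bilmul^~ x) (fun y z => bilmulDl y z x) (bilmul0l x)). Qed.

Lemma bilmul_sumr (I : finType) (F : I -> {malg k[K]}) x :
  bilmul x (\sum_i F i) = \sum_i bilmul x (F i).
Proof. exact: (big_morph (bilmul x) (fun y z => bilmulDr x y z) (bilmul0r x)). Qed.

Lemma bilmul_idl u : (forall p, bilmul u << p >> = << p >>) ->
  left_id u bilmul.
Proof.
move=> hu x; elim/malg_lind: x => [|x x' IHx IHx'|c p].
- by rewrite bilmul0r.
- by rewrite bilmulDr IHx IHx'.
by rewrite bilmulZr hu.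
Qed.

Lemma bilmul_idr u : (forall p, bilmul << p >> u = << p >>) ->
  right_id u bilmul.
Proof.
move=> hu x; elim/malg_lind: x => [|x x' IHx IHx'|c p].
- by rewrite bilmul0l.
- by rewrite bilmulDl IHx IHx'.
by rewrite bilmulZl hu.
Qed.

Lemma mcoeff_basis_sum (I : finType) (f : I -> K) i : injective f ->
  (\sum_j << f j >> : {malg k[K]})@_(f i) = 1.
Proof.
move=> finj; rewrite raddf_sum /= (bigD1 i) //= mcoeffUU big1 ?addr0 // => j ji.
by rewrite mcoeffU (inj_eq finj) (negbTE ji).
Qed.

Lemma mcoeff_bilmul_l (Q : pred K) x y :
  (forall p q r, ~~ Q p -> Q r -> (b p q)@_r = 0) ->
  (forall r, Q r -> x@_r = 0) -> forall r, Q r -> (bilmul x y)@_r = 0.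
Proof.
move=> bQ xQ r Qr; rewrite /bilmul raddf_sum big1 //= => p _.
rewrite raddf_sum big1 //= => q _; rewrite mcoeffZ.
have [Qp|Qp] := boolP (Q p); first by rewrite xQ // !mul0r.
by rewrite bQ // mulr0.
Qed.

Lemma mcoeff_bilmul_r (Q : pred K) x y :
  (forall p q r, ~~ Q q -> Q r -> (b p q)@_r = 0) ->
  (forall r, Q r -> y@_r = 0) -> forall r, Q r -> (bilmul x y)@_r = 0.
Proof.
move=> bQ yQ r Qr; rewrite /bilmul raddf_sum big1 //= => p _.
rewrite raddf_sum big1 //= => q _; rewrite mcoeffZ.
have [Qq|Qq] := boolP (Q q); first by rewrite yQ // mulr0 mul0r.
by rewrite bQ // mulr0.
Qed.

End BilinearProduct.

Section PathAlgebra.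
Context (k : fieldType) {m : nat} (e : rel 'I_m.+1).

(* Finitely supported k-linear combinations of paths.  A separate name because
   {malg k[_]} carries a product only when the basis is a monoid. *)
Definition pathalg := {malg k[walk e]}.
HB.instance Definition _ := GRing.Lmodule.on pathalg.

Definition pbasis (p : walk e) : pathalg := (<< p >> : {malg k[walk e]}).

(* Paths are multiplied from left to right: p q is p followed by q. *)
Definition pbmul (p q : walk e) : {malg k[walk e]} :=
  if wtgt p == wsrc q then << wcat p q >> else 0.

Definition pmul : pathalg -> pathalg -> pathalg := bilmul pbmul.

Definition pone : pathalg := (\sum_(v : 'I_m.+1) << wtriv e v >> : {malg k[walk e]}).

Lemma pbmulA p q r :
  bilmul pbmul << p >> (pbmul q r) = bilmul pbmul (pbmul p q) << r >>.
Proof.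
rewrite [pbmul q r]/pbmul [pbmul p q]/pbmul.
case: (wtgt q =P wsrc r) => [qr|qr]; case: (wtgt p =P wsrc q) => [pq|pq].
- rewrite !bilmulbb /pbmul wsrc_cat // wtgt_cat //.
  by rewrite (introT eqP pq) (introT eqP qr) wcatA.
- by rewrite bilmul0l bilmulbb /pbmul wsrc_cat //; case: eqP.
- by rewrite bilmul0r bilmulbb /pbmul wtgt_cat //; case: eqP.
- by rewrite bilmul0l bilmul0r.
Qed.

Lemma pmulA : associative pmul.
Proof. exact/bilmulA/pbmulA. Qed.

Lemma pmul1l : left_id pone pmul.
Proof.
apply: bilmul_idl => p; rewrite bilmul_suml (bigD1 (wsrc p)) //= big1.
  rewrite addr0 bilmulbb /pbmul eqxx; congr mkmalgU.
  by apply: walk_eq; rewrite ?wsrc_cat ?wseq_cat.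
by move=> v vp; rewrite bilmulbb /pbmul (negbTE vp).
Qed.

Lemma pmul1r : right_id pone pmul.
Proof.
apply: bilmul_idr => p; rewrite bilmul_sumr (bigD1 (wtgt p)) //= big1.
  rewrite addr0 bilmulbb /pbmul eqxx; congr mkmalgU.
  by apply: walk_eq; rewrite ?wsrc_cat ?wseq_cat //= cats0.
by move=> v vp; rewrite bilmulbb /pbmul eq_sym (negbTE vp).
Qed.

Lemma wtriv_inj : injective (wtriv e).
Proof. by move=> u v /(congr1 (@wsrc _ _)). Qed.

Lemma pone_coeff v : mcoeff (wtriv e v) pone = 1.
Proof. exact: (@mcoeff_basis_sum k _ _ (wtriv e) v wtriv_inj). Qed.

Lemma pone_neq0 : pone != 0.
Proof.
apply/eqP => h; have := pone_coeff ord0; rewrite h mcoeff0.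
by move/esym/eqP; rewrite oner_eq0.
Qed.

HB.instance Definition _ := GRing.Zmodule_isNzRing.Build pathalg
  pmulA pmul1l pmul1r (bilmulDl pbmul) (bilmulDr pbmul) pone_neq0.
HB.instance Definition _ := GRing.Lmodule_isLalgebra.Build k pathalg
  (fun c x y => esym (bilmulZl pbmul c x y)).
HB.instance Definition _ := GRing.Lalgebra_isAlgebra.Build k pathalg
  (fun c x y => esym (bilmulZr pbmul c x y)).

End PathAlgebra.

Section TwoSidedIdeals.
Context {A : nzRingType}.

Record is_ideal (I : A -> Prop) : Prop := IsIdeal {
  ideal_0 : I 0;
  ideal_D : forall x y, I x -> I y -> I (x + y);
  ideal_Ml : forall a x, I x -> I (a * x);
  ideal_Mr : forall x a, I x -> I (x * a) }.

Definition ideal_gen (R : A -> Prop) (x : A) : Prop :=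
  forall I : A -> Prop, is_ideal I -> (forall r, R r -> I r) -> I x.

Lemma ideal_gen_ideal R : is_ideal (ideal_gen R).
Proof.
split=> [I hI _|x y hx hy I hI hR|a x hx I hI hR|x a hx I hI hR].
- exact: ideal_0.
- by apply: ideal_D => //; [apply: hx | apply: hy].
- by apply: ideal_Ml => //; apply: hx.
- by apply: ideal_Mr => //; apply: hx.
Qed.

Record proper_ideal := ProperIdeal {
  pideal :> A -> Prop;
  pidealP : is_ideal pideal;
  pideal1 : ~ pideal 1 }.

End TwoSidedIdeals.
Arguments proper_ideal : clear implicits.

Section QuotientAlgebra.
Context (k : fieldType) (A : algType k) (I : proper_ideal A).

Definition ideal_pred : {pred A} := fun x => `[< I x >].

Lemma ideal_zmod : zmod_closed ideal_pred.
Proof.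
have hI := pidealP I; split=> [|x y /asboolP hx /asboolP hy].
  exact/asboolP/(ideal_0 hI).
by apply/asboolP/(ideal_D hI) => //; rewrite -mulN1r; apply: (ideal_Ml hI).
Qed.
HB.instance Definition _ := GRing.isZmodClosed.Build A ideal_pred ideal_zmod.

Definition quotalg := Quotient.quot ideal_pred.
HB.instance Definition _ := GRing.Zmodule.on quotalg.
HB.instance Definition _ := EqQuotient.on quotalg.

Definition qpi (x : A) : quotalg := \pi_quotalg x.

Lemma qpi_eq x y : (qpi x = qpi y) <-> I (x - y).
Proof.
by split=> [/eqP|h]; rewrite ?piE ?Quotient.equivE; [move/asboolP|apply/eqP; rewrite piE Quotient.equivE; apply/asboolP].
Qed.

Lemma qpiK x : qpi (repr x) = x. Proof. exact: reprK. Qed.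

Lemma qpiD x y : qpi (x + y) = qpi x + qpi y.
Proof. exact: Quotient.pi_add. Qed.

Lemma repr_qpi x : I (repr (qpi x) - x).
Proof. by apply/qpi_eq; rewrite qpiK. Qed.

Definition qone : quotalg := qpi 1.
Definition qmul (x y : quotalg) : quotalg := qpi (repr x * repr y).
Definition qscale (c : k) (x : quotalg) : quotalg := qpi (c *: repr x).

Lemma qpiM x y : qpi (x * y) = qmul (qpi x) (qpi y).
Proof.
apply/esym/qpi_eq.
rewrite -[_ * _](subrK (repr (qpi x) * y)) -mulrBr -addrA -mulrBl.
by apply: (ideal_D (pidealP I)); [apply: (ideal_Ml (pidealP I))|apply: (ideal_Mr (pidealP I))]; apply: repr_qpi.
Qed.

Lemma qpiZ c x : qpi (c *: x) = qscale c (qpi x).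
Proof.
apply/esym/qpi_eq; rewrite -scalerBr -mulr_algl.
by apply: (ideal_Ml (pidealP I)); apply: repr_qpi.
Qed.

Lemma qmulA : associative qmul.
Proof. by move=> x y z; rewrite -[x]qpiK -[y]qpiK -[z]qpiK -!qpiM mulrA. Qed.
Lemma qmul1l : left_id qone qmul.
Proof. by move=> x; rewrite -[x]qpiK -qpiM mul1r. Qed.
Lemma qmul1r : right_id qone qmul.
Proof. by move=> x; rewrite -[x]qpiK -qpiM mulr1. Qed.
Lemma qmulDl : left_distributive qmul +%R.
Proof.
by move=> x y z; rewrite -[x]qpiK -[y]qpiK -[z]qpiK -qpiD -!qpiM -qpiD mulrDl.
Qed.
Lemma qmulDr : right_distributive qmul +%R.
Proof.
by move=> x y z; rewrite -[x]qpiK -[y]qpiK -[z]qpiK -qpiD -!qpiM -qpiD mulrDr.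
Qed.
Lemma qone_neq0 : qone != 0.
Proof.
have -> : 0 = qpi 0 :> quotalg by rewrite /qpi piE.
by apply/eqP => /qpi_eq; rewrite subr0; apply: pideal1.
Qed.
HB.instance Definition _ := GRing.Zmodule_isNzRing.Build quotalg
  qmulA qmul1l qmul1r qmulDl qmulDr qone_neq0.

Lemma qscaleA c d x : qscale c (qscale d x) = qscale (c * d) x.
Proof. by rewrite -[x]qpiK -!qpiZ scalerA. Qed.
Lemma qscale1 : left_id 1 qscale.
Proof. by move=> x; rewrite -[x]qpiK -qpiZ scale1r. Qed.
Lemma qscaleDr : right_distributive qscale +%R.
Proof.
by move=> c x y; rewrite -[x]qpiK -[y]qpiK -qpiD -!qpiZ -qpiD scalerDr.
Qed.
Lemma qscaleDl x : {morph qscale^~ x : c d / c + d}.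
Proof. by move=> c d; rewrite -[x]qpiK -!qpiZ -qpiD scalerDl. Qed.
HB.instance Definition _ := GRing.Zmodule_isLmodule.Build k quotalg
  qscaleA qscale1 qscaleDr qscaleDl.

Lemma qscaleAl (c : k) (x y : quotalg) : c *: (x * y) = (c *: x) * y.
Proof.
rewrite -[x]qpiK -[y]qpiK.
have <- : qpi (c *: (repr x * repr y)) = c *: (qpi (repr x) * qpi (repr y)) :> quotalg.
  by rewrite qpiZ qpiM.
have <- : qpi (c *: repr x * repr y) = (c *: qpi (repr x)) * qpi (repr y) :> quotalg.
  by rewrite qpiM qpiZ.
by rewrite scalerAl.
Qed.
Lemma qscaleAr (c : k) (x y : quotalg) : c *: (x * y) = x * (c *: y).
Proof.
rewrite -[x]qpiK -[y]qpiK.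
have <- : qpi (c *: (repr x * repr y)) = c *: (qpi (repr x) * qpi (repr y)) :> quotalg.
  by rewrite qpiZ qpiM.
have <- : qpi (repr x * (c *: repr y)) = qpi (repr x) * (c *: qpi (repr y)) :> quotalg.
  by rewrite qpiM qpiZ.
by rewrite scalerAr.
Qed.
HB.instance Definition _ := GRing.Lmodule_isLalgebra.Build k quotalg qscaleAl.
HB.instance Definition _ := GRing.Lalgebra_isAlgebra.Build k quotalg qscaleAr.

End QuotientAlgebra.

Section Bn.
Context (k : fieldType) (n : nat).

(* For n >= 1, the ordinal i < n stands for the vertex i + 1. *)
Definition Barrow : rel 'I_n.-1.+1 :=
  fun i j => (j == i.+1 :> nat) || (i == j.+1 :> nat).

Local Notation kQ := (pathalg k Barrow).
Local Notation "[ 'path' p ]" := (pbasis k p : kQ).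
Implicit Types p q : walk Barrow.

Inductive Brel : kQ -> Prop :=
| Brel_len3 p of wlen p = 3 : Brel [path p]
| Brel_noncycle p of wlen p = 2 & wsrc p <> wtgt p : Brel [path p]
| Brel_cycles p q of wlen p = 2 & wlen q = 2
    & wsrc p = wtgt p & wsrc q = wtgt q & wsrc p = wsrc q :
    Brel ([path p] - [path q])
| Brel_last p of wlen p = 2 & wsrc p = ord_max & wtgt p = ord_max :
    Brel [path p].

Lemma Bideal_proper : ~ ideal_gen Brel 1.
Proof.
pose Q (p : walk Barrow) := wlen p == 0.
have Qcat p q : wtgt p = wsrc q -> Q (wcat p q) = Q p && Q q.
  by move=> pq; rewrite /Q /wlen wseq_cat // size_cat addn_eq0.
have pb0 p r : ~~ Q p -> Q r -> (<< p >> : {malg k[walk Barrow]})@_r = 0.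
  by move=> Qp Qr; rewrite mcoeffU; case: eqP => // E; rewrite E Qr in Qp.
pose S (x : {malg k[walk Barrow]}) := forall r, Q r -> x@_r = 0.
have SI : @is_ideal kQ S.
  split=> [r _|x y hx hy r Qr|a x hx|x a hx]; first exact: mcoeff0.
  - by rewrite mcoeffD hx // hy // addr0.
  - apply: mcoeff_bilmul_r hx => p q r Qq Qr; rewrite /pbmul.
    case: eqP => [pq|_]; last by rewrite mcoeff0.
    by apply: pb0 => //; rewrite Qcat // negb_and Qq orbT.
  - apply: mcoeff_bilmul_l hx => p q r Qp Qr; rewrite /pbmul.
    case: eqP => [pq|_]; last by rewrite mcoeff0.
    by apply: pb0 => //; rewrite Qcat // negb_and Qp.
have SR x : Brel x -> S x.
  case=> [p lp|p lp _|p q lp lq _ _ _|p lp _ _] r Qr.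
  - by apply: pb0 => //; rewrite /Q lp.
  - by apply: pb0 => //; rewrite /Q lp.
  - have E : (<< p >> - << q >> : {malg k[walk Barrow]})@_r = 0.
      by rewrite mcoeffB !pb0 ?subr0 // /Q ?lp ?lq.
    exact: E.
  - by apply: pb0 => //; rewrite /Q lp.
move=> /(_ S SI SR (wtriv Barrow ord0) isT).
by rewrite (pone_coeff k Barrow ord0) => /eqP; rewrite oner_eq0.
Qed.

Definition Bideal : proper_ideal kQ :=
  ProperIdeal (ideal_gen_ideal Brel) Bideal_proper.

Definition Balg : algType k := quotalg Bideal.

(* The idempotent at the vertex i, 1 <= i <= n. *)
Definition Bidem (i : nat) : Balg :=
  qpi Bideal (pbasis k (wtriv Barrow (inord i.-1))).

End Bn.

Section LinearPack.
Context (k : fieldType) (U V : lmodType k).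

Definition lin_of (f : U -> V) (hf : linear f) : {linear U -> V} :=
  HB.pack f (GRing.isLinear.Build k U V *:%R f hf).

End LinearPack.

Section Modules.
Context {k : fieldType} {A : algType k}.

(* Finite-dimensional right A-modules. *)
Record rmod := RMod {
  rcar :> vectType k;
  ract : rcar -> A -> rcar;
  ract_linl : forall a, linear (ract^~ a);
  ract_linr : forall v, linear (ract v);
  ract1 : forall v, ract v 1 = v;
  ractM : forall v a b, ract v (a * b) = ract (ract v a) b }.

Record rhom (M N : rmod) := RHom {
  rfun :> {linear M -> N};
  rfunP : forall v a, rfun (ract v a) = ract (rfun v) a }.

Definition surjective_rhom (M N : rmod) (f : rhom M N) : Prop :=
  forall y, exists x, f x = y.

Definition riso (M N : rmod) : Prop := exists f : rhom M N, bijective f.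

Lemma rzero_lin (v : 'rV[k]_0) : linear (fun _ : A => v).
Proof. by move=> c a b; rewrite [v]thinmx0 scaler0 addr0. Qed.

Definition rzero : rmod := @RMod 'rV[k]_0 (fun v _ => v)
  (fun _ _ _ _ => erefl) rzero_lin (fun _ => erefl) (fun _ _ _ => erefl).

Section DirectSum.
Context (M N : rmod).
Definition rsum_act (v : M * N) (a : A) : M * N := (ract v.1 a, ract v.2 a).
Lemma rsum_linl a : linear (rsum_act^~ a).
Proof. by move=> c u v; rewrite /rsum_act /= !ract_linl. Qed.
Lemma rsum_linr v : linear (rsum_act v).
Proof. by move=> c a b; rewrite /rsum_act /= !ract_linr. Qed.
Lemma rsum_act1 v : rsum_act v 1 = v.
Proof. by case: v => x y; rewrite /rsum_act /= !ract1. Qed.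
Lemma rsum_actM v a b : rsum_act v (a * b) = rsum_act (rsum_act v a) b.
Proof. by rewrite /rsum_act /= !ractM. Qed.
Definition rsum : rmod := RMod rsum_linl rsum_linr rsum_act1 rsum_actM.
End DirectSum.

Lemma ract0 (M : rmod) a : ract (0 : M) a = 0.
Proof.
have := @ract_linl M a (-1) 0 0.
by rewrite scaler0 addr0 scaleN1r addNr.
Qed.

Lemma ractN (M : rmod) (v : M) a : ract (- v) a = - ract v a.
Proof.
have := @ract_linl M a (-1) v 0.
by rewrite !scaleN1r !addr0 ract0 addr0.
Qed.

Lemma ractD (M : rmod) (u v : M) a : ract (u + v) a = ract u a + ract v a.
Proof. by have := @ract_linl M a 1 u v; rewrite !scale1r. Qed.

Lemma rhom0_lin (M N : rmod) : linear (fun _ : M => 0 : N).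
Proof. by move=> c x y; rewrite scaler0 addr0. Qed.
Definition rhom0 (M N : rmod) : rhom M N :=
  @RHom M N (lin_of (@rhom0_lin M N)) (fun v a => esym (ract0 N a)).

Section Opp.
Context (M N : rmod) (f : rhom M N).
Lemma rhom_opp_lin : linear (fun v => - f v).
Proof. by move=> c x y; rewrite linearP opprD scalerN. Qed.
Lemma rhom_opp_act v a : lin_of rhom_opp_lin (ract v a) = ract (lin_of rhom_opp_lin v) a.
Proof. by rewrite /= rfunP ractN. Qed.
Definition rhom_opp : rhom M N := RHom rhom_opp_act.
End Opp.

Definition submodule (M : rmod) (U : {vspace M}) : Prop :=
  forall v a, v \in U -> ract v a \in U.

Definition simple_submodule (M : rmod) (U : {vspace M}) : Prop :=
  [/\ submodule U, U <> 0%VS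
    & forall W, submodule W -> (W <= U)%VS -> W = 0%VS \/ W = U].

Definition maximal_submodule_of (M : rmod) (V U : {vspace M}) : Prop :=
  [/\ submodule U, (U <= V)%VS, U <> V
    & forall W, submodule W -> (U <= W)%VS -> (W <= V)%VS -> W = U \/ W = V].

Definition simple_rmod (M : rmod) : Prop := simple_submodule (fullv : {vspace M}).

Definition uniserial (M : rmod) : Prop :=
  forall U V : {vspace M}, submodule U -> submodule V ->
    (U <= V)%VS \/ (V <= U)%VS.

(* M has a composition series with l factors. *)
Definition has_length (M : rmod) (l : nat) : Prop :=
  exists U : nat -> {vspace M}, [/\ U 0 = 0%VS, U l = fullv
    & forall i, (i < l)%N -> maximal_submodule_of (U i.+1) (U i)].

Definition in_radical (M : rmod) (v : M) : Prop :=
  forall U, maximal_submodule_of fullv U -> v \in U.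

(* The sum of the simple submodules is the least submodule containing them. *)
Definition in_socle (M : rmod) (v : M) : Prop :=
  forall U : {vspace M}, submodule U ->
    (forall W, simple_submodule W -> (W <= U)%VS) -> v \in U.

Definition is_top (M T : rmod) : Prop :=
  exists2 f : rhom M T, surjective_rhom f & forall v, f v = 0 <-> in_radical v.

Definition is_socle (M S : rmod) : Prop :=
  exists2 f : rhom S M, injective f
    & forall v, in_socle v <-> exists w, f w = v.

Definition projective (P : rmod) : Prop :=
  forall (M N : rmod) (g : rhom M N) (f : rhom P N), surjective_rhom g ->
    exists h : rhom P M, forall v, g (h v) = f v.

Record proj_resolution (M : rmod) := ProjRes {
  pr_obj :> nat -> rmod;
  pr_d : forall i, rhom (pr_obj i.+1) (pr_obj i);
  pr_aug : rhom (pr_obj 0) M;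
  pr_proj : forall i, projective (pr_obj i);
  pr_surj : surjective_rhom pr_aug;
  pr_exact0 : forall x, pr_aug x = 0 <-> exists y, pr_d 0 y = x;
  pr_exactS : forall i x, pr_d i x = 0 <-> exists y, pr_d i.+1 y = x }.

Definition ext_cocycle (M N : rmod) (P : proj_resolution M) i
  (f : rhom (P i) N) : Prop := forall y, f (pr_d P i y) = 0.

Definition ext_coboundary (M N : rmod) (P : proj_resolution M) i :
  rhom (P i) N -> Prop :=
  match i with
  | 0 => fun f => forall x, f x = 0
  | j.+1 => fun f => exists g : rhom (P j) N, forall x, f x = g (pr_d P j x)
  end.

(* Ext^i(M, N) = 0, i.e. the complex Hom(P, N) is exact in degree i for a
   projective resolution P of M; by the comparison theorem the choice of P is
   immaterial.  For i = 0 this says Hom(M, N) = 0. *)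
Definition ext_vanishes (i : nat) (M N : rmod) : Prop :=
  exists P : proj_resolution M,
    forall f : rhom (P i) N, ext_cocycle f -> ext_coboundary f.

(* The first clause says that c |-> c * id is a bijection k -> Hom(M, M). *)
Definition exceptional (M : rmod) : Prop :=
  (forall f : rhom M M, exists! c : k, forall v, f v = c *: v) /\
  (forall i, (0 < i)%N -> ext_vanishes i M M).

Definition exceptional_seq (Ms : seq rmod) : Prop :=
  (forall t, (t < size Ms)%N -> exceptional (nth rzero Ms t)) /\
  (forall s t, (s < t < size Ms)%N ->
    forall i, ext_vanishes i (nth rzero Ms t) (nth rzero Ms s)).

Record complex := Complex {
  cx_obj :> int -> rmod;
  cx_d : forall i, rhom (cx_obj i) (cx_obj (i + 1));
  cx_dd : forall i x, cx_d (i + 1) (cx_d i x) = 0;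
  cx_bounded : exists b : nat, forall i, (b < `|i|)%N ->
    forall x : cx_obj i, x = 0 }.

Record cmap (X Y : complex) := CMap {
  cm :> forall i, rhom (X i) (Y i);
  cmP : forall i x, cm (i + 1) (cx_d X i x) = cx_d Y i (cm i x) }.

(* f induces an injective and surjective map on the cohomology in degree
   i + 1, for every integer i. *)
Definition quasi_iso (X Y : complex) (f : cmap X Y) : Prop :=
  forall i,
  (forall x, cx_d X (i + 1) x = 0 ->
     (exists z, cx_d Y i z = f (i + 1) x) -> exists w, cx_d X i w = x) /\
  (forall y, cx_d Y (i + 1) y = 0 ->
     exists x z, cx_d X (i + 1) x = 0 /\ y = f (i + 1) x + cx_d Y i z).

Section Stalk.
Context (M : rmod).
Definition stalk_obj (i : int) : rmod := if i == 0 then M else rzero.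
Lemma stalk_bounded : exists b : nat, forall i, (b < `|i|)%N ->
  forall x : stalk_obj i, x = 0.
Proof.
exists 0; rewrite /stalk_obj => i; rewrite absz_gt0 => /negbTE -> x.
exact: thinmx0.
Qed.
Definition stalk : complex := @Complex stalk_obj
  (fun i => rhom0 _ _) (fun i x => erefl) stalk_bounded.
End Stalk.

Section Shift.
Context (X : complex).
Definition shift_obj (i : int) : rmod := X (i + 1).
Definition shift_d i : rhom (shift_obj i) (shift_obj (i + 1)) :=
  rhom_opp (cx_d X (i + 1)).
Lemma shift_dd i x : shift_d (i + 1) (shift_d i x) = 0.
Proof. by rewrite /= linearN opprK cx_dd. Qed.
Lemma shift_bounded : exists b : nat, forall i, (b < `|i|)%N ->
  forall x : shift_obj i, x = 0.
Proof.
have [b hb] := cx_bounded X; exists b.+1 => i hi; apply: hb; lia.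
Qed.
Definition shift : complex := Complex shift_dd shift_bounded.
End Shift.

Section Cone.
Context (X Y : complex) (f : cmap X Y).
Definition cone_obj (i : int) : rmod := rsum (X (i + 1)) (Y i).
Definition cone_dfun i (v : cone_obj i) : cone_obj (i + 1) :=
  (- cx_d X (i + 1) v.1, f (i + 1) v.1 + cx_d Y i v.2).
Lemma cone_dlin i : linear (@cone_dfun i).
Proof.
move=> c u v; congr (_, _) => /=; first by rewrite linearP opprD scalerN.
by rewrite !linearP /= scalerDr addrACA.
Qed.
Lemma cone_dact i v a :
  lin_of (@cone_dlin i) (ract v a) = ract (lin_of (@cone_dlin i) v) a.
Proof. by congr (_, _) => /=; rewrite !rfunP ?ractN ?ractD. Qed.
Definition cone_d i : rhom (cone_obj i) (cone_obj (i + 1)) :=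
  RHom (@cone_dact i).
Lemma cone_dd i x : cone_d (i + 1) (cone_d i x) = 0.
Proof.
congr (_, _) => /=; first by rewrite linearN cx_dd !oppr0.
by rewrite linearN linearD cx_dd addr0 cmP addNr.
Qed.
Lemma cone_bounded : exists b : nat, forall i, (b < `|i|)%N ->
  forall x : cone_obj i, x = 0.
Proof.
have [b hb] := cx_bounded X; have [c hc] := cx_bounded Y.
exists (b + c).+1 => i hi [x y]; congr (_, _).
  by apply: hb; lia.
by apply: hc; lia.
Qed.
Definition cone : complex := Complex cone_dd cone_bounded.
End Cone.

(* The strictly full triangulated subcategories of the bounded derived
   category, given by their objects.  Two complexes are isomorphic in the
   derived category iff they are linked by a zigzag of quasi-isomorphisms, and
   the distinguished triangles are, up to isomorphism, X -> Y -> cone f -> X[1]. *)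
Record triangulated (S : complex -> Prop) : Prop := Triangulated {
  tr_zero : S (stalk rzero);
  tr_quasi_iso : forall X Y (f : cmap X Y), quasi_iso f -> (S X <-> S Y);
  tr_shift : forall X, S X <-> S (shift X);
  tr_cone : forall X Y (f : cmap X Y), S X -> S Y -> S (cone f) }.

Definition generates (Ms : seq rmod) : Prop :=
  forall S, triangulated S ->
    (forall t, (t < size Ms)%N -> S (stalk (nth rzero Ms t))) ->
    forall X, S X.

Definition full_exceptional_seq (Ms : seq rmod) : Prop :=
  exceptional_seq Ms /\ generates Ms.

Definition seq_iso (Ms Ns : seq rmod) : Prop := List.Forall2 riso Ms Ns.

End Modules.
Arguments rmod {k} A.

(* The objects satisfying P fall into exactly N classes for eqv. *)
Definition exactly_up_to (T : Type) (eqv : T -> T -> Prop) (P : T -> Prop)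
  (N : nat) : Prop :=
  exists r : 'I_N -> T, [/\ forall i, P (r i),
    forall i j, eqv (r i) (r j) -> i = j
  & forall x, P x -> exists i, eqv x (r i)].

Section BnModules.
Context {k : fieldType} (n : nat).
Implicit Types M : rmod (Balg k n).

Definition is_L (i : nat) M : Prop :=
  simple_rmod M /\ exists v : M, ract v (Bidem k n i) <> 0.

Definition uniserial2 M (i j : nat) : Prop :=
  [/\ uniserial M, has_length M 2,
      exists2 T, is_L i T & is_top M T
    & exists2 S, is_L j S & is_socle M S].

Definition is_Delta (i : nat) M : Prop := uniserial2 M i i.-1.

Definition is_nabla (i : nat) M : Prop := uniserial2 M i.-1 i.

End BnModules.

(* Main.v *)
(* Number the vertices 0, ..., m with m = n - 1, and let U and D be the sums of
   the arrows going up and down.  The standard module Delta a is resolved by the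
   projectives P_a <- P_(a+1) <- ... <- P_m, and the costandard module with top i
   by P_i <- ... <- P_0 <- P_0 <- ... <- P_m, so that Ext from either of them into
   any module N is the cohomology of a complex of the spaces N e_j whose maps are
   right multiplications by U, D or U D.  Hence all Ext groups between standard
   and costandard modules can be read off.
   The classes of the standard modules (equal to those of the costandard modules)
   are an orthonormal basis of the Grothendieck group for the Euler form: injective
   coresolutions show that dim Hom(Q, N) is the Euler form for projective Q, and
   splicing syzygies gives dim Hom(M, N) whenever the higher Ext groups vanish.  So
   an exceptional M has sum x_j^2 = 1 in this basis, hence the dimension vector of
   a standard module, and End M = k leaves only Delta, nabla and L(1).
   Generation is tested on the parity of the total dimension of X e, where e is the
   sum of the idempotents e_i with i >= j: it is even on an exceptional sequence
   missing the index j, and the complexes of even parity form a triangulated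
   subcategory.  Thus all indices occur, L(1) splits the sequence into a nabla part
   and a Delta part, and the Ext groups force the orders. *)

From mathcomp Require Import all_boot all_order all_algebra.
From mathcomp Require Import finmap monalg boolp zify.
Require Import Defs.
From Stdlib Require List.

Set Implicit Arguments.
Unset Strict Implicit.
Unset Printing Implicit Defensive.

Import Order.TTheory GRing.Theory Num.Theory.
Local Open Scope ring_scope.

(** * Linear algebra and finite-dimensional modules *)

(** Vanishing of Ext and generation are defined by quantifying over resolutions and over classes of
    complexes, so no derived functor or derived category is formed. Ext is exactness of Hom(P, N) on
    one fixed resolution, with a single comparison theorem; triangulated subcategories are used
    through short exact sequences of complexes. The quotient of the path algebra enters only through
    the record [zigzag]: relations, generation (to recognise homomorphisms) and the universal
    property [zact] (to build modules). The Euler form replaces a classification of indecomposables: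
    as an integral sum of squares it leaves an exceptional module at most one dimension at each of
    two neighbouring vertices. Injectivity of P_a for a < m and of the costandard module with socle
    m makes the needed dimensions computable, and bounds the injective dimension of simples by 2m,
    which stops the syzygy induction. Parity suffices for generation because modulo 2 the coordinate
    x_j is the dimension of M e with e the tail idempotent at j; without signs, shifts and cones are
    harmless. *)

Section LinearAlgebra.
Context {k : fieldType}.

(** A subspace of maximal dimension inside P exhausts P: adding a vector of P outside it would give
    a larger one. This turns predicates such as kernels or equivariance into [{vspace V}]. *)
Lemma subspace_vspace (V : vectType k) (P : V -> Prop) :
  P 0 -> (forall c u v, P u -> P v -> P (c *: u + v)) ->
  exists W : {vspace V}, forall v, v \in W <-> P v.
Proof.
move=> P0 PD.
pose good (d : nat) := `[< exists W : {vspace V}, (forall v, v \in W -> P v) /\ \dim W = d >].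
have ex : exists d, good d.
  by exists 0%N; apply/asboolP; exists 0%VS; split=> [v|]; rewrite ?dimv0 // memv0 => /eqP->.
have ub d : good d -> (d <= dim V)%N.
  by move=> /asboolP[W [_ <-]]; rewrite -dimvf dimvS ?subvf.
have [d /asboolP[W [WP dW]] dmax] := ex_maxnP ex ub.
exists W => v; split=> [/WP //|Pv]; apply/negPn/negP => vW.
have : good d.+1.
  apply/asboolP; exists (W + <[v]>)%VS; split.
    move=> _ /memv_addP[w wW [_ /vlineP[c ->] ->]].
    by rewrite addrC; apply: PD => //; apply: WP.
  rewrite dimv_disjoint_sum ?dim_vline.
    have v0 : v != 0 by apply: contraNneq vW => ->; rewrite mem0v.
    by rewrite v0 addn1 dW.
  apply/eqP; rewrite -subv0; apply/subvP => x; rewrite memv_cap memv0.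
  move=> /andP[xW /vlineP[c xc]]; rewrite xc scaler_eq0.
  by move: xW; rewrite xc rpredZeq (negbTE vW) orbF => ->.
by move/dmax; rewrite ltnn.
Qed.

(** Formulated for subspaces so that it applies both to Hom spaces inside all linear maps and to the
    components M a inside M. *)
Lemma dim_ses (U V W : vectType k) (A : {vspace U}) (B : {vspace V})
    (C : {vspace W}) (f : {linear U -> V}) (g : {linear V -> W}) :
  (forall u, u \in A -> f u = 0 -> u = 0) ->
  (forall u, u \in A -> f u \in B /\ g (f u) = 0) ->
  (forall v, v \in B -> g v = 0 -> exists2 u, u \in A & f u = v) ->
  (forall v, v \in B -> g v \in C) ->
  (forall w, w \in C -> exists2 v, v \in B & g v = w) ->
  \dim B = (\dim A + \dim C)%N.
Proof.
move=> finj fB fex gC gex.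
rewrite -(limg_ker_dim (linfun g) B).
have -> : (linfun g @: B)%VS = C.
  apply/vspaceP => w; apply/idP/idP => [/memv_imgP[v vB ->]|/gex[v vB <-]].
    by rewrite lfunE; apply: gC.
  by rewrite -[g v]lfunE memv_img.
congr (_ + _)%N.
have -> : (B :&: lker (linfun g))%VS = (linfun f @: A)%VS.
  apply/vspaceP => v; rewrite memv_cap memv_ker lfunE.
  apply/andP/idP => [[vB /eqP gv]|/memv_imgP[u uA ->]].
    by have [u uA <-] := fex v vB gv; rewrite -[f u]lfunE memv_img.
  by rewrite lfunE; have [fuB gfu] := fB u uA; split=> //; apply/eqP.
rewrite -(limg_ker_dim (linfun f) A).
suff -> : (A :&: lker (linfun f))%VS = 0%VS by rewrite dimv0.
apply/eqP; rewrite -subv0; apply/subvP => u; rewrite memv_cap memv_ker lfunE memv0.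
by move=> /andP[uA /eqP fu]; apply/eqP/finj.
Qed.

Lemma inj_retract (U V : vectType k) (f : {linear U -> V}) :
  injective f -> exists r : {linear V -> U}, forall u, r (f u) = u.
Proof.
move=> finj; exists ((linfun f)^-1%VF : {linear V -> U}) => u.
have h : lker (linfun f) == 0%VS.
  by apply/lker0P => x y; rewrite !lfunE; apply: finj.
by rewrite -[f u]lfunE; apply: lker0_lfunK.
Qed.

End LinearAlgebra.

(** * Submodules, quotients and short exact sequences of right modules *)

Section RightModules.
Context {k : fieldType} {A : algType k}.
Implicit Types M N X Y Z : rmod A.

Lemma ractZ M c (v : M) a : ract (c *: v) a = c *: ract v a.
Proof. by have := ract_linl a c v 0; rewrite !addr0 ract0 addr0. Qed.

Lemma ract_sum M (I : Type) (r : seq I) (P : pred I) (F : I -> M) a :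
  ract (\sum_(i <- r | P i) F i) a = \sum_(i <- r | P i) ract (F i) a.
Proof. exact: (big_morph (fun v => ract v a) (fun u v => ractD u v a) (ract0 M a)). Qed.

Lemma ractDr M (v : M) a b : ract v (a + b) = ract v a + ract v b.
Proof. by have := ract_linr v 1 a b; rewrite !scale1r. Qed.

Lemma ractr0 M (v : M) : ract v 0 = 0.
Proof.
by have := ract_linr v (-1) 0 0; rewrite scaler0 addr0 scaleN1r addNr.
Qed.

Lemma ractr_sum M (v : M) (I : Type) (r : seq I) (P : pred I) (F : I -> A) :
  ract v (\sum_(i <- r | P i) F i) = \sum_(i <- r | P i) ract v (F i).
Proof. exact: (big_morph (ract v) (ractDr v) (ractr0 v)). Qed.

Definition mk_rhom M N (f : M -> N) (fl : linear f)
  (fa : forall v a, f (ract v a) = ract (f v) a) : rhom M N :=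
  @RHom k A M N (lin_of fl) fa.

Definition rid M : rhom M M := @mk_rhom M M id (fun _ _ _ => erefl) (fun _ _ => erefl).

Lemma rcomp_lin M N X (g : rhom N X) (f : rhom M N) : linear (fun v => g (f v)).
Proof. by move=> c u v; rewrite !linearP. Qed.
Lemma rcomp_act M N X (g : rhom N X) (f : rhom M N) v a :
  g (f (ract v a)) = ract (g (f v)) a.
Proof. by rewrite !rfunP. Qed.
Definition rcomp M N X (g : rhom N X) (f : rhom M N) : rhom M X :=
  mk_rhom (rcomp_lin g f) (rcomp_act g f).

Lemma rsub_lin M N (f g : rhom M N) : linear (fun v => f v - g v).
Proof. by move=> c u v; rewrite (linearP f) (linearP g) scalerBr opprD addrACA. Qed.
Lemma rsub_act M N (f g : rhom M N) v a :
  f (ract v a) - g (ract v a) = ract (f v - g v) a.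
Proof. by rewrite !rfunP ractD ractN. Qed.
Definition rsub M N (f g : rhom M N) : rhom M N :=
  mk_rhom (rsub_lin f g) (rsub_act f g).

Lemma radd_lin M N (f g : rhom M N) : linear (fun v => f v + g v).
Proof. by move=> c u v; rewrite (linearP f) (linearP g) scalerDr addrACA. Qed.
Lemma radd_act M N (f g : rhom M N) v a :
  f (ract v a) + g (ract v a) = ract (f v + g v) a.
Proof. by rewrite !rfunP ractD. Qed.
Definition radd M N (f g : rhom M N) : rhom M N :=
  mk_rhom (radd_lin f g) (radd_act f g).

Lemma riso_sym M N : riso M N -> riso N M.
Proof.
move=> [f [g fg gf]].
have gl : linear g.
  by move=> c u v; apply: (can_inj fg); rewrite gf linearP !gf.
have ga v a : g (ract v a) = ract (g v) a.
  by apply: (can_inj fg); rewrite gf rfunP gf.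
by exists (mk_rhom gl ga); exists f.
Qed.

Lemma riso_trans M N X : riso M N -> riso N X -> riso M X.
Proof.
by move=> [f fb] [g gb]; exists (rcomp g f); apply: (bij_comp gb fb).
Qed.

Lemma riso_refl M : riso M M.
Proof. by exists (rid M); exists id. Qed.

Lemma bij_of_inj_surj (U V : Type) (f : U -> V) :
  injective f -> (forall v, exists u, f u = v) -> bijective f.
Proof.
move=> fi /choice[g fg]; exists g => // u.
by apply: fi; rewrite fg.
Qed.

Lemma exists_sub M (U : {vspace M}) : submodule U ->
  exists (X : rmod A) (f : rhom X M), injective f /\
    forall v, v \in U <-> exists x, f x = v.
Proof.
move=> hU.
pose act (x : subvs_of U) (a : A) : subvs_of U := vsproj U (ract (vsval x) a).
have actE x a : vsval (act x a) = ract (vsval x) a.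
  by rewrite /act vsprojK // hU // subvsP.
have h1 a : linear (act^~ a).
  by move=> c u v; apply: val_inj; rewrite /= !actE linearP ract_linl.
have h2 x : linear (act x).
  by move=> c a b; apply: val_inj; rewrite /= !actE ract_linr.
have h3 x : act x 1 = x by apply: val_inj; rewrite /= actE ract1.
have h4 x a b : act x (a * b) = act (act x a) b.
  by apply: val_inj; rewrite /= !actE ractM.
pose X := RMod h1 h2 h3 h4.
have fl : linear (vsval : X -> M) by move=> c u v; rewrite linearP.
exists X, (@mk_rhom X M vsval fl actE); split; first exact: val_inj.
move=> v; split=> [vU|[x <-]]; last exact: subvsP.
by exists (vsproj U v); apply: vsprojK.
Qed.

(** The quotient is carried by the complement of U, with the action followed by the projection along
    U. *)
Lemma exists_quot M (U : {vspace M}) : submodule U ->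
  exists (X : rmod A) (f : rhom M X), surjective_rhom f /\
    forall v, f v = 0 <-> v \in U.
Proof.
move=> hU; set W := (U^C)%VS.
pose p (v : M) : subvs_of W := vsproj W (v - projv U v).
have decomp v : projv U v + daddv_pi W U v = v.
  by apply: daddv_pi_add; rewrite ?capv_compl ?addv_complf ?memvf.
have pE v : vsval (p v) = v - projv U v.
  by rewrite /p vsprojK // memv_projC.
have pl : linear p.
  move=> c u v; apply: val_inj; rewrite /= !pE.
  by rewrite linearP scalerBr opprD addrACA.
have pK (x : subvs_of W) : p (vsval x) = x.
  apply: val_inj; rewrite /= pE.
  have -> : projv U (vsval x) = 0; last by rewrite subr0.
  have := decomp (vsval x); rewrite daddv_pi_id ?subvsP //.
    by move/(canRL (addrK _)); rewrite subrr.
  by rewrite capvC capv_compl.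
have p0 v : p v = 0 <-> v \in U.
  split=> [/(congr1 vsval)|vU].
    by rewrite pE => /eqP; rewrite subr_eq0 => /eqP->; apply: memv_proj.
  by apply: val_inj; rewrite /= pE projv_id // subrr.
pose act (x : subvs_of W) (a : A) : subvs_of W := p (ract (vsval x) a).
pose pL := lin_of pl.
have pa v a : p (ract v a) = act (p v) a.
  apply/eqP; rewrite -subr_eq0 -[p (ract v a)]/(pL _) -[act _ _]/(pL _) -linearB.
  by apply/eqP/p0; rewrite -ractN -ractD hU // pE opprB addrC subrK memv_proj.
have h1 a : linear (act^~ a).
  by move=> c u v; rewrite /act linearP ract_linl pl.
have h2 x : linear (act x).
  by move=> c a b; rewrite /act ract_linr pl.
have h3 x : act x 1 = x by rewrite /act ract1.
have h4 x a b : act x (a * b) = act (act x a) b.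
  by rewrite -pa /act ractM.
pose X := RMod h1 h2 h3 h4.
exists X, (@mk_rhom M X p pl pa); split=> // x.
by exists (vsval x); apply: pK.
Qed.

Definition ses X Y Z (f : rhom X Y) (g : rhom Y Z) : Prop :=
  [/\ injective f, surjective_rhom g & forall y, g y = 0 <-> exists x, f x = y].

Lemma rhom_lift_inj X Y Z (f : rhom X Y) (h : rhom Z Y) : injective f ->
  (forall z, exists x, f x = h z) -> exists g : rhom Z X, forall z, f (g z) = h z.
Proof.
move=> fi /choice[g gE].
have gl : linear g by move=> c u v; apply: fi; rewrite gE !linearP !gE.
have ga v a : g (ract v a) = ract (g v) a by apply: fi; rewrite gE !rfunP gE.
by exists (mk_rhom gl ga).
Qed.

Lemma rhom_factor_surj X Y Z (f : rhom X Y) (h : rhom X Z) : surjective_rhom f ->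
  (forall x, f x = 0 -> h x = 0) -> exists g : rhom Y Z, forall x, g (f x) = h x.
Proof.
move=> /choice[s fs] fh.
have hE x y : f x = f y -> h x = h y.
  by move=> e; apply/eqP; rewrite -subr_eq0 -linearB fh // linearB e subrr.
pose g y := h (s y).
have gE x : g (f x) = h x by apply: hE; rewrite fs.
have gl : linear g.
  move=> c u v; have -> : c *: u + v = f (c *: s u + s v) by rewrite linearP !fs.
  by rewrite gE linearP.
have ga v a : g (ract v a) = ract (g v) a.
  by rewrite -[v]fs -rfunP !gE rfunP.
by exists (mk_rhom gl ga).
Qed.

(** K is the kernel of g, that is the image of f. Applied to the maps of a resolution it produces
    the syzygies. *)
Lemma exists_ses_sub X Y Z (f : rhom X Y) (g : rhom Y Z) :
  (forall y, g y = 0 <-> exists x, f x = y) ->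
  exists (K : rmod A) (i : rhom K Y) (p : rhom X K),
    [/\ injective i, (forall y, g y = 0 <-> exists u, i u = y),
        surjective_rhom p & forall x, i (p x) = f x].
Proof.
move=> ex; have [|U hU] := @subspace_vspace k Y (fun y => g y = 0) (linear0 g).
  by move=> c u v gu gv; rewrite linearP gu gv scaler0 addr0.
have sU : submodule U by move=> v a /hU gv; apply/hU; rewrite rfunP gv ract0.
have [K [i [ii iU]]] := exists_sub sU.
have [|p pE] := @rhom_lift_inj K Y X i f ii.
  by move=> x; apply/iU/hU/ex; exists x.
exists K, i, p; split=> // [y|u].
  by split=> [/hU/iU|/iU/hU].
have /ex[x fx] : g (i u) = 0 by apply/hU/iU; exists u.
by exists x; apply: ii; rewrite pE.
Qed.

Lemma projective_lift P X Y Z (f : rhom X Y) (g : rhom Y Z) (h : rhom P Y) :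
  projective P -> (forall y, g y = 0 <-> exists x, f x = y) ->
  (forall p, g (h p) = 0) -> exists l : rhom P X, forall p, f (l p) = h p.
Proof.
move=> pP ex gh; have [K [i [p [ii iU ps pE]]]] := exists_ses_sub ex.
have [|h' h'E] := @rhom_lift_inj _ _ _ i h ii; first by move=> z; apply/iU.
have [l lE] := pP _ _ p h' ps.
by exists l => x; rewrite -pE lE h'E.
Qed.

End RightModules.

(** * Comparison of projective resolutions *)

Arguments pr_proj {k A M} p i [M0 N g] f _ : rename.
Arguments pr_exact0 {k A M} p x.
Arguments pr_exactS {k A M} p i x.

Section Comparison.
Context {k : fieldType} {A : algType k}.
Implicit Types M N X Y Z : rmod A.

Lemma riso_inv M N : riso M N ->
  exists (f : rhom M N) (g : rhom N M), cancel f g /\ cancel g f.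
Proof.
move=> [f [g fg gf]].
have gl : linear g.
  by move=> c u v; apply: (can_inj fg); rewrite gf linearP !gf.
have ga v a : g (ract v a) = ract (g v) a.
  by apply: (can_inj fg); rewrite gf rfunP gf.
by exists f, (mk_rhom gl ga).
Qed.

(** The condition inside [ext_vanishes] for a given P; by [ext_vanishesE] every choice of P gives
    the same answer. *)
Definition exact_at M (P : proj_resolution M) N i : Prop :=
  forall f : rhom (P i) N, ext_cocycle f -> ext_coboundary f.

(** The degree i component of a chain map over phi. The lower components stay under an existential,
    so that no dependent family of maps has to be built. *)
Fixpoint lifts M M' (phi : rhom M M') (P : proj_resolution M)
    (Q : proj_resolution M') (i : nat) : rhom (P i) (Q i) -> Prop :=
  match i with
  | 0 => fun f => forall x, pr_aug Q (f x) = phi (pr_aug P x)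
  | j.+1 => fun f => exists2 f', lifts phi f' &
              forall x, pr_d Q j (f x) = f' (pr_d P j x)
  end.

Lemma pr_dd M (P : proj_resolution M) i x : pr_d P i (pr_d P i.+1 x) = 0.
Proof. by apply/pr_exactS; exists x. Qed.

Lemma pr_aug_d M (P : proj_resolution M) x : pr_aug P (pr_d P 0 x) = 0.
Proof. by apply/pr_exact0; exists x. Qed.

Lemma lifts_step M M' (phi : rhom M M') (P : proj_resolution M)
    (Q : proj_resolution M') i (f : rhom (P i) (Q i)) : lifts phi f ->
  exists2 f' : rhom (P i.+1) (Q i.+1), lifts phi f' &
    forall x, pr_d Q i (f' x) = f (pr_d P i x).
Proof.
move=> fl; suff [f' f'E] : exists f' : rhom (P i.+1) (Q i.+1),
    forall x, pr_d Q i (f' x) = rcomp f (pr_d P i) x.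
  by exists f' => //; exists f.
case: i f fl => [|i] f /= => [fE|[f' _ fE]].
  apply: (projective_lift (h := rcomp f (pr_d P 0)) (pr_proj P 1) (pr_exact0 Q)) => p /=.
  by rewrite fE pr_aug_d linear0.
apply: (projective_lift (h := rcomp f (pr_d P i.+1)) (pr_proj P i.+2) (pr_exactS Q i)) => p /=.
by rewrite fE pr_dd linear0.
Qed.

Lemma lifts_exist M M' (phi : rhom M M') (P : proj_resolution M)
    (Q : proj_resolution M') i : exists f : rhom (P i) (Q i), lifts phi f.
Proof.
elim: i => [|i [f /lifts_step[f' f'l _]]]; last by exists f'.
exact: (pr_proj P 0 (rcomp phi (pr_aug P)) (pr_surj Q)).
Qed.

Lemma lifts_comp M1 M2 M3 (phi : rhom M1 M2) (psi : rhom M2 M3)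
    (P : proj_resolution M1) (Q : proj_resolution M2) (R : proj_resolution M3)
    i (f : rhom (P i) (Q i)) (g : rhom (Q i) (R i)) :
  lifts phi f -> lifts psi g -> lifts (rcomp psi phi) (rcomp g f).
Proof.
elim: i f g => [|i IH] f g /= => [fE gE x|[f' f'l fE] [g' g'l gE]].
  by rewrite gE fE.
by exists (rcomp g' f'); [apply: IH | move=> x /=; rewrite gE fE].
Qed.

Lemma lifts_sub_id M (phi : rhom M M) (P : proj_resolution M)
    i (f : rhom (P i) (P i)) :
  lifts phi f -> lifts (rsub phi (rid M)) (rsub f (rid _)).
Proof.
elim: i f => [|i IH] f /= => [fE x|[f' f'l fE]].
  by rewrite linearB fE.
by exists (rsub f' (rid _)); [apply: IH | move=> x /=; rewrite linearB fE].
Qed.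

(** The null-homotopy is built degree by degree: with f' = d h' + h'' d one degree lower, f - h' d
    is killed by the differential and lifts. The [match] only separates degree 0, where the term h'
    d is absent. *)
Lemma lifts_null M M' (phi : rhom M M') (P : proj_resolution M)
    (Q : proj_resolution M') : (forall x, phi x = 0) ->
  forall i (f : rhom (P i) (Q i)), lifts phi f ->
  exists h : rhom (P i) (Q i.+1),
  match i return rhom (P i) (Q i) -> rhom (P i) (Q i.+1) -> Prop with
  | 0 => fun f h => forall x, f x = pr_d Q 0 (h x)
  | j.+1 => fun f h => exists h' : rhom (P j) (Q j.+1),
              forall x, f x = pr_d Q j.+1 (h x) + h' (pr_d P j x)
  end f h.
Proof.
move=> phi0; elim=> [|i IH] f /= => [fE|[f' f'l fE]].
  have [|h hE] := projective_lift (h := f) (pr_proj P 0) (pr_exact0 Q).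
    by move=> p; rewrite fE phi0.
  by exists h => x; rewrite hE.
have [h' h'E] := IH _ f'l.
have [|h hE] := projective_lift (h := rsub f (rcomp h' (pr_d P i)))
  (pr_proj P i.+1) (pr_exactS Q i).
  move=> p /=; rewrite linearB /= fE; move: p h'E {IH fE}.
  case: i f f' f'l h' => [|i] f f' f'l h' /= p => [h'E|[h'' h'E]].
    by rewrite h'E subrr.
  by rewrite h'E pr_dd linear0 addr0 subrr.
by exists h, h' => x; rewrite hE /= subrK.
Qed.

(** Comparison theorem. A cocycle c on Q is pulled back to P along f, bounded there, and brought
    back along g. Since f g - id = d h + h' d and c kills the part d h, the remaining difference c
    h' d is a coboundary. *)
Lemma exact_at_iso M M' N N' (P : proj_resolution M) (Q : proj_resolution M') i :
  riso M M' -> riso N N' -> exact_at P N i -> exact_at Q N' i.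
Proof.
move=> /riso_inv[u [v [uv vu]]] /riso_inv[w' [w [w'w ww']]] ex c cc.
have [f fl] := lifts_exist u P Q i; have [g gl] := lifts_exist v Q P i.
have [f1 _ f1E] := lifts_step fl.
have c1 : ext_cocycle (rcomp w (rcomp c f)).
  by move=> y /=; rewrite -f1E cc linear0.
have nul := lifts_sub_id (lifts_comp gl fl).
have [|h] := lifts_null _ nul; first by move=> x /=; rewrite vu subrr.
case: i P Q f g c f1 h ex fl gl cc f1E c1 nul => [|i] P Q f g c f1 h ex fl gl cc f1E c1 _ /=.
  move=> hE x; have := ex _ c1 (g x) => /= /(congr1 w').
  rewrite ww' linear0 => cfg.
  have := congr1 c (hE x); rewrite linearB cfg /= cc sub0r => /eqP.
  by rewrite oppr_eq0 => /eqP.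
move=> [h' hE]; have [b bE] := ex _ c1; have [g' _ gE] := gl.
exists (rsub (rcomp w' (rcomp b g')) (rcomp c h')) => x /=.
have := congr1 c (hE x); rewrite linearB linearD cc add0r /=.
have := bE (g x); rewrite /= gE => <-; rewrite ww'.
by move=> <-; rewrite subKr.
Qed.

Lemma exists_res_iso M M' : riso M M' -> proj_resolution M ->
  inhabited (proj_resolution M').
Proof.
move=> [u [v uv vu]] P.
have s : surjective_rhom (rcomp u (pr_aug P)).
  by move=> y; have [x xE] := pr_surj P (v y); exists x; rewrite /= xE vu.
have e x : rcomp u (pr_aug P) x = 0 <-> exists y, pr_d P 0 y = x.
  rewrite -pr_exact0 /=; split=> [ux|->]; last exact: linear0.
  by apply: (can_inj uv); rewrite ux linear0.
by constructor; apply: (ProjRes (pr_proj P) s e (pr_exactS P)).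
Qed.

Lemma ext_vanishesE M M' N N' (P : proj_resolution M) i :
  riso M M' -> riso N N' -> ext_vanishes i M' N' <-> exact_at P N i.
Proof.
move=> iM iN; split=> [[Q ex]|ex].
  by apply: (exact_at_iso (riso_sym iM) (riso_sym iN)); apply: ex.
have [Q] := exists_res_iso iM P; exists Q.
exact: (exact_at_iso iM iN ex).
Qed.

Lemma ses_zero X Y Z (f : rhom X Y) (g : rhom Y Z) x : ses f g -> g (f x) = 0.
Proof. by move=> [_ _ ex]; apply/ex; exists x. Qed.

(* Hom(P, -) is exact, so the long exact sequence in the second variable can be
   chased on a fixed resolution. *)
Lemma exact_at_ses M (P : proj_resolution M) X Y Z (f : rhom X Y) (g : rhom Y Z) i :
  ses f g -> exact_at P X i.+1 -> exact_at P Z i.+1 -> exact_at P Y i.+1.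
Proof.
move=> fg exX exZ c cc; have [fi gs ex] := fg.
have [|b bE] := exZ (rcomp g c); first by move=> y /=; rewrite cc linear0.
have [b' b'E] := pr_proj P i b gs.
pose c' := rsub c (rcomp b' (pr_d P i)).
have [|a aE] := rhom_lift_inj (h := c') fi.
  by move=> z; apply/ex; rewrite linearB /= b'E -bE /= subrr.
have [|a' a'E] := exX a.
  by move=> y; apply: fi; rewrite aE /= cc pr_dd !linear0 addr0.
exists (radd (rcomp f a') b') => x /=.
by have := aE x; rewrite a'E /= => ->; rewrite subrK.
Qed.

(** The part Ext^(i+1)(M, Z) -> Ext^(i+2)(M, X) -> Ext^(i+2)(M, Y) of the long exact sequence. Along
    an injective coresolution it is dimension shifting. *)
Lemma exact_at_shift M (P : proj_resolution M) X Y Z (f : rhom X Y) (g : rhom Y Z) i :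
  ses f g -> exact_at P Y i.+2 -> exact_at P Z i.+1 -> exact_at P X i.+2.
Proof.
move=> fg exY exZ c cc; have [fi gs ex] := fg.
have [|b bE] := exY (rcomp f c); first by move=> y /=; rewrite cc linear0.
have [|a aE] := exZ (rcomp g b).
  by move=> y /=; rewrite -bE /= (ses_zero _ fg).
have [a' a'E] := pr_proj P i a gs.
have [|e eE] := rhom_lift_inj (h := rsub b (rcomp a' (pr_d P i))) fi.
  by move=> z; apply/ex; rewrite linearB /= a'E -aE /= subrr.
exists e => x; apply: fi; rewrite eE /= pr_dd linear0 subr0.
exact: bE.
Qed.

Definition injective_rmod I : Prop :=
  forall X Y (f : rhom X Y) (g : rhom X I), injective f ->
    exists h : rhom Y I, forall x, h (f x) = g x.

(** A cocycle factors through the image K of the differential, and injectivity of I extends it from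
    K to P i. *)
Lemma exact_at_injective M (P : proj_resolution M) I i :
  injective_rmod I -> exact_at P I i.+1.
Proof.
move=> hI c cc.
have ex : exists (K : rmod A) (j : rhom K (P i)) (p : rhom (P i.+1) K),
    [/\ injective j, surjective_rhom p & forall x, j (p x) = pr_d P i x].
  case: i c cc => [|i] c cc.
    by have [K [j [p [? _ ? ?]]]] := exists_ses_sub (pr_exact0 P); exists K, j, p.
  by have [K [j [p [? _ ? ?]]]] := exists_ses_sub (pr_exactS P i); exists K, j, p.
have [K [j [p [ji ps jp]]]] := ex.
have [|g gE] := rhom_factor_surj (h := c) ps.
  move=> x px; have /pr_exactS[y <-] : pr_d P i x = 0 by rewrite -jp px linear0.
  exact: cc.
by have [h hE] := hI _ _ j g ji; exists h => x; rewrite -jp hE gE.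
Qed.

End Comparison.

(** * Dimensions of Hom spaces *)

Section HomDimensions.
Context {k : fieldType} {A : algType k}.
Implicit Types M N X Y Z : rmod A.

Lemma hom_space_subproof M N : exists W : {vspace 'Hom(M, N)},
  forall f : 'Hom(M, N), f \in W <-> forall v a, f (ract v a) = ract (f v) a.
Proof.
apply: subspace_vspace => [v a|c f g fP gP v a]; first by rewrite !lfunE /= ract0.
by rewrite !lfunE /= !lfunE /= fP gP ract_linl.
Qed.

Definition hom_space M N : {vspace 'Hom(M, N)} :=
  projT1 (cid (hom_space_subproof M N)).

Lemma hom_spaceP M N (f : 'Hom(M, N)) :
  f \in hom_space M N <-> forall v a, f (ract v a) = ract (f v) a.
Proof. exact: (projT2 (cid (hom_space_subproof M N))). Qed.

Definition hdim M N : nat := \dim (hom_space M N).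

Lemma linfun_hom_space M N (f : rhom M N) : linfun f \in hom_space M N.
Proof. by apply/hom_spaceP => v a; rewrite !lfunE /= rfunP. Qed.

Lemma hom_space_rhom M N (f : 'Hom(M, N)) : f \in hom_space M N ->
  exists g : rhom M N, forall v, g v = f v.
Proof. by move=> /hom_spaceP fP; exists (@RHom k A M N f fP). Qed.

(** Hom is left exact; the lifting hypothesis supplies surjectivity of Hom(M, Y) -> Hom(M, Z) and
    comes from projectivity of M. *)
Lemma hdim_ses_r M X Y Z (f : rhom X Y) (g : rhom Y Z) : ses f g ->
  (forall h : rhom M Z, exists l : rhom M Y, forall v, g (l v) = h v) ->
  hdim M Y = (hdim M X + hdim M Z)%N.
Proof.
move=> [fi gs ex] lift.
have Fl : linear (fun h : 'Hom(M, X) => (linfun f \o h)%VF).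
  by move=> c u v; rewrite comp_lfunDr comp_lfunZr.
have Gl : linear (fun h : 'Hom(M, Y) => (linfun g \o h)%VF).
  by move=> c u v; rewrite comp_lfunDr comp_lfunZr.
apply: (dim_ses (f := lin_of Fl) (g := lin_of Gl)) => /=.
- move=> h _ /lfunP h0; apply/lfunP => v; apply: fi.
  by have := h0 v; rewrite !comp_lfunE !lfunE /= linear0.
- move=> h /hom_spaceP hP; split.
    by apply/hom_spaceP => v a; rewrite !comp_lfunE !lfunE /= hP rfunP.
  by apply/lfunP => v; rewrite !comp_lfunE !lfunE /=; apply/ex; exists (h v).
- move=> h /hom_space_rhom[h' h'E] /lfunP h0.
  have [|l lE] := rhom_lift_inj (h := h') fi.
    by move=> v; apply/ex; have := h0 v; rewrite !comp_lfunE !lfunE /= h'E.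
  exists (linfun l); first exact: linfun_hom_space.
  by apply/lfunP => v; rewrite !comp_lfunE !lfunE /= lE h'E.
- by move=> h /hom_spaceP hP; apply/hom_spaceP => v a; rewrite !comp_lfunE !lfunE /= hP rfunP.
- move=> h /hom_space_rhom[h' h'E]; have [l lE] := lift h'.
  exists (linfun l); first exact: linfun_hom_space.
  by apply/lfunP => v; rewrite !comp_lfunE !lfunE /= lE h'E.
Qed.

Lemma hdim_ses_l X Y Z N (f : rhom X Y) (g : rhom Y Z) : ses f g ->
  (forall h : rhom X N, exists l : rhom Y N, forall v, l (f v) = h v) ->
  hdim Y N = (hdim X N + hdim Z N)%N.
Proof.
move=> [fi gs ex] ext; rewrite addnC.
have Fl : linear (fun h : 'Hom(Z, N) => (h \o linfun g)%VF).
  by move=> c u v; rewrite comp_lfunDl comp_lfunZl.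
have Gl : linear (fun h : 'Hom(Y, N) => (h \o linfun f)%VF).
  by move=> c u v; rewrite comp_lfunDl comp_lfunZl.
apply: (dim_ses (f := lin_of Fl) (g := lin_of Gl)) => /=.
- move=> h _ /lfunP h0; apply/lfunP => v; have [y <-] := gs v.
  by have := h0 y; rewrite !comp_lfunE !lfunE /=.
- move=> h /hom_spaceP hP; split.
    by apply/hom_spaceP => v a; rewrite !comp_lfunE !lfunE /= rfunP hP.
  apply/lfunP => v; rewrite !comp_lfunE !lfunE /=.
  by rewrite (proj2 (ex (f v))) ?linear0 //; exists v.
- move=> h /hom_space_rhom[h' h'E] /lfunP h0.
  have [|l lE] := rhom_factor_surj (h := h') gs.
    by move=> y /ex[x <-]; have := h0 x; rewrite !comp_lfunE !lfunE /= h'E.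
  exists (linfun l); first exact: linfun_hom_space.
  by apply/lfunP => v; rewrite !comp_lfunE !lfunE /= lE h'E.
- by move=> h /hom_spaceP hP; apply/hom_spaceP => v a; rewrite !comp_lfunE !lfunE /= rfunP hP.
- move=> h /hom_space_rhom[h' h'E]; have [l lE] := ext h'.
  exists (linfun l); first exact: linfun_hom_space.
  by apply/lfunP => v; rewrite !comp_lfunE !lfunE /= lE h'E.
Qed.

Lemma hdim_brick M : (forall f : rhom M M, exists! c : k, forall v, f v = c *: v) ->
  hdim M M = 1%N.
Proof.
move=> brick; suff E : hom_space M M = <[ \1%VF : 'Hom(M, M) ]>%VS.
  (* The uniqueness of the scalar excludes M = 0, where both 0 and 1 would represent the
     identity. *)
  rewrite /hdim E dim_vline; case: eqP => //= id0.
  have [c [_ cU]] := brick (rid M).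
  have v0 (v : M) : v = 0 by rewrite -[v]id_lfunE id0 lfunE.
  have c0 : c = 0 by apply: cU => v; rewrite [LHS]v0 [RHS]v0.
  have c1 : c = 1 by apply: cU => v; rewrite [LHS]v0 [RHS]v0.
  by move/eqP: c1; rewrite c0 eq_sym oner_eq0.
apply/vspaceP => f; apply/idP/vlineP => [/hom_space_rhom[g gE]|[c ->]].
  have [c [cE _]] := brick g; exists c; apply/lfunP => v.
  by rewrite -gE cE !lfunE /= lfunE.
by apply/hom_spaceP => v a; rewrite !lfunE /= !lfunE /= ractZ.
Qed.

(** Meant for idempotents a: single vertices for dimension vectors, sums of vertices for the parity
    test. *)
Definition comp_space M (a : A) : {vspace M} := limg (linfun (lin_of (ract_linl (r := M) a))).

Definition wd M (a : A) : nat := \dim (comp_space M a).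

Lemma comp_spaceP M a v : a * a = a -> v \in comp_space M a <-> ract v a = v.
Proof.
move=> aa; split=> [/memv_imgP[u _ ->]|<-]; rewrite /comp_space.
  by rewrite lfunE /= -ractM aa.
have -> : ract v a = linfun (lin_of (ract_linl (r := M) a)) v by rewrite lfunE.
by apply/memv_img/memvf.
Qed.

(** For an idempotent a the functor M -> M a is exact: a preimage v of an element of Z a may be
    replaced by v a. *)
Lemma wd_ses X Y Z (f : rhom X Y) (g : rhom Y Z) a : a * a = a -> ses f g ->
  wd Y a = (wd X a + wd Z a)%N.
Proof.
move=> aa [fi gs ex]; apply: (dim_ses (f := f) (g := g)).
- by move=> u _ fu; apply: fi; rewrite fu linear0.
- move=> u /(comp_spaceP _ aa) ua; split; last by apply/ex; exists u.
  by apply/(comp_spaceP _ aa); rewrite -rfunP ua.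
- move=> v /(comp_spaceP _ aa) va /ex[x fx]; exists x => //.
  by apply/(comp_spaceP _ aa)/fi; rewrite rfunP fx va.
- by move=> v /(comp_spaceP _ aa) va; apply/(comp_spaceP _ aa); rewrite -rfunP va.
- move=> w /(comp_spaceP _ aa) wa; have [v vE] := gs w.
  exists (ract v a); last by rewrite rfunP vE.
  by apply/(comp_spaceP _ aa); rewrite -ractM aa.
Qed.

Lemma wd_iso M N a : a * a = a -> riso M N -> wd M a = wd N a.
Proof.
move=> aa /riso_inv[f [g [fg gf]]].
rewrite (@wd_ses M N rzero f (rhom0 _ _)) //.
  suff -> : wd rzero a = 0%N by rewrite addn0.
  apply/eqP; rewrite -leqn0 (leq_trans (dimvS (subvf _))) // dimvf.
  by rewrite dim_matrix.
split=> [|x|y]; first exact: can_inj fg.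
  by exists 0; rewrite [x]thinmx0 /=.
by split=> // _; exists (g y).
Qed.

End HomDimensions.

(** * Zigzag algebras and their string modules *)

(* The operators v |-> v e_i, v |-> v U and v |-> v D of a right module, where U
   is the sum of the arrows i -> i+1 and D the sum of the arrows i+1 -> i. *)
Record zigzag_rep (k : fieldType) (m : nat) (V : vectType k)
    (e : nat -> V -> V) (u d : V -> V) : Prop := ZigzagRep {
  zr_elin : forall i, linear (e i);
  zr_ulin : linear u;
  zr_dlin : linear d;
  zr_ee : forall i j v, e j (e i v) = if i == j then e i v else 0;
  zr_sum : forall v, \sum_(i < m.+1) e i v = v;
  zr_eu : forall i v, u (e i v) = e i.+1 (u v);
  zr_u0 : forall v, e 0 (u v) = 0;
  zr_ed : forall i v, d (e i.+1 v) = e i (d v);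
  zr_d0 : forall v, d (e 0 v) = 0;
  zr_uu : forall v, u (u v) = 0;
  zr_dd : forall v, d (d v) = 0;
  zr_ud : forall i v, d (u (e i.+1 v)) = u (d (e i.+1 v)) }.

(* B_{m+1}, with the vertices renumbered 0, ..., m and paths read from left to
   right; zE i is junk (zero) for i > m. *)
Record zigzag (k : fieldType) (A : algType k) (m : nat) := Zigzag {
  zE : nat -> A;
  zU : A;
  zD : A;
  zEE : forall i j, zE i * zE j = if i == j then zE i else 0;
  zsum : \sum_(i < m.+1) zE i = 1;
  zbig : forall i, (m < i)%N -> zE i = 0;
  zEU : forall i, zE i * zU = zU * zE i.+1;
  zU0 : zU * zE 0 = 0;
  zED : forall i, zE i.+1 * zD = zD * zE i;
  zD0 : zE 0 * zD = 0;
  zUU : zU * zU = 0;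
  zDD : zD * zD = 0;
  zUD : forall i, zE i.+1 * (zU * zD) = zE i.+1 * (zD * zU);
  zgen : forall S : A -> Prop, (forall c a b, S a -> S b -> S (c *: a + b)) ->
    (forall a b, S a -> S b -> S (a * b)) ->
    (forall i, S (zE i)) -> S zU -> S zD -> forall a, S a;
  zact : forall (V : vectType k) (e : nat -> V -> V) (u d : V -> V),
    zigzag_rep m e u d -> exists act : V -> A -> V,
      [/\ forall a, linear (act^~ a), forall v, linear (act v),
          forall v, act v 1 = v, forall v a b, act v (a * b) = act (act v a) b
        & [/\ forall v i, act v (zE i) = e i v, forall v, act v zU = u v
            & forall v, act v zD = d v]] }.

Section Zigzag.
Context {k : fieldType} {A : algType k} {m : nat} (Z : zigzag A m).
Implicit Types M N X Y : rmod A.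

Local Notation E := (zE Z).
Local Notation U := (zU Z).
Local Notation D := (zD Z).

Lemma rhom_of_gen M N (f : M -> N) : linear f ->
  (forall i v, f (ract v (E i)) = ract (f v) (E i)) ->
  (forall v, f (ract v U) = ract (f v) U) ->
  (forall v, f (ract v D) = ract (f v) D) ->
  exists g : rhom M N, forall v, g v = f v.
Proof.
move=> fl fE fU fD.
suff fa v a : f (ract v a) = ract (f v) a by exists (mk_rhom fl fa).
move: a v; apply: (zgen (z := Z)) => //.
- by move=> c a b ha hb v; rewrite !ract_linr fl ha hb.
- by move=> a b ha hb v; rewrite !ractM hb ha.
Qed.

Lemma submodule_of_gen M (W : {vspace M}) :
  (forall i v, v \in W -> ract v (E i) \in W) ->
  (forall v, v \in W -> ract v U \in W) ->
  (forall v, v \in W -> ract v D \in W) -> submodule W.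
Proof.
move=> hE hU hD v a; move: a v; apply: (zgen (z := Z)) => //.
- by move=> c a b ha hb v vW; rewrite ract_linr rpredD ?rpredZ ?ha ?hb.
- by move=> a b ha hb v vW; rewrite ractM hb ?ha.
Qed.

Section RightAction.
Variable M : rmod A.
Implicit Types v : M.

Lemma ractEE v i j : ract (ract v (E i)) (E j) = if i == j then ract v (E i) else 0.
Proof. by rewrite -ractM zEE; case: eqP => // _; rewrite ractr0. Qed.

Lemma ractE_id v i : ract (ract v (E i)) (E i) = ract v (E i).
Proof. by rewrite ractEE eqxx. Qed.

Lemma ract_sumE v : \sum_(i < m.+1) ract v (E i) = v.
Proof. by rewrite -ractr_sum zsum ract1. Qed.

Lemma ractE_big v i : (m < i)%N -> ract v (E i) = 0.
Proof. by move=> mi; rewrite zbig // ractr0. Qed.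

Lemma ractEU v i : ract (ract v (E i)) U = ract (ract v U) (E i.+1).
Proof. by rewrite -!ractM zEU. Qed.

Lemma ractU0 v : ract (ract v U) (E 0) = 0.
Proof. by rewrite -ractM zU0 ractr0. Qed.

Lemma ractED v i : ract (ract v (E i.+1)) D = ract (ract v D) (E i).
Proof. by rewrite -!ractM zED. Qed.

Lemma ractD0 v : ract (ract v (E 0)) D = 0.
Proof. by rewrite -ractM zD0 ractr0. Qed.

Lemma ractUU v : ract (ract v U) U = 0.
Proof. by rewrite -ractM zUU ractr0. Qed.

Lemma ractDD v : ract (ract v D) D = 0.
Proof. by rewrite -ractM zDD ractr0. Qed.

Lemma ractDU v i : ract (ract (ract v (E i.+1)) D) U =
  ract (ract (ract v (E i.+1)) U) D.
Proof. by rewrite -!ractM -?mulrA zUD. Qed.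

Lemma eq0_ractE v : (forall i, (i <= m)%N -> ract v (E i) = 0) -> v = 0.
Proof.
by move=> h; rewrite -(ract_sumE v) big1 // => i _; rewrite h // -ltnS.
Qed.

(** Where UD = DU, the word UDU becomes DUU = 0. At vertex 0 the two loops differ, but after the
    first U one is at vertex 1, and there DU is replaced by UD, giving U U D = 0. *)
Lemma ractUDU v : ract (ract (ract v U) D) U = 0.
Proof.
apply: eq0_ractE => i _; case: i => [|i]; first exact: ractU0.
rewrite -ractEU -ractED -ractEU; case: i => [|i].
  have -> : ract (ract v (E 0)) U = ract (ract (ract v (E 0)) U) (E 1).
    by rewrite -ractEU ractE_id.
  by rewrite ractDU ractEU ractUU ract0 ?ractUU ?ract0.
by rewrite -ractDU ractUU.
Qed.

Lemma ractDUD v : ract (ract (ract v D) U) D = 0.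
Proof.
apply: eq0_ractE => i _.
rewrite -ractED -ractEU -ractED ractDU; exact: ractDD.
Qed.

(** U would lead from vertex m to m + 1, where the idempotent is zero. Combined with [zUD] at a
    vertex m > 0 this yields the vanishing of the cycle at the last vertex. *)
Lemma ractUm v : ract (ract v (E m)) U = 0.
Proof. by rewrite ractEU ractE_big. Qed.

Lemma ractDm v : ract (ract v D) (E m) = 0.
Proof. by rewrite -ractED ractE_big ?ract0. Qed.

Lemma ractE_deg v i j : ract v (E i) = v -> i != j -> ract v (E j) = 0.
Proof. by move=> <- /negbTE ij; rewrite ractEE ij. Qed.

Lemma ractU_deg v i : ract v (E i) = v -> ract (ract v U) (E i.+1) = ract v U.
Proof. by move=> vi; rewrite -ractEU vi. Qed.

Lemma ractD_deg v i : ract v (E i.+1) = v -> ract (ract v D) (E i) = ract v D.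
Proof. by move=> vi; rewrite -ractED vi. Qed.

Lemma ractDU_deg v i : ract v (E i) = v -> (0 < i)%N ->
  ract (ract v D) U = ract (ract v U) D.
Proof. by case: i => // i <- _; apply: ractDU. Qed.

Lemma ractDU_comp v i : (0 < i)%N ->
  ract (ract (ract v D) U) (E i) = ract (ract (ract v U) D) (E i).
Proof. by case: i => // i _; rewrite -ractEU -ractED ractDU ractEU ractED. Qed.

End RightAction.

(** The words 1, U, D, UD. Applied to e_j they span e_j B, because e_j DU equals e_j UD for j > 0
    and is zero for j = 0. *)
Definition zpath (x : bool * bool) : A := (if x.1 then U else 1) * (if x.2 then D else 1).

Lemma ract_zpath M (v : M) x : ract v (zpath x) =
  (if x.2 then fun w => ract w D else id) ((if x.1 then fun w => ract w U else id) v).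
Proof. by case: x => [[] []]; rewrite /zpath /= ractM ?ract1. Qed.

(* The basis element e_j U^(x.1) D^(x.2) of the projective e_j B survives in the
   quotient where U is killed unless qa holds and D is killed unless qb holds. *)
Definition mok (qa qb : bool) (j : nat) (x : bool * bool) : bool :=
  [&& j <= m, x.1 ==> qa && (j < m) & x.2 ==> qb && ((0 < j) || x.1)]%N.

(** Quotients of e_j B by dead words: ([qa], [qb]) = (true, true) is the projective P_j, (false,
    true) the standard module, (false, false) the simple one, and (true, false), for j < m, the
    costandard module with top j. For j > m all of them are zero. Only the coordinates on the
    surviving words are exported; later arguments compare coordinates. *)
Record model_data (qa qb : bool) (j : nat) := ModelData {
  md_mod :> rmod A;
  md_gen : md_mod;
  md_co : bool * bool -> md_mod -> k;
  md_lin : forall x, linear (md_co x : md_mod -> k^o);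
  md_out : forall x v, ~~ mok qa qb j x -> md_co x v = 0;
  md_zpath : forall x y,
    md_co x (ract md_gen (zpath y)) = ((x == y) && mok qa qb j x)%:R;
  md_expand : forall v, v = \sum_x md_co x v *: ract md_gen (zpath x);
  md_E : forall x v i,
    md_co x (ract v (E i)) = if (j + x.1 - x.2 == i)%N then md_co x v else 0;
  md_U : forall x v, md_co x (ract v U) =
    if mok qa qb j x && x.1 then md_co (false, x.2) v else 0;
  md_D : forall x v, md_co x (ract v D) =
    if mok qa qb j x && x.2 then md_co (x.1, false) v else 0 }.

Section Models.
Variables (qa qb : bool) (j : nat).
Local Notation ok := (mok qa qb j).

Let S := {x : bool * bool | ok x}.
Let V : vectType k := {ffun S -> k^o}.
Let co (x : bool * bool) (f : V) : k := oapp (fun s : S => f s) 0 (insub x).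
Let mk (F : bool * bool -> k) : V := [ffun s : S => F (val s)].
Let vert (x : bool * bool) : nat := (j + x.1 - x.2)%N.

Let coE F x : co x (mk F) = if ok x then F x else 0.
Proof.
by rewrite /co; case: insubP => [s okx <-|/negbTE->] //=; rewrite ffunE (valP s).
Qed.

Let co_lin x : linear (co x : V -> k^o).
Proof.
move=> c f g; rewrite /co; case: insubP => [s _ _|_] /=; first by rewrite !ffunE.
by rewrite scaler0 addr0.
Qed.

Let coP f g : (forall x, co x f = co x g) -> f = g.
Proof.
by move=> h; apply/ffunP => s; have := h (val s); rewrite /co valK.
Qed.

Let co_out x f : ~~ ok x -> co x f = 0.
Proof. by move=> /negbTE h; rewrite /co insubF. Qed.

Let e i (f : V) : V := mk (fun x => if vert x == i then co x f else 0).
Let u (f : V) : V := mk (fun x => if x.1 then co (false, x.2) f else 0).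
Let d (f : V) : V := mk (fun x => if x.2 then co (x.1, false) f else 0).

Let mk_lin (F : V -> bool * bool -> k) :
  (forall x, linear (fun f => F f x : k^o)) -> linear (fun f => mk (F f)).
Proof.
by move=> Fl c f g; apply/ffunP => s; rewrite !ffunE Fl.
Qed.

Let coD x f g : co x (f + g) = co x f + co x g.
Proof. by have := co_lin x 1 f g; rewrite !scale1r. Qed.
Let co0 x : co x 0 = 0.
Proof. by rewrite /co; case: insub => //= s; rewrite ffunE. Qed.
Let co_sum x (I : Type) (r : seq I) (P : pred I) (F : I -> V) :
  co x (\sum_(i <- r | P i) F i) = \sum_(i <- r | P i) co x (F i).
Proof. exact: (big_morph (co x) (coD x) (co0 x)). Qed.

Let rep : zigzag_rep m e u d.
Proof.
split.
- move=> i; apply: mk_lin => x c f g; case: ifP => _; first exact: co_lin.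
  by rewrite scaler0 addr0.
- apply: mk_lin => x c f g; case: ifP => _; first exact: co_lin.
  by rewrite scaler0 addr0.
- apply: mk_lin => x c f g; case: ifP => _; first exact: co_lin.
  by rewrite scaler0 addr0.
- move=> i i' v; apply: coP => x; rewrite (fun_if (co x)) !coE co0.
  case: ifP => okx; last by rewrite if_same.
  rewrite ?okx; case: (eqVneq (vert x) i') => [->|ne]; first by rewrite (eq_sym i' i); case: eqP.
  by case: (eqVneq i i') => // ->; rewrite (negbTE ne).
- move=> v; apply: coP => x; rewrite co_sum; have [okx|nx] := boolP (ok x); last first.
    by rewrite big1 => [|i _]; rewrite co_out.
  have lx : (vert x < m.+1)%N.
    by move: okx; case: x => [[] []] /and3P[/= h1 h2 h3]; rewrite /vert /=; lia.
  rewrite (bigD1 (Ordinal lx)) //= coE okx eqxx big1 ?addr0 // => i.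
  rewrite coE okx -val_eqE /= eq_sym; by case: eqP.
- move=> i v; apply: coP => [[x1 x2]]; rewrite !coE /=; case: ifP => // okx.
  case: x1 okx => okx; last by case: ifP.
  rewrite ?coE /vert /=; case: (boolP (ok (false, x2))) => ok'; last first.
    by rewrite co_out ?if_same.
  have -> : (j + 1 - x2 == i.+1)%N = (j + 0 - x2 == i)%N; last by [].
  by move: ok' => /and3P[/= h1 h2 h3]; case: x2 okx h3 => /= okx h3; lia.
- move=> v; apply: coP => [[x1 x2]]; rewrite !coE co0 /=; case: ifP => // okx.
  case: ifP => // /eqP; case: x1 okx => okx /=; last by rewrite ?if_same.
  rewrite /vert /=.
  case: (boolP (ok (false, x2))) => ok'; last by rewrite co_out // !if_same.
  by move=> h; exfalso; move: ok' => /and3P[/= h1 h2 h3]; case: x2 okx h h3 => /= okx h h3; lia.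
- move=> i v; apply: coP => [[x1 x2]]; rewrite !coE /=; case: ifP => // okx.
  case: x2 okx => okx; last by case: ifP.
  rewrite ?coE /vert /=; case: (boolP (ok (x1, false))) => ok'; last first.
    by rewrite co_out ?if_same.
  have -> : (j + x1 - 1 == i)%N = (j + x1 - 0 == i.+1)%N; last by [].
  by move: okx => /and3P[/= h1 h2 h3]; case: x1 ok' h2 h3 => /= ok' h2 h3; lia.
- move=> v; apply: coP => [[x1 x2]]; rewrite !coE co0 /=; case: ifP => // okx.
  case: x2 okx => //= okx; rewrite ?coE /vert /=; case: ifP => // _.
  case: eqP => // h; exfalso.
  by move: okx => /and3P[/= h1 h2 h3]; case: x1 h h2 h3 => /= h h2 h3; lia.
- move=> v; apply: coP => [[x1 x2]]; rewrite !coE co0 /=; case: ifP => // _.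
  by case: x1 => //; rewrite ?coE /=; case: ifP.
- move=> v; apply: coP => [[x1 x2]]; rewrite !coE co0 /=; case: ifP => // _.
  by case: x2 => //; rewrite ?coE /=; case: ifP.
- move=> i v; apply: coP => [[x1 x2]]; rewrite !coE /=; case: ifP => // okx.
  case: x1 x2 okx => [] [] okx //=; rewrite ?coE /= ?if_same // ?coE /vert /=.
  case: (boolP (ok (false, false))) => ok0; last by rewrite !if_same.
  case: eqP => [ji|_]; last by rewrite !if_same.
  have -> : ok (true, false) by move: okx; rewrite /mok /= => /and3P[-> -> _].
  have -> // : ok (false, true).
  by move: okx; rewrite /mok /= => /and3P[-> _ /andP[-> _]]; lia.
Qed.

Lemma model_exists : exists _ : model_data qa qb j, True.
Proof.
have [act [h1 h2 h3 h4 [hE hU hD]]] := zact Z rep.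
pose M : rmod A := RMod h1 h2 h3 h4.
pose g : M := mk (fun x => (x == (false, false))%:R).
have cE x (v : M) i : co x (ract v (E i)) = if (j + x.1 - x.2 == i)%N then co x v else 0.
  by rewrite [ract _ _]hE coE; case: (boolP (ok x)) => // nx; rewrite co_out // if_same.
have cU x (v : M) : co x (ract v U) = if ok x && x.1 then co (false, x.2) v else 0.
  by rewrite [ract _ _]hU coE; case: (ok x).
have cD x (v : M) : co x (ract v D) = if ok x && x.2 then co (x.1, false) v else 0.
  by rewrite [ract _ _]hD coE; case: (ok x).
have cg x y : co x (ract g (zpath y)) = ((x == y) && ok x)%:R.
  rewrite ract_zpath; case: (leqP j m) => jm; last first.
    have no z : ok z = false by rewrite /mok leqNgt jm.
    by rewrite co_out ?no ?andbF.
  have ok0 : ok (false, false) by rewrite /mok jm.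
  have okz : ok (true, true) -> ok (true, false).
    by rewrite /mok /= => /and3P[-> -> _].
  case: x y => [[] []] [[] []] /=; rewrite ?cD ?cU ?coE ?ok0 /= ?andbT ?andbF //=;
    rewrite ?cU ?coE ?ok0 /= ?andbT ?andbF ?if_same //=;
    try (by case: (ok _)).
  by case okt: (ok (true, true)) => //=; rewrite (okz okt).
suff cv (v : M) : v = \sum_x co x v *: ract g (zpath x).
  by exists (@ModelData qa qb j M g co co_lin co_out cg cv cE cU cD).
apply: coP => x; rewrite co_sum.
have coZ c f y : co y (c *: f) = c * co y f.
  by have := co_lin y c f 0; rewrite !addr0 co0 addr0.
rewrite (bigD1 x) //= coZ cg eqxx /= big1 ?addr0 => [|y yx].
  by case: (boolP (ok x)) => nx; rewrite ?mulr1 // co_out ?mul0r.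
by rewrite coZ cg eq_sym (negbTE yx) mulr0.
Qed.

End Models.
End Zigzag.

Lemma sum_bool2 (V : nmodType) (F : bool * bool -> V) :
  \sum_x F x = F (false, false) + F (true, false) + F (false, true) + F (true, true).
Proof.
rewrite (bigD1 (false, false)) //= (bigD1 (true, false)) //= (bigD1 (false, true)) //=.
rewrite (bigD1 (true, true)) //= big1 => [|[[] []] //].
by rewrite addr0 !addrA.
Qed.

(** * Universal properties of the string modules and explicit projective resolutions *)

Section ZigzagModels.
Context {k : fieldType} {A : algType k} {m : nat} (Z : zigzag A m).
Implicit Types M N X Y : rmod A.

Local Notation E := (zE Z).
Local Notation U := (zU Z).
Local Notation D := (zD Z).
Local Notation "00" := (false, false).
Local Notation "10" := (true, false).
Local Notation "01" := (false, true).
Local Notation "11" := (true, true).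

Definition model_pack qa qb j : model_data Z qa qb j :=
  projT1 (cid (model_exists Z qa qb j)).
Definition model qa qb j : rmod A := md_mod (model_pack qa qb j).
Definition mgen qa qb j : model qa qb j := md_gen (model_pack qa qb j).
Definition mco qa qb j : bool * bool -> model qa qb j -> k :=
  @md_co k A m Z qa qb j (model_pack qa qb j).

Section Coordinates.
Variables (qa qb : bool) (j : nat).
Local Notation MM := (model qa qb j).
Local Notation g := (mgen qa qb j).
Local Notation co := (@mco qa qb j).
Local Notation ok := (@mok m qa qb j).
Implicit Types v : MM.

Lemma mco_lin x : linear (co x : MM -> k^o). Proof. exact: md_lin. Qed.

Lemma mco_out x v : ~~ ok x -> co x v = 0. Proof. exact: md_out. Qed.

Lemma mco_zpath x y : co x (ract g (zpath Z y)) = ((x == y) && ok x)%:R.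
Proof. exact: md_zpath. Qed.

Lemma mcoE v : v = \sum_x co x v *: ract g (zpath Z x).
Proof. exact: md_expand. Qed.

Lemma mco_E x v i :
  co x (ract v (E i)) = if (j + x.1 - x.2 == i)%N then co x v else 0.
Proof. exact: md_E. Qed.

Lemma mco_U x v : co x (ract v U) = if ok x && x.1 then co (false, x.2) v else 0.
Proof. exact: md_U. Qed.

Lemma mco_D x v : co x (ract v D) = if ok x && x.2 then co (x.1, false) v else 0.
Proof. exact: md_D. Qed.

Lemma mcoP v w : (forall x, co x v = co x w) -> v = w.
Proof. by move=> h; rewrite [v]mcoE [w]mcoE; apply: eq_bigr => x _; rewrite h. Qed.

Lemma mco0 x : co x 0 = 0.
Proof. exact: (linear0 (lin_of (mco_lin x))). Qed.

Lemma mcoD x v w : co x (v + w) = co x v + co x w.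
Proof. exact: (linearD (lin_of (mco_lin x))). Qed.

Lemma mcoZ x c v : co x (c *: v) = c * co x v.
Proof. by have := mco_lin x c v 0; rewrite !addr0 mco0 addr0. Qed.

Lemma mco_gen x : co x g = ((x == 00) && ok x)%:R.
Proof. by rewrite -mco_zpath ract_zpath. Qed.

Lemma mgenE : ract g (E j) = g.
Proof.
apply: mcoP => x; rewrite mco_E mco_gen; case: (x =P 00) => [->|_] /=.
  by rewrite addn0 subn0 eqxx.
by rewrite if_same.
Qed.

Lemma mgen_neq0 : (j <= m)%N -> g <> 0.
Proof.
move=> jm /(congr1 (co 00)); rewrite mco_gen mco0 /mok jm /= => /eqP.
by rewrite oner_eq0.
Qed.

Lemma zpath_expand v : v = co 00 v *: g + co 10 v *: ract g U +
  co 01 v *: ract g D + co 11 v *: ract (ract g U) D.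
Proof.
by rewrite {1}[v]mcoE sum_bool2 !ract_zpath.
Qed.

(** The universal property of the cyclic module on [g]. The formula in coordinates commutes with U
    and D because UU, DD and UDU vanish and DU can be rewritten as UD at a vertex j > 0. *)
Lemma model_hom N (w : N) : ract w (E j) = w ->
  (forall x, ~~ ok x -> ract w (zpath Z x) = 0) ->
  exists F : rhom MM N, F g = w.
Proof.
move=> wj wok; pose F (v : MM) : N := \sum_x co x v *: ract w (zpath Z x).
have Fexp v : F v = co 00 v *: w + co 10 v *: ract w U +
    co 01 v *: ract w D + co 11 v *: ract (ract w U) D.
  by rewrite /F sum_bool2 !ract_zpath.
have Fl : linear F.
  move=> c u v; rewrite /F scaler_sumr -big_split; apply: eq_bigr => x _ /=.
  by rewrite mcoD mcoZ scalerDl scalerA.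
have ok_w x : ok x || (ract w (zpath Z x) == 0).
  by case: (boolP (ok x)) => //= /wok ->.
have [|||G GE] := rhom_of_gen (Z := Z) Fl.
- move=> i v; rewrite /F ract_sum; apply: eq_bigr => x _.
  rewrite ractZ mco_E.
  have [okx|/wok ->] := boolP (ok x); last by rewrite ract0 !scaler0.
  suff -> : ract (ract w (zpath Z x)) (E i) =
      if (j + x.1 - x.2 == i)%N then ract w (zpath Z x) else 0.
    by case: ifP => _; rewrite ?scaler0 ?scale0r.
  have deg : ract (ract w (zpath Z x)) (E (j + x.1 - x.2)) = ract w (zpath Z x).
    rewrite ract_zpath; move: okx; case: x => [[] []] /and3P[/= h1 h2 h3].
    - by rewrite addnK; apply: ractD_deg; apply: ractU_deg.
    - by rewrite /= subn0 addn1; apply: ractU_deg.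
    - apply: ractD_deg; rewrite /= addn0 subn1 prednK //.
      by move: h3; rewrite orbF => /andP[].
    - by rewrite /= addn0 subn0.
  case: eqP => [<- //|/eqP ne]; exact: ractE_deg deg ne.
- move=> v; rewrite !Fexp !ractD !ractZ !mco_U /= !andbT !andbF /= !scale0r.
  rewrite ractUU ractUDU !scaler0 add0r !addr0.
  congr (_ + _).
    have := ok_w 10; rewrite ract_zpath /=; case: (ok 10) => //= /eqP ->.
    by rewrite !scaler0.
  have [b|nb] := boolP (ok 01); last first.
    by rewrite (mco_out _ nb) if_same !scale0r.
  have j0 : (0 < j)%N by move: b => /and3P[_ _ /= /andP[_]]; rewrite orbF.
  rewrite (ractDU_deg wj j0).
  have := ok_w 11; rewrite ract_zpath /=.
  by case: (ok 11) => //= /eqP ->; rewrite !scaler0.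
- move=> v; rewrite !Fexp !ractD !ractZ !mco_D /= !andbT !andbF /= !scale0r.
  rewrite !ractDD !scaler0 !add0r !addr0.
  congr (_ + _).
    have := ok_w 01; rewrite ract_zpath /=; case: (ok 01) => //= /eqP ->.
    by rewrite !scaler0.
  have := ok_w 11; rewrite ract_zpath /=; case: (ok 11) => //= /eqP ->.
  by rewrite !scaler0.
exists G; rewrite GE Fexp !mco_gen /=.
have [jm|jm] := leqP j m; last by rewrite -wj ractE_big // !(ract0, scaler0, addr0).
by rewrite /mok jm /= scale1r !scale0r !addr0.
Qed.

Lemma rhom_model_eq N (F G : rhom MM N) : F g = G g -> forall v, F v = G v.
Proof.
move=> FG v; rewrite [v]mcoE !linear_sum; apply: eq_bigr => x _.
by rewrite !linearZ !rfunP FG.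
Qed.

End Coordinates.

Local Notation P := (model true true).

(** The words failing [mok] for (true, true) vanish on N e_j in every module N, so Hom(P j, N) is N
    e_j and P j is e_j B. *)
Lemma proj_hom N j (w : N) : ract w (E j) = w ->
  exists F : rhom (P j) N, F (mgen true true j) = w.
Proof.
move=> wj; apply: model_hom => // x; rewrite ract_zpath /mok.
have [jm|jm _] := leqP j m; last first.
  by rewrite -wj ractE_big //; case: x => [[] []] /=; rewrite ?ract0.
have [mj|jm'] := leqP m j.
  have wU : ract w U = 0 by rewrite -wj (_ : j = m) ?ractUm //; lia.
  case: x => [[] []] /=; rewrite ?wU ?ract0 ?orbF // => j0.
  by rewrite -wj (_ : j = 0%N) ?ractD0 //; lia.
case: x => [[] []] /=; rewrite ?orbT ?orbF // => j0.
by rewrite -wj (_ : j = 0%N) ?ractD0 //; lia.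
Qed.

Lemma proj_projective j : projective (P j).
Proof.
move=> M N f h fs; have [x xE] := fs (h (mgen true true j)).
have [|F FE] := @proj_hom M j (ract x (E j)); first by rewrite ractE_id.
exists F => v; apply: (rhom_model_eq (F := rcomp f F) (G := h)).
by rewrite /= FE rfunP xE -rfunP mgenE.
Qed.

(* Exactness at t of the complex N_(g 0) -> N_(g 1) -> ... whose t-th map is
   right multiplication by the path w t. *)
Definition wexact (g : nat -> nat) (w : nat -> bool * bool) N (t : nat) : Prop :=
  forall v : N, ract v (E (g t)) = v -> ract v (zpath Z (w t)) = 0 ->
  match t with
  | 0 => v = 0
  | t'.+1 => exists2 u : N, ract u (E (g t')) = u & ract u (zpath Z (w t')) = v
  end.

(** Evaluation at the generators identifies Hom(P (g t), N) with N e_(g t), and composition with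
    [d t] becomes right multiplication by the word [w t]. *)
Lemma word_resolution (g : nat -> nat) (w : nat -> bool * bool) M
    (aug : rhom (P (g 0)) M) (d : forall t, rhom (P (g t.+1)) (P (g t))) :
  (forall t, d t (mgen _ _ _) = ract (mgen _ _ _) (zpath Z (w t))) ->
  surjective_rhom aug ->
  (forall x, aug x = 0 <-> exists y, d 0 y = x) ->
  (forall t x, d t x = 0 <-> exists y, d t.+1 y = x) ->
  exists R : proj_resolution M, forall N t, exact_at R N t <-> wexact g w N t.
Proof.
move=> dE augs ex0 exS.
pose R := @ProjRes k A M (fun t => P (g t)) d aug (fun t => @proj_projective _) augs ex0 exS.
exists R => N t; split=> [ex v vg vw|ex f fc].
  have [F FE] := proj_hom vg.
  have Fc : @ext_cocycle k A M N R t F.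
    move=> y /=; rewrite -[F _]/(rcomp F (d t) y).
    rewrite (rhom_model_eq (G := rhom0 _ _)) //= dE rfunP FE vw //.
  move: (ex F Fc); case: t F v vg vw FE Fc {ex} => [|t] F v _ _ FE Fc /=.
    by move=> h; rewrite -FE h.
  move=> [G GE]; exists (G (mgen _ _ _)); first by rewrite -rfunP mgenE.
  by rewrite -rfunP -(dE t) -[G _]GE FE.
have f1 : ract (f (mgen _ _ _)) (E (g t)) = f (mgen _ _ _) by rewrite -rfunP mgenE.
have f2 : ract (f (mgen _ _ _)) (zpath Z (w t)) = 0.
  by rewrite -rfunP -(dE t); apply: fc.
move: (ex _ f1 f2); case: t f fc {ex f1 f2} => [|t] f fc /=.
  by move=> f0 x; rewrite (rhom_model_eq (F := f) (G := rhom0 _ _)).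
move=> [u ug uw]; have [F FE] := proj_hom ug; exists F => x.
rewrite -[RHS]/(rcomp F (d t) x); apply: rhom_model_eq.
by rewrite /= dE rfunP FE uw.
Qed.

Section Differentials.
Variables (j' j : nat) (d : rhom (P j') (P j)).
Local Notation g' := (mgen true true j').
Local Notation g := (mgen true true j).

Lemma up_diffE f : d g' = ract g U ->
  d f = mco 00 f *: ract g U + mco 01 f *: ract (ract g U) D.
Proof.
move=> dg; rewrite {1}[f]zpath_expand !linearD !linearZ !rfunP /= dg.
by rewrite ractUU ract0 !scaler0 !addr0.
Qed.

Lemma down_diffE f : (0 < j)%N -> d g' = ract g D ->
  d f = mco 00 f *: ract g D + mco 10 f *: ract (ract g U) D.
Proof.
move=> j0 dg; rewrite {1}[f]zpath_expand !linearD !linearZ !rfunP /= dg.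
rewrite ractDD ractDUD !scaler0 !addr0.
by rewrite (ractDU_deg (mgenE _ _ _) j0).
Qed.

Lemma loop_diffE f : d g' = ract (ract g U) D ->
  d f = mco 00 f *: ract (ract g U) D.
Proof.
move=> dg; rewrite {1}[f]zpath_expand !linearD !linearZ !rfunP /= dg.
by rewrite ractUDU ractDD ract0 !scaler0 !addr0.
Qed.

(** All kernels and images below are cut out by two coordinates: 00 = 01 = 0 is the span of U and
    UD, while 00 = 10 = 0 is the span of D and UD. Exactness of the resolutions then amounts to
    matching these conditions. *)
Lemma up_diff_ker f : j' = j.+1 -> d g' = ract g U ->
  d f = 0 <-> mco 00 f = 0 /\ mco 01 f = 0.
Proof.
move=> jj dg; rewrite up_diffE //; split=> [h|[-> ->]]; last by rewrite !scale0r addr0.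
have [jm|jm] := leqP j' m; last first.
  by rewrite !mco_out // /mok leqNgt jm.
have := congr1 (mco 10) h; have := congr1 (mco 11) h.
rewrite !(mcoD, mcoZ, mco_U, mco_D, mco_gen, mco0) /mok /= !andbT.
have -> : (j < m)%N by lia.
have -> : (j <= m)%N by lia.
by rewrite orbT /= !mulr0 !mulr1 add0r addr0.
Qed.

Lemma up_diff_im f : d g' = ract g U ->
  (exists y, d y = f) <-> mco 00 f = 0 /\ mco 01 f = 0.
Proof.
move=> dg; split=> [[y <-]|[h0 h1]].
  rewrite up_diffE // !(mcoD, mcoZ, mco_U, mco_D) /=.
  by rewrite !andbF /= ?if_same !mulr0 !addr0.
exists (mco 10 f *: g' + mco 11 f *: ract g' D).
rewrite linearD !linearZ rfunP /= dg [RHS]zpath_expand h0 h1.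
by rewrite !scale0r add0r addr0.
Qed.

(** The hypothesis [j < m] keeps UD alive at j; at the last vertex g' U would also be in the
    kernel. *)
Lemma down_diff_ker f : j = j'.+1 -> (j < m)%N -> d g' = ract g D ->
  d f = 0 <-> mco 00 f = 0 /\ mco 10 f = 0.
Proof.
move=> jj jm dg; have j0 : (0 < j)%N by lia.
rewrite down_diffE //; split=> [h|[-> ->]]; last by rewrite !scale0r addr0.
have := congr1 (mco 01) h; have := congr1 (mco 11) h.
rewrite !(mcoD, mcoZ, mco_U, mco_D, mco_gen, mco0) /mok /= !andbT.
have -> : (j < m)%N by lia.
have -> : (j <= m)%N by lia.
by rewrite j0 /= ?if_same !mulr0 !mulr1 add0r addr0.
Qed.

Lemma down_diff_im f : (0 < j)%N -> d g' = ract g D ->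
  (exists y, d y = f) <-> mco 00 f = 0 /\ mco 10 f = 0.
Proof.
move=> j0 dg; split=> [[y <-]|[h0 h1]].
  rewrite down_diffE // !(mcoD, mcoZ, mco_U, mco_D) /=.
  by rewrite !andbF /= ?if_same !mulr0 !addr0.
exists (mco 01 f *: g' + mco 11 f *: ract g' U).
rewrite linearD !linearZ rfunP /= dg [RHS]zpath_expand h0 h1.
rewrite !scale0r !add0r; congr (_ + _ *: _).
by rewrite (ractDU_deg (mgenE _ _ _) j0).
Qed.

(** At vertex 0 the coordinate 01 is always zero. It is listed so that the kernel has the shape of
    the image of the next map, which goes up. *)
Lemma loop_diff_ker f : j = 0%N -> j' = 0%N -> (0 < m)%N ->
  d g' = ract (ract g U) D ->
  d f = 0 <-> mco 00 f = 0 /\ mco 01 f = 0.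
Proof.
move=> jj jj' m0 dg; rewrite loop_diffE //; split=> [h|[-> _]]; last by rewrite scale0r.
split; last by rewrite mco_out // /mok jj'.
have := congr1 (mco 11) h.
by rewrite !(mcoD, mcoZ, mco_U, mco_D, mco_gen, mco0) /mok jj /= m0 mulr1.
Qed.

Lemma loop_diff_im f : j = 0%N ->
  d g' = ract (ract g U) D ->
  (exists y, d y = f) <-> mco 00 f = 0 /\ mco 10 f = 0.
Proof.
move=> jj dg; split=> [[y <-]|[h0 h1]].
  by rewrite loop_diffE // !(mcoZ, mco_D) /= !andbF !mulr0.
exists (mco 11 f *: g'); rewrite linearZ /= dg [RHS]zpath_expand h0 h1.
rewrite [mco 01 f]mco_out ?scale0r ?add0r //.
by rewrite /mok jj.
Qed.

End Differentials.

Definition Delta a := model false true a.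
(* nabla i' is the costandard module with top i' and socle i'.+1. *)
Definition nabla i' := model true false i'.

Lemma Delta_aug a : exists2 aug : rhom (P a) (Delta a), surjective_rhom aug &
  forall f, aug f = 0 <-> mco 00 f = 0 /\ mco 01 f = 0.
Proof.
have [F FE] := proj_hom (mgenE false true a).
have gU : ract (mgen false true a) U = 0.
  by apply: mcoP => x; rewrite mco_U mco0 /mok; case: x => [[] []] /=; rewrite ?andbF.
have FfE f : F f = mco 00 f *: mgen false true a + mco 01 f *: ract (mgen false true a) D.
  rewrite {1}[f]zpath_expand !linearD !linearZ !rfunP /= FE gU ract0 !scaler0.
  by rewrite !addr0.
exists F => [y|f].
  exists (mco 00 y *: mgen _ _ _ + mco 01 y *: ract (mgen _ _ _) D).
  by rewrite linearD !linearZ rfunP /= FE [RHS]zpath_expand gU ract0 !scaler0 !addr0.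
rewrite FfE; split=> [h|[-> ->]]; last by rewrite !scale0r addr0.
have [am|am] := leqP a m; last by rewrite !mco_out // /mok leqNgt am.
have [a0|a0] := leqP a 0; last first.
  have := congr1 (mco 00) h; have := congr1 (mco 01) h.
  rewrite !(mcoD, mcoZ, mco_U, mco_D, mco_gen, mco0) /mok /= am a0 /=.
  by rewrite !mulr0 !mulr1 add0r addr0.
rewrite [mco 01 f]mco_out //; last by rewrite /mok /= orbF ltnNge a0 /= andbF.
have := congr1 (mco 00) h.
by rewrite !(mcoD, mcoZ, mco_U, mco_D, mco_gen, mco0) /mok /= am !mulr0 mulr1 addr0.
Qed.

Lemma nabla_aug a : (a < m)%N ->
  exists2 aug : rhom (P a) (nabla a), surjective_rhom aug &
  forall f, aug f = 0 <-> mco 00 f = 0 /\ mco 10 f = 0.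
Proof.
move=> am; have [F FE] := proj_hom (mgenE true false a).
have gD : ract (mgen true false a) D = 0.
  by apply: mcoP => x; rewrite mco_D mco0 /mok; case: x => [[] []] /=; rewrite ?andbF.
have gUD : ract (ract (mgen true false a) U) D = 0.
  by apply: mcoP => x; rewrite mco_D mco0 /mok; case: x => [[] []] /=; rewrite ?andbF.
have FfE f : F f = mco 00 f *: mgen true false a + mco 10 f *: ract (mgen true false a) U.
  rewrite {1}[f]zpath_expand !linearD !linearZ !rfunP /= FE gD gUD !scaler0.
  by rewrite !addr0.
exists F => [y|f].
  exists (mco 00 y *: mgen _ _ _ + mco 10 y *: ract (mgen _ _ _) U).
  by rewrite linearD !linearZ rfunP /= FE [RHS]zpath_expand gD gUD !scaler0 !addr0.
rewrite FfE; split=> [h|[-> ->]]; last by rewrite !scale0r addr0.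
have := congr1 (mco 00) h; have := congr1 (mco 10) h.
rewrite !(mcoD, mcoZ, mco_U, mco_D, mco_gen, mco0) /mok /= am (ltnW am) /=.
by rewrite !mulr0 !mulr1 add0r addr0.
Qed.

(** Since P_j is zero for j > m, the index t may run over all naturals: for a <= m the resolution
    has length m - a. *)
Lemma Delta_resolution a : exists R : proj_resolution (Delta a),
  forall N t, exact_at R N t <-> wexact (fun t => t + a)%N (fun => 10) N t.
Proof.
have [aug augs augk] := Delta_aug a.
have hd t : exists d : rhom (P (t.+1 + a)) (P (t + a)), d (mgen _ _ _) = ract (mgen _ _ _) U.
  by apply: proj_hom; rewrite addSn; apply: ractU_deg; apply: mgenE.
pose d t := projT1 (cid (hd t)); have dE t := projT2 (cid (hd t)) : d t _ = _.
apply: (word_resolution (g := fun t => (t + a)%N) (d := d)) augs _ _ => [t|x|t x].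
- by rewrite dE ract_zpath.
- by rewrite augk up_diff_im.
- by rewrite up_diff_ker ?up_diff_im.
Qed.

(** The map from degree t + 1 to degree t: D while the vertices descend from i to 0, the loop UD
    between the two copies of P_0 in degrees i and i + 1, and U from there on. *)
Definition nabla_word (i t : nat) : bool * bool :=
  if (t < i)%N then 01 else if (t == i)%N then 11 else 10.

Definition nabla_vertex (i t : nat) : nat := (if t <= i then i - t else t - i.+1)%N.

Lemma nabla_vertexE i t : nabla_vertex i t = (i - t + (t - i.+1))%N.
Proof. by rewrite /nabla_vertex; case: leqP => h; lia. Qed.

Lemma nabla_resolution i : (i < m)%N -> exists R : proj_resolution (nabla i),
  forall N t, exact_at R N t <-> wexact (nabla_vertex i) (nabla_word i) N t.
Proof.
move=> im.
have [aug augs augk] : exists2 aug : rhom (P (nabla_vertex i 0)) (nabla i),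
    surjective_rhom aug & forall f, aug f = 0 <-> mco 00 f = 0 /\ mco 10 f = 0.
  by rewrite /nabla_vertex leq0n subn0; apply: nabla_aug.
have hd t : exists d : rhom (P (nabla_vertex i t.+1)) (P (nabla_vertex i t)),
    d (mgen _ _ _) = ract (mgen _ _ _) (zpath Z (nabla_word i t)).
  apply: proj_hom; rewrite ract_zpath /nabla_word; have ge := mgenE true true (nabla_vertex i t).
  case: (ltngtP t i) => ti /=.
  - apply: ractD_deg; rewrite -[RHS]ge; congr (ract _ (E _)).
    by rewrite ?nabla_vertexE; lia.
  - have -> : nabla_vertex i t.+1 = (nabla_vertex i t).+1 by rewrite ?nabla_vertexE; lia.
    exact: ractU_deg.
  - apply: ractD_deg.
    have -> : (nabla_vertex i t.+1).+1 = (nabla_vertex i t).+1 by rewrite ?nabla_vertexE; lia.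
    exact: ractU_deg.
pose d t := projT1 (cid (hd t)); have dE t := projT2 (cid (hd t)) : d t _ = _.
have im_d t x : (exists y, d t y = x) <->
    if (t <= i)%N then mco 00 x = 0 /\ mco 10 x = 0 else mco 00 x = 0 /\ mco 01 x = 0.
  have := dE t; rewrite ract_zpath /nabla_word; case: (ltngtP t i) => ti /= dg.
  - by apply: down_diff_im dg; rewrite ?nabla_vertexE; lia.
  - exact: up_diff_im dg.
  - by apply: loop_diff_im dg; rewrite ?nabla_vertexE; lia.
have ker_d t x : d t x = 0 <->
    if (t < i)%N then mco 00 x = 0 /\ mco 10 x = 0 else mco 00 x = 0 /\ mco 01 x = 0.
  have := dE t; rewrite ract_zpath /nabla_word; case: (ltngtP t i) => ti /= dg.
  - by apply: down_diff_ker dg; rewrite ?nabla_vertexE; lia.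
  - by apply: up_diff_ker dg; rewrite ?nabla_vertexE; lia.
  - by apply: loop_diff_ker dg; rewrite ?nabla_vertexE; lia.
apply: (word_resolution (d := d)) augs _ _ => [//|x|t x].
  by rewrite im_d augk.
by rewrite ker_d im_d.
Qed.

End ZigzagModels.

(** * Extensions between standard and costandard modules *)

Section ExtGroups.
Context {k : fieldType} {A : algType k} {m : nat} (Z : zigzag A m).
Implicit Types M N X Y : rmod A.

Local Notation E := (zE Z).
Local Notation U := (zU Z).
Local Notation D := (zD Z).
Local Notation "00" := (false, false).
Local Notation "10" := (true, false).
Local Notation "01" := (false, true).
Local Notation "11" := (true, true).
Local Notation Delta := (Delta Z).
Local Notation nabla := (nabla Z).

Lemma Delta_U b (v : Delta b) : ract v U = 0.
Proof.
by apply: mcoP => x; rewrite mco_U mco0 /mok; case: x => [[] []] /=; rewrite ?andbF.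
Qed.

Lemma nabla_D b (v : nabla b) : ract v D = 0.
Proof.
by apply: mcoP => x; rewrite mco_D mco0 /mok; case: x => [[] []] /=; rewrite ?andbF.
Qed.

Lemma Delta_expand b (v : Delta b) :
  v = mco 00 v *: mgen Z false true b + mco 01 v *: ract (mgen Z false true b) D.
Proof. by rewrite {1}[v]zpath_expand Delta_U ract0 !scaler0 !addr0. Qed.

Lemma nabla_expand b (v : nabla b) :
  v = mco 00 v *: mgen Z true false b + mco 10 v *: ract (mgen Z true false b) U.
Proof. by rewrite {1}[v]zpath_expand !nabla_D !scaler0 !addr0. Qed.

Lemma mco_deg qa qb j (v : model Z qa qb j) c (x : bool * bool) : ract v (E c) = v ->
  (j + x.1 - x.2)%N <> c -> mco x v = 0.
Proof. by move=> <- h; rewrite mco_E; case: eqP. Qed.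

Lemma Delta_deg b c (v : Delta b) : ract v (E c) = v -> c <> b -> c.+1 <> b -> v = 0.
Proof.
move=> vc cb c1b; rewrite [v]Delta_expand (mco_deg vc); last by move=> /=; lia.
case: b v vc cb c1b => [|b] v vc cb c1b.
  by rewrite mco_out ?scale0r ?addr0 // /mok /= andbF.
by rewrite (mco_deg vc) ?scale0r ?addr0 //=; lia.
Qed.

Lemma nabla_deg b c (v : nabla b) : ract v (E c) = v -> c <> b -> c <> b.+1 -> v = 0.
Proof.
move=> vc cb c1b; rewrite [v]nabla_expand (mco_deg vc); last by move=> /=; lia.
by rewrite (mco_deg vc) ?scale0r ?addr0 //=; lia.
Qed.

Lemma model_top qa qb j (v : model Z qa qb j) : ~~ (qa && qb) -> ract v (E j) = v ->
  v = mco 00 v *: mgen Z qa qb j.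
Proof.
move=> qab vj; rewrite {1}[v]zpath_expand (mco_deg (x := 10) vj); last by move=> /=; lia.
rewrite [mco 11 v]mco_out; last by rewrite /mok /= orbT; case: qa qb qab {v vj} => [] [] //= _; rewrite !andbF.
case: j v vj => [|j] v vj.
  by rewrite [mco 01 v]mco_out ?scale0r ?addr0 // /mok /= andbF.
by rewrite (mco_deg (x := 01) vj) ?scale0r ?addr0 //=; lia.
Qed.

Lemma nabla_socle b (v : nabla b) : ract v (E b.+1) = v ->
  v = mco 10 v *: ract (mgen Z true false b) U.
Proof.
move=> vb; rewrite {1}[v]nabla_expand (mco_deg (x := 00) vb) ?scale0r ?add0r //=.
by lia.
Qed.

Lemma nabla_genU b : (b < m)%N -> ract (mgen Z true false b) U <> 0.
Proof.
move=> bm /(congr1 (mco 10)); rewrite mco_U mco_gen mco0 /mok /= bm (ltnW bm) /=.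
by move/eqP; rewrite oner_eq0.
Qed.

Lemma nabla_top_U b (v : nabla b) : (b < m)%N ->
  ract v (E b) = v -> ract v U = 0 -> v = 0.
Proof.
move=> bm vb vU; rewrite [v]model_top //; have := congr1 (mco 10) vU.
by rewrite mco_U mco0 /mok /= bm (ltnW bm) /= => ->; rewrite scale0r.
Qed.

Local Notation gD a := (fun t => t + a)%N.
Local Notation wD := (fun _ : nat => 10).

(** The term in degree t sits at vertex t + a, which is above the support {b - 1, b} of Delta b, so
    it is zero. *)
Lemma wexact_DD a b t : (b < a)%N || (b == a) && (0 < t)%N ->
  wexact Z (gD a) wD (Delta b) t.
Proof.
move=> h v vg _; have -> : v = 0 by apply: (Delta_deg vg); lia.
by case: t {h v vg} => [|t] //; exists 0; rewrite ract0.
Qed.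

(** On nabla b, U is an isomorphism from vertex b to vertex b + 1. The complex contains both
    vertices as neighbouring terms or misses both, unless it starts at a = b + 1. *)
Lemma wexact_DN a b t : (b < m)%N -> a != b.+1 -> wexact Z (gD a) wD (nabla b) t.
Proof.
move=> bm ab v vg; rewrite ract_zpath /= => vU.
have v0 : (t + a)%N <> b.+1 -> v = 0.
  move=> tb1; have [tb|tb] := eqVneq (t + a)%N b.
    by apply: nabla_top_U => //; move: vg; rewrite /= tb.
  by apply: (nabla_deg vg) => //; apply/eqP.
case: t vg v0 => [|t] vg v0; first by apply: v0; apply/eqP.
have [tb|/eqP tb] := eqVneq (t.+1 + a)%N b.+1; last first.
  by exists 0; rewrite ract0 // v0.
have vb : ract v (E b.+1) = v by move: vg; rewrite /= tb.
exists (mco 10 v *: mgen Z true false b); rewrite ?ract_zpath /= ractZ.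
  have -> : (t + a)%N = b by lia.
  by rewrite mgenE.
by rewrite -nabla_socle.
Qed.

(** The ascending part of the resolution crosses the support {b, b + 1} along U, which is an
    isomorphism there. The descending part misses the support if i < b, and meets it only in degree
    0 if i = b. *)
Lemma wexact_NN i b t : (b < m)%N -> (i < b)%N || (b == i) && (0 < t)%N ->
  wexact Z (nabla_vertex i) (nabla_word i) (nabla b) t.
Proof.
move=> bm ib v vg; rewrite ract_zpath /nabla_word => vw.
have v0 : nabla_vertex i t <> b.+1 -> v = 0.
  move=> tb1; have [tb|tb] := eqVneq (nabla_vertex i t) b; last first.
    by apply: (nabla_deg vg) => //; apply/eqP.
  apply: nabla_top_U => //; first by move: vg; rewrite tb.
  move: tb vw; rewrite nabla_vertexE; case: ltngtP => //=; by lia.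
have [tb|/eqP tb] := eqVneq (nabla_vertex i t) b.+1; last first.
  by rewrite v0 //; case: t {ib v vg vw v0 tb} => [|t] //; exists 0; rewrite ract0.
have vb : ract v (E b.+1) = v by move: vg; rewrite tb.
case: t vg tb ib {v0 vw} => [|t] vg tb ib.
  by move: tb; rewrite nabla_vertexE; lia.
exists (mco 10 v *: mgen Z true false b).
  have -> : nabla_vertex i t = b by move: tb; rewrite !nabla_vertexE; lia.
  by rewrite ractZ mgenE.
have it : (i < t)%N by move: tb; rewrite nabla_vertexE; lia.
rewrite ract_zpath /nabla_word ltnNge (ltnW it) /= gtn_eqF //= ractZ.
by rewrite -nabla_socle.
Qed.

(** U acts as zero on Delta b, so the complex has zero differentials and the generator survives in
    the degree b - a of its vertex. *)
Lemma not_wexact_DD a b : (a <= b <= m)%N -> ~ wexact Z (gD a) wD (Delta b) (b - a).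
Proof.
move=> /andP[ab bm] /(_ (mgen Z false true b)); rewrite subnK //= mgenE ract_zpath /= Delta_U.
move=> /(_ erefl erefl); case: (b - a)%N => [|t]; first exact: mgen_neq0.
by move=> [u _]; rewrite ract_zpath /= Delta_U => /esym; apply: mgen_neq0.
Qed.

(** The socle of nabla b is the top of Delta (b + 1), which gives a nonzero homomorphism between
    them. *)
Lemma not_wexact_DN b : (b < m)%N -> ~ wexact Z (gD b.+1) wD (nabla b) 0.
Proof.
move=> bm /(_ (ract (mgen Z true false b) U)); rewrite ract_zpath /= ractUU.
by rewrite (ractU_deg (mgenE _ _ _ _)) => /(_ erefl erefl); apply: nabla_genU.
Qed.

(** In degree i + b + 1 the ascending part has reached vertex b. The words on both sides of this
    degree, including the loop UD when b = 0, begin with U, which kills Delta b. *)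
Lemma not_wexact_ND i b : (i < m)%N -> (b <= m)%N ->
  ~ wexact Z (nabla_vertex i) (nabla_word i) (Delta b) (i + b).+1.
Proof.
move=> im bm /(_ (mgen Z false true b)).
have -> : nabla_vertex i (i + b).+1 = b by rewrite nabla_vertexE; lia.
have w1 t : (i <= t)%N -> (nabla_word i t).1.
  by rewrite /nabla_word; case: ltngtP.
rewrite mgenE !ract_zpath w1 ?Delta_U; last by lia.
case: (nabla_word _ _).2 => /=; rewrite ?ract0 => /(_ erefl erefl)[u _];
  rewrite !ract_zpath w1 ?leq_addr // Delta_U;
  case: (nabla_word _ _).2 => /=; rewrite ?ract0 => /esym; exact: mgen_neq0.
Qed.

(** In degree i - b the descending part is at vertex b; all words up to degree i end in D, which
    kills nabla b. *)
Lemma not_wexact_NN i b : (i < m)%N -> (b <= i)%N ->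
  ~ wexact Z (nabla_vertex i) (nabla_word i) (nabla b) (i - b).
Proof.
move=> im bi /(_ (mgen Z true false b)).
have -> : nabla_vertex i (i - b) = b by rewrite nabla_vertexE; lia.
have w2 t : (t <= i)%N -> (nabla_word i t).2.
  by rewrite /nabla_word; case: ltngtP.
rewrite mgenE !ract_zpath w2 ?leq_subr // nabla_D => /(_ erefl erefl).
have bm : (b <= m)%N by lia.
case et : (i - b)%N => [|t]; first exact: mgen_neq0.
move=> [u _]; rewrite !ract_zpath w2 ?nabla_D; last by lia.
by move/esym; apply: mgen_neq0.
Qed.

(* (true, i) stands for nabla i and (false, a) for Delta a. *)
Definition code_mod (c : bool * nat) : rmod A :=
  if c.1 then nabla c.2 else Delta c.2.

Definition code_ok (c : bool * nat) : bool := (c.2 + c.1 <= m)%N.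

(** The relation [c may stand before d]: by [ext_code] it is the vanishing of all Ext groups from d
    to c. *)
Definition code_rel (c d : bool * nat) : bool :=
  match c, d with
  | (true, b), (true, i) => (i < b)%N
  | (true, b), (false, a) => a != b.+1
  | (false, b), (false, a) => (b < a)%N
  | (false, _), (true, _) => false
  end.

Lemma ext_code c d M N : code_ok c -> code_ok d ->
  riso (code_mod d) M -> riso (code_mod c) N ->
  (forall t, ext_vanishes t M N) <-> code_rel c d.
Proof.
case: c d => [[] b] [[] a]; rewrite /code_ok /code_mod /= => cb ca iM iN.
- have [|R RE] := @nabla_resolution _ _ _ Z a; first by lia.
  split=> [h|h t]; last by apply/(ext_vanishesE R _ iM iN)/RE/wexact_NN; lia.
  rewrite ltnNge; apply/negP => ba; apply: (@not_wexact_NN a b); try lia.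
  by apply/RE/(ext_vanishesE R _ iM iN).
- have [R RE] := Delta_resolution Z a.
  split=> [h|h t]; last by apply/(ext_vanishesE R _ iM iN)/RE/wexact_DN => //; lia.
  apply/eqP => ab; apply: (@not_wexact_DN b); first by lia.
  by rewrite -ab; apply/RE/(ext_vanishesE R _ iM iN).
- have [|R RE] := @nabla_resolution _ _ _ Z a; first by lia.
  split=> // h; exfalso; apply: (@not_wexact_ND a b); try lia.
  by apply/RE/(ext_vanishesE R _ iM iN).
- have [R RE] := Delta_resolution Z a.
  split=> [h|h t]; last by apply/(ext_vanishesE R _ iM iN)/RE/wexact_DD; lia.
  rewrite ltnNge; apply/negP => ab; apply: (@not_wexact_DD a b); first by lia.
  by apply/RE/(ext_vanishesE R _ iM iN).
Qed.

(** The image of the generator stays at vertex j and determines f. Excluding (true, true) removes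
    the loop UD, so the component at j is a line. *)
Lemma model_brick qa qb j (f : rhom (model Z qa qb j) (model Z qa qb j)) :
  ~~ (qa && qb) -> (j <= m)%N -> exists! c : k, forall v, f v = c *: v.
Proof.
move=> qab jm; set g := mgen Z qa qb j.
have fg : ract (f g) (E j) = f g by rewrite -rfunP mgenE.
exists (mco 00 (f g)); split=> [v|c cE].
  rewrite [v]mcoE linear_sum scaler_sumr; apply: eq_bigr => x _.
  by rewrite linearZ rfunP /= [f _ in LHS]model_top // ractZ scalerA mulrC -scalerA.
by rewrite cE mcoZ mco_gen /mok jm mulr1.
Qed.

Lemma exceptional_code c M : code_ok c -> riso (code_mod c) M -> exceptional M.
Proof.
move=> okc iM; split.
  move=> f; have [u [v [uv vu]]] := riso_inv iM.
  have [a [aE aU]] : exists! a : k, forall x, rcomp (rcomp v f) u x = a *: x.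
    move: (rcomp _ _); move: okc; rewrite /code_ok /code_mod; case: c {iM u v uv vu} => [[] i] /= okc F;
      by apply: model_brick => //; lia.
  exists a; split=> [x|b bE].
    by have := congr1 u (aE (v x)); rewrite /= !vu linearZ /= vu.
  by apply: aU => x; rewrite /= bE linearZ /= uv.
case: c okc iM => [[] i]; rewrite /code_ok /code_mod /= => okc iM t t0.
  have [|R RE] := @nabla_resolution _ _ _ Z i; first by lia.
  by apply/(ext_vanishesE R _ iM iM)/RE/wexact_NN; lia.
have [R RE] := Delta_resolution Z i.
by apply/(ext_vanishesE R _ iM iM)/RE/wexact_DD; lia.
Qed.

End ExtGroups.

(** * Devissage and injective modules *)

Section Devissage.
Context {k : fieldType} {A : algType k} {m : nat} (Z : zigzag A m).
Implicit Types M N X Y : rmod A.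

Local Notation E := (zE Z).
Local Notation U := (zU Z).
Local Notation D := (zD Z).
Local Notation "00" := (false, false).
Local Notation "10" := (true, false).
Local Notation "01" := (false, true).
Local Notation "11" := (true, true).
Local Notation P := (model Z true true).
Local Notation L := (model Z false false).
Local Notation nabla := (nabla Z).

(** A nonzero homogeneous class of V / W dies after at most two nonzero steps along U and D; the
    last nonzero class spans a simple submodule of V / W. *)
Lemma socle_mod M (W V : {vspace M}) : submodule W -> submodule V ->
  (W <= V)%VS -> W <> V ->
  exists i v, [/\ (i <= m)%N, v \in V, v \notin W, ract v (E i) = v &
                  ract v U \in W /\ ract v D \in W].
Proof.
move=> sW sV WV neq.
have [v vV vW] : exists2 v, v \in V & v \notin W.
  apply: contrapT => h; apply: neq; apply/eqP; rewrite eqEsubv WV.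
  apply/subvP => v vV; apply/negPn/negP => vW; apply: h; by exists v.
have deg i u : ract u (E i) = u -> u \notin W -> (i <= m)%N.
  by move=> ui uW; rewrite leqNgt; apply: contra uW => mi; rewrite -ui ractE_big ?mem0v.
have [i {}vW] : exists i, ract v (E i) \notin W.
  apply: contrapT => h; move/negP: vW; apply; rewrite -(ract_sumE Z v).
  by apply: memv_suml => i _; apply/negPn/negP => ?; apply: h; exists i.
have {}vV := sV _ (E i) vV; move: (ractE_id Z v i); move: (ract v (E i)) vW vV => {}v vW vV vi.
have [vU|vU] := boolP (ract v U \in W).
  have [vD|vD] := boolP (ract v D \in W).
    by exists i, v; split=> //; apply: deg vW.
  case: i vi => [|i] vi; first by rewrite -vi ractD0 mem0v in vD.
  have vDi := ractD_deg vi.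
  have [vDU|vDU] := boolP (ract (ract v D) U \in W).
    exists i, (ract v D); split=> //; [exact: deg vDi vD|exact: sV|].
    by rewrite ractDD mem0v.
  have vDUi := ractU_deg vDi.
  exists i.+1, (ract (ract v D) U); split=> //; [exact: deg vDUi vDU|by apply/sV/sV|].
  by rewrite ractUU ractDUD mem0v.
have vUi := ractU_deg vi.
have [vUD|vUD] := boolP (ract (ract v U) D \in W).
  exists i.+1, (ract v U); split=> //; [exact: deg vUi vU|exact: sV|].
  by rewrite ractUU mem0v.
have vUDi := ractD_deg vUi.
exists i, (ract (ract v U) D); split=> //; [exact: deg vUDi vUD|by apply/sV/sV|].
by rewrite ractUDU ractDD mem0v.
Qed.

Lemma L_U j (v : L j) : ract v U = 0.
Proof. by apply: mcoP => x; rewrite mco_U mco0 /mok; case: x => [[] []] /=; rewrite ?andbF. Qed.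

Lemma L_D j (v : L j) : ract v D = 0.
Proof. by apply: mcoP => x; rewrite mco_D mco0 /mok; case: x => [[] []] /=; rewrite ?andbF. Qed.

Lemma L_expand j (v : L j) : v = mco 00 v *: mgen Z false false j.
Proof. by rewrite {1}[v]zpath_expand !L_U !L_D !scaler0 !addr0. Qed.

Lemma L_hom N j (w : N) : ract w (E j) = w -> ract w U = 0 -> ract w D = 0 ->
  exists F : rhom (L j) N, F (mgen Z false false j) = w.
Proof.
move=> wj wU wD; have [jm|jm] := leqP j m; last first.
  exists (rhom0 _ _); rewrite /= -wj ractE_big //.
apply: model_hom => // x; rewrite ract_zpath /mok jm.
by case: x => [[] []] //=; rewrite ?wU ?wD ?ract0.
Qed.

Definition null_mod N : Prop := forall v : N, v = 0.

Lemma null_dim N : null_mod N <-> \dim (fullv : {vspace N}) = 0%N.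
Proof.
split=> [h|/eqP]; first by apply/eqP; rewrite dimv_eq0 -subv0; apply/subvP => v _; rewrite (h v) mem0v.
by rewrite dimv_eq0 => /eqP h v; apply/eqP; rewrite -memv0 -h memvf.
Qed.

Lemma dim_ses_full X Y W (f : rhom X Y) (g : rhom Y W) : ses f g ->
  \dim (fullv : {vspace Y}) = (\dim (fullv : {vspace X}) + \dim (fullv : {vspace W}))%N.
Proof.
move=> [fi gs ex]; apply: (dim_ses (f := f) (g := g)) => //.
- by move=> u _ fu; apply: fi; rewrite fu linear0.
- by move=> u _; split; [exact: memvf | apply/ex; exists u].
- by move=> v _ /ex[x fx]; exists x; rewrite ?memvf.
- by move=> v _; exact: memvf.
- by move=> w _; have [v vw] := gs w; exists v; rewrite ?memvf.
Qed.

Lemma submodule0 M : submodule (0%VS : {vspace M}).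
Proof. by move=> v a; rewrite !memv0 => /eqP ->; rewrite ract0. Qed.

Lemma submodulef M : submodule (fullv : {vspace M}).
Proof. by move=> v a _; exact: memvf. Qed.

Lemma simple_sub N : ~ null_mod N -> exists j X (f : rhom (L j) N) (g : rhom N X),
  (j <= m)%N /\ ses f g.
Proof.
move=> nz; have [||||i [v [im _ v0 vi [vU vD]]]] := @socle_mod N 0%VS fullv.
- exact: submodule0.
- exact: submodulef.
- exact: subvf.
- by move=> e; apply: nz; apply/null_dim; rewrite -e dimv0.
move: v0 vU vD; rewrite !memv0 => v0 /eqP vU /eqP vD.
have [F FE] := L_hom vi vU vD.
have FfE x : F x = mco 00 x *: v by rewrite {1}[x]L_expand linearZ /= FE.
have Fi : injective F.
  move=> x y; rewrite !FfE => /eqP; rewrite -subr_eq0 -scalerBl scaler_eq0 (negbTE v0) orbF subr_eq0.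
  by move=> /eqP h; rewrite [x]L_expand [y]L_expand h.
have sv : submodule <[v]>%VS.
  move=> u a /vlineP[c ->]; apply/vlineP; have [d dE] : exists d, ract (mgen Z false false i) a = d *: mgen Z false false i.
    by exists (mco 00 (ract (mgen Z false false i) a)); rewrite -L_expand.
  by exists (c * d); rewrite ractZ -FE -rfunP dE linearZ /= FE scalerA.
have [X [g [gs gk]]] := exists_quot sv.
exists i, X, F, g; split=> //; split=> // y; rewrite gk; split=> [/vlineP[c ->]|[x <-]].
  by exists (c *: mgen Z false false i); rewrite linearZ /= FE.
by rewrite FfE; apply/vlineP; exists (mco 00 x).
Qed.

Lemma devissage (Pr : rmod A -> Prop) :
  (forall N, null_mod N -> Pr N) -> (forall j, (j <= m)%N -> Pr (L j)) ->
  (forall X Y W (f : rhom X Y) (g : rhom Y W), ses f g -> Pr X -> Pr W -> Pr Y) ->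
  forall N, Pr N.
Proof.
move=> P0 PL Pext N.
have [n] := ubnP (\dim (fullv : {vspace N})); elim: n N => // n IH N le.
have [nz|nz] := pselect (null_mod N); first exact: P0.
have [j [X [f [g [jm fg]]]]] := simple_sub nz.
apply: (Pext _ _ _ _ _ fg); [exact: PL | apply: IH].
have := dim_ses_full fg; suff : (0 < \dim (fullv : {vspace (L j)}))%N by lia.
rewrite lt0n; apply/eqP => /null_dim /(_ (mgen Z false false j)).
exact: mgen_neq0.
Qed.

(* nab a is the costandard module with socle a, including nab 0 = L 0. *)
Definition nab a : rmod A := if a is a'.+1 then nabla a' else L 0.

(** The kernel of P a -> nabla a is spanned by D and UD. As [nabla a] is [nab a.+1], these sequences
    splice into a coresolution of [nab a] by P a, ..., P (m - 1) and finally [nab m]. *)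
Lemma nab_proj_ses a : (a < m)%N ->
  exists (f : rhom (nab a) (P a)) (g : rhom (P a) (nabla a)), ses f g.
Proof.
move=> am; have [g gs gk] := nabla_aug Z am.
suff [f [fi fE]] : exists f : rhom (nab a) (P a), injective f /\
    forall x, (exists y, f y = x) <-> mco 00 x = 0 /\ mco 10 x = 0.
  by exists f, g; split=> // y; rewrite gk fE.
case: a am {g gs gk} => [|a] am /=.
  pose p := mgen Z true true 0.
  have [|||F FE] := @L_hom (P 0) 0 (ract (ract p U) D).
  - by apply: ractD_deg; apply: ractU_deg; exact: mgenE.
  - exact: ractUDU.
  - exact: ractDD.
  have FfE x : F x = mco 00 x *: ract (ract p U) D by rewrite {1}[x]L_expand linearZ /= FE.
  exists F; split=> [x y /(congr1 (mco 11))|x].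
    rewrite !FfE !(mcoZ, mco_D, mco_U, mco_gen) /mok /= am !mulr1 => h.
    by rewrite [x]L_expand [y]L_expand h.
  split=> [[y <-]|[h0 h1]].
    by rewrite FfE !(mcoZ, mco_D, mco_U, mco_gen) /= !andbF !mulr0.
  exists (mco 11 x *: mgen Z false false 0).
  rewrite linearZ /= FE [RHS]zpath_expand h0 h1 [mco 01 x]mco_out; last by rewrite /mok.
  by rewrite !scale0r !add0r.
pose p := mgen Z true true a.+1.
have pd : ract (ract p D) (E a) = ract p D by apply: ractD_deg; exact: mgenE.
have [|F FE] := @model_hom _ _ _ Z true false a (P a.+1) (ract p D) pd.
  move=> x; rewrite ract_zpath /mok (ltnW (ltnW am)) (ltnW am).
  by case: x => [[] []] //= _; rewrite ?ractDUD ?ractDD.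
have FfE x : F x = mco 00 x *: ract p D + mco 10 x *: ract (ract p U) D.
  rewrite {1}[x]nabla_expand linearD !linearZ rfunP /= FE.
  by rewrite (@ractDU_deg _ _ _ _ _ p a.+1) ?mgenE.
exists F; split=> [x y|x].
  rewrite !FfE => h; have := congr1 (mco 01) h; have := congr1 (mco 11) h.
  rewrite !(mcoD, mcoZ, mco_D, mco_U, mco_gen) /mok /= am (ltnW am) /= !mulr1 !mulr0 !addr0 !add0r => e1 e0.
  by rewrite [x]nabla_expand [y]nabla_expand e0 e1.
split=> [[y <-]|[h0 h1]].
  by rewrite FfE !(mcoD, mcoZ, mco_D, mco_U, mco_gen) /= !andbF !mulr0 !addr0.
exists (mco 01 x *: mgen Z true false a + mco 11 x *: ract (mgen Z true false a) U).
rewrite linearD !linearZ rfunP /= FE [RHS]zpath_expand h0 h1 !scale0r !add0r.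
by rewrite (@ractDU_deg _ _ _ _ _ p a.+1) ?mgenE.
Qed.

Lemma nab_simple_ses a : (a < m)%N ->
  exists (f : rhom (L a.+1) (nab a.+1)) (g : rhom (nab a.+1) (L a)), ses f g.
Proof.
move=> am; pose p := mgen Z true false a.
have [|||f fE] := @L_hom (nabla a) a.+1 (ract p U).
- by apply: ractU_deg; exact: mgenE.
- exact: ractUU.
- exact: nabla_D.
have [|g gE] := @model_hom _ _ _ Z true false a (L a) (mgen Z false false a) (mgenE Z _ _ _).
  move=> x; rewrite ract_zpath /mok (ltnW am) am.
  by case: x => [[] []] //= _; rewrite ?L_U ?L_D.
have ffE x : f x = mco 00 x *: ract p U by rewrite {1}[x]L_expand linearZ /= fE.
have ggE x : g x = mco 00 x *: mgen Z false false a.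
  by rewrite {1}[x]nabla_expand linearD !linearZ rfunP /= gE L_U scaler0 addr0.
exists f, g; split=> [x y /(congr1 (mco 10))|y|y].
- rewrite !ffE !(mcoZ, mco_U, mco_gen) /mok /= am (ltnW am) !mulr1 => h.
  by rewrite [x]L_expand [y]L_expand h.
- by exists (mco 00 y *: p); rewrite linearZ /= gE -L_expand.
rewrite ggE; split=> [/(congr1 (mco 00))|[x <-]].
  rewrite mcoZ mco_gen mco0 /mok (ltnW am) mulr1 => h.
  exists (mco 10 y *: mgen Z false false a.+1).
  by rewrite linearZ /= fE [RHS]nabla_expand h scale0r add0r.
by rewrite ffE mcoZ mco_U /= andbF mulr0 scale0r.
Qed.

(** Composition with [mu] identifies Hom(X, I) with the dual of X e_a for every X: I is the
    indecomposable injective of vertex a. *)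
Definition cogenerates (I : rmod A) (a : nat) : Prop :=
  exists mu : {linear I -> k^o},
  [/\ forall v, mu (ract v (E a)) = mu v,
      forall X (F : rhom X I), (forall v, mu (F v) = 0) -> forall v, F v = 0 &
      forall X (l : {linear X -> k^o}), (forall v, l (ract v (E a)) = l v) ->
        exists F : rhom X I, forall v, mu (F v) = l v].

(** The form reads the coordinate of UD. Under it 1 pairs with UD and U with D, so every coordinate
    of a vector is detected after multiplying by a suitable word. For a < m the word UD is alive. *)
Lemma proj_cogenerates a : (a < m)%N -> cogenerates (P a) a.
Proof.
move=> am; exists (lin_of (@mco_lin _ _ _ Z true true a 11)); split=> [v|X F F0 v|X l lE] /=.
- by rewrite mco_E /= addnK eqxx.
- apply: mcoP => x; rewrite mco0; have [okx|nx] := boolP (@mok m true true a x); last exact: mco_out.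
  have am' := ltnW am.
  case: x okx => [[] []] okx.
  + exact: F0.
  + have := F0 (ract v D); rewrite rfunP /= mco_D /mok /= am am' orbT; done.
  + have a0 : (0 < a)%N by move: okx; rewrite /mok /= orbF => /andP[].
    have := F0 (ract v U); rewrite rfunP /= mco_U /mok /= am am' orbT; done.
  + have := F0 (ract (ract v U) D).
    by rewrite !rfunP /= mco_D mco_U /mok /= am am' orbT /=; done.
pose g := mgen Z true true a.
(* The coefficients solve mu (F v w) = l (v w) for the words w = UD, D, U, 1. *)
pose F (v : X) : P a := l (ract (ract v U) D) *: g + l (ract v D) *: ract g U +
  l (ract v U) *: ract g D + l v *: ract (ract g U) D.
have ga : ract g (E a) = g by exact: mgenE.
have Fl : linear F.
  move=> c u v; rewrite /F !ractD !ractZ !linearP !scalerDl !scalerDr !scalerA.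
  by rewrite [RHS](AC (4*4) ((1*5)*(2*6)*(3*7)*(4*8)))%AC.
have lei v i : l (ract v (E i)) = if i == a then l v else 0.
  case: eqVneq => [->|ia]; rewrite ?lE //.
  by rewrite -lE ractEE (negbTE ia) linear0.
have gE i : ract g (E i) = if i == a then g else 0.
  by rewrite -ga ractEE eq_sym; case: ifP; rewrite ?ractE_id.
have lU0 u : a = 0%N -> l (ract u U) = 0 by move=> a0; rewrite -lE a0 ractU0 linear0.
have gD0 : a = 0%N -> ract g D = 0.
  by move=> /esym/eqP a0; have := ractD0 Z g; rewrite gE a0.
have [|||G GE] := rhom_of_gen (Z := Z) Fl.
- move=> i v; rewrite /F !ractD !ractZ; congr (_ + _ + _ + _).
  + by rewrite ractEU ractED lei gE; case: ifP => _; rewrite ?scale0r ?scaler0.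
  + case: i => [|i]; first by rewrite ractD0 linear0 scale0r ractU0 scaler0.
    by rewrite ractED lei -ractEU gE; case: ifP => _; rewrite ?ract0 ?scale0r ?scaler0.
  + by rewrite ractEU lei -ractED gE; case: ifP => _; rewrite ?ract0 ?scale0r ?scaler0.
  + by rewrite lei -ractED -ractEU gE; case: ifP => _; rewrite ?ract0 ?scale0r ?scaler0.
- move=> v; rewrite /F !ractD !ractZ ractUU ract0 !ractUU ractUDU !linear0 ?scale0r ?scaler0.
  rewrite !add0r !addr0; congr (_ + _).
  have [a0|a0] := posnP a; last by rewrite (ractDU_deg ga a0).
  by rewrite (gD0 a0) (lU0 _ a0) ract0 scale0r scaler0.
- move=> v; rewrite /F !ractD !ractZ ractDUD ractDD !linear0 !ractDD ?scale0r ?scaler0.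
  rewrite !add0r !addr0; congr (_ + _).
  have [a0|a0] := posnP a; first by rewrite (gD0 a0) !scaler0.
  by rewrite -[l (ract (ract v D) U)]lE (ractDU_comp _ _ a0) lE.
exists G => v; rewrite GE /F !(mcoD, mcoZ, mco_D, mco_U, mco_gen) /mok /= am (ltnW am) !orbT /=.
by rewrite !mulr0 !add0r mulr1.
Qed.

(** At the last vertex the loop UD is dead, and the injective module is the costandard one with
    socle m; its form reads the socle coordinate 10. *)
Lemma nabla_cogenerates a : a.+1 = m -> cogenerates (nabla a) m.
Proof.
move=> am; have am1 : (a < m)%N by lia.
exists (lin_of (@mco_lin _ _ _ Z true false a 10)); split=> [v|X F F0 v|X l lE] /=.
- by rewrite mco_E /= subn0 addn1 am eqxx.
- apply: mcoP => x; rewrite mco0; have [okx|nx] := boolP (@mok m true false a x); last exact: mco_out.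
  case: x okx => [[] []] okx; try by move: okx; rewrite /mok /= ?andbF.
    exact: F0.
  have := F0 (ract v U).
  by rewrite rfunP /= mco_U /mok /= am1 (ltnW am1) /=; done.
pose g := mgen Z true false a.
pose F (v : X) : nabla a := l (ract v U) *: g + l v *: ract g U.
have ga : ract g (E a) = g by exact: mgenE.
have Fl : linear F.
  move=> c u v; rewrite /F !ractD !ractZ !(linearP l) !scalerDl !scalerDr !scalerA.
  by rewrite [RHS](AC (2*2) ((1*3)*(2*4)))%AC.
have lei v i : l (ract v (E i)) = if i == m then l v else 0.
  case: eqVneq => [->|im]; rewrite ?lE //.
  by rewrite -lE ractEE (negbTE im) linear0.
have gE i : ract g (E i) = if i == a then g else 0.
  by rewrite -ga ractEE eq_sym; case: ifP; rewrite ?ractE_id.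
have eqm i : (i.+1 == m) = (i == a) by rewrite -am eqSS.
have m0 : (0%N == m) = false by rewrite -am.
have [|||G GE] := rhom_of_gen (Z := Z) Fl.
- move=> i v; rewrite /F !ractD !ractZ; congr (_ + _).
    by rewrite ractEU lei eqm gE; case: ifP => _; rewrite ?scale0r ?scaler0.
  rewrite lei; case: i => [|i]; first by rewrite ractU0 scaler0 m0 scale0r.
  by rewrite -ractEU eqm gE; case: ifP => _; rewrite ?ract0 ?scale0r ?scaler0.
- by move=> v; rewrite /F !ractD !ractZ !ractUU linear0 scale0r !scaler0 add0r addr0.
- move=> v; rewrite /F !ractD !ractZ !nabla_D !scaler0.
  have lD u : l (ract u D) = 0 by rewrite -lE ractDm linear0.
  by rewrite -[l (ract (ract v D) U)]lE ractDU_comp ?lE ?lD ?scale0r ?addr0 //; lia.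
exists G => v; rewrite GE /F !(mcoD, mcoZ, mco_U, mco_gen) /mok /= am1 (ltnW am1) /=.
by rewrite mulr0 add0r mulr1.
Qed.

(** The form mu g is extended to Y by a linear retraction of f. The homomorphism representing it
    restricts to g because [mu] separates homomorphisms into I. *)
Lemma cogenerates_injective I a : cogenerates I a -> injective_rmod I.
Proof.
move=> [mu [muE mu0 muF]] X Y f g fi.
have [r rE] := inj_retract (f := f) fi.
have hl : linear (fun y : Y => mu (g (r (ract y (E a)))) : k^o).
  by move=> c u v; rewrite ractD ractZ !linearP.
have [|F FE] := muF Y (lin_of hl); first by move=> v /=; rewrite ractE_id.
exists F => x; apply/eqP; rewrite -subr_eq0; apply/eqP.
apply: (mu0 _ (rsub (rcomp F f) g)) => v /=.
by rewrite linearB FE /= -rfunP rE rfunP muE subrr.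
Qed.

Lemma cogenerates_hdim I a X : cogenerates I a -> hdim X I = wd X (E a).
Proof.
move=> [mu [muE mu0 muF]].
have aa : E a * E a = E a by rewrite zEE eqxx.
pose S := subvs_of (comp_space X (E a)).
have Gl : linear (fun h : 'Hom(X, I) => linfun (mu \o (h \o vsval : S -> I)) : 'Hom(S, k^o)).
  move=> c u v; apply/lfunP => s; rewrite !lfunE /= !lfunE /=.
  by rewrite !lfunE /= linearP.
have Fl : linear (fun h : 'Hom(X, I) => 0 : 'Hom(X, I)) by move=> c u v; rewrite scaler0 addr0.
(* With left term 0, [dim_ses] expresses that Hom(X, I) and the dual of X e_a are isomorphic. *)
rewrite /hdim (@dim_ses _ _ _ _ 0%VS (hom_space X I) (fullv : {vspace 'Hom(S, k^o)}) (lin_of Fl) (lin_of Gl)) //=.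
- rewrite dimv0 add0n dimvf /wd /dim /=.
  exact: muln1.
- by move=> u; rewrite memv0 => /eqP.
- by move=> u _; split; [exact: mem0v | apply/lfunP => s; rewrite !lfunE /= lfunE linear0].
- move=> h /hom_space_rhom[F FE] h0; exists 0; rewrite ?mem0v //.
  apply/lfunP => x; rewrite lfunE -FE; apply/esym/mu0 => v; rewrite -muE -rfunP.
  have vS : ract v (E a) \in comp_space X (E a) by apply/comp_spaceP => //; rewrite ractE_id.
  have := congr1 (fun h : 'Hom(S, k^o) => h (Subvs vS)) h0.
  by rewrite !lfunE /= FE.
- by move=> v _; exact: memvf.
move=> l _.
have Xl : linear (fun x : X => l (vsproj (comp_space X (E a)) (ract x (E a)))).
  by move=> c u v; rewrite ractD ractZ !linearP.
have [|F FE] := muF X (lin_of Xl); first by move=> v /=; rewrite ractE_id.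
exists (linfun F); first exact: linfun_hom_space.
apply/lfunP => s; rewrite lfunE /= lfunE FE /=; congr (l _).
have := subvsP s => /(comp_spaceP _ aa) ->; exact: vsvalK.
Qed.

End Devissage.

(** * The Euler form and the classification of exceptional modules *)

Section EulerForm.
Context {k : fieldType} {A : algType k} {m : nat} (Z : zigzag A m).
Implicit Types M N X Y : rmod A.

Local Notation E := (zE Z).
Local Notation U := (zU Z).
Local Notation D := (zD Z).
Local Notation "00" := (false, false).
Local Notation "10" := (true, false).
Local Notation "01" := (false, true).
Local Notation P := (model Z true true).
Local Notation L := (model Z false false).
Local Notation nabla := (nabla Z).
Local Notation nab := (nab Z).

Definition dm M i : nat := wd M (E i).

Lemma EE_id i : E i * E i = E i. Proof. by rewrite zEE eqxx. Qed.

Lemma dm_ses X Y W (f : rhom X Y) (g : rhom Y W) i : ses f g ->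
  dm Y i = (dm X i + dm W i)%N.
Proof. exact/wd_ses/EE_id. Qed.

Lemma dm_null N i : null_mod N -> dm N i = 0%N.
Proof.
move=> /null_dim h; apply/eqP; rewrite -leqn0 -h; exact/dimvS/subvf.
Qed.

Lemma dm_big M i : (m < i)%N -> dm M i = 0%N.
Proof.
move=> mi; apply/eqP; rewrite dimv_eq0 -subv0; apply/subvP => v.
by move=> /(comp_spaceP _ (EE_id i)) <-; rewrite ractE_big // mem0v.
Qed.

Lemma dm_L j i : (j <= m)%N -> dm (L j) i = (i == j).
Proof.
move=> jm; set g := mgen Z false false j.
have [->|ij] := eqVneq i j; last first.
  apply/eqP; rewrite dimv_eq0 -subv0; apply/subvP => v.
  move=> /(comp_spaceP _ (EE_id i)) <-; rewrite [v]L_expand ractZ -(mgenE Z false false j) ractEE.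
  by rewrite eq_sym (negbTE ij) scaler0 mem0v.
rewrite /dm /wd (_ : comp_space _ _ = <[g]>%VS).
  by rewrite dim_vline; case: eqP => // /(mgen_neq0 jm).
apply/vspaceP => v; apply/idP/vlineP => [_|[c ->]].
  by exists (mco 00 v); rewrite -L_expand.
by apply/(comp_spaceP _ (EE_id j)); rewrite ractZ mgenE.
Qed.

Lemma dm_nab a i : (a <= m)%N -> dm (nab a) i = ((i == a) + (i.+1 == a))%N.
Proof.
case: a => [|a] am; first by rewrite dm_L // addn0.
have [f [g fg]] := nab_simple_ses Z am.
by rewrite (dm_ses _ fg) !dm_L ?eqSS // ltnW.
Qed.

(* The coordinate of [M] on the class of the j-th standard module, equivalently
   of nab j. *)
Definition xc M j : int := \sum_(t < m.+1) (-1) ^+ t * (dm M (j + t))%:Z.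

(** As nab a has dimension vector supported with value 1 at a and a - 1, this is the expansion of
    [M] in the classes of the nab j, read at vertex j. *)
Lemma xcS M j : xc M j + xc M j.+1 = (dm M j)%:Z.
Proof.
rewrite {1}/xc big_ord_recl /= expr0 mul1r addn0 -addrA -[RHS]addr0; congr (_ + _).
rewrite /xc big_ord_recr /= dm_big ?mulr0 ?addr0; last by lia.
rewrite -big_split big1 //= => t _.
by rewrite /bump /= add1n exprS addnS addSn mulN1r mulNr addNr.
Qed.

Lemma xc_big M j : (m < j)%N -> xc M j = 0.
Proof. by move=> mj; rewrite /xc big1 // => t _; rewrite dm_big ?mulr0 //; lia. Qed.

(** Descending recursion from m + 1; it identifies coordinates without evaluating alternating
    sums. *)
Lemma xc_unique M (y : nat -> int) : y m.+1 = 0 ->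
  (forall j, (j <= m)%N -> y j + y j.+1 = (dm M j)%:Z) ->
  forall j, (j <= m.+1)%N -> xc M j = y j.
Proof.
move=> y0 yS j jm; rewrite -(subKn jm); elim: (m.+1 - j)%N (leq_subr j m.+1) => [|i IH] im.
  by rewrite subn0 y0 xc_big.
have e : (m.+1 - i = (m.+1 - i.+1).+1)%N by lia.
have := xcS M (m.+1 - i.+1); rewrite -yS; last by lia.
by rewrite -e IH ?(ltnW im) // => /addIr.
Qed.

Lemma xc_ses X Y W (f : rhom X Y) (g : rhom Y W) j : ses f g ->
  xc Y j = xc X j + xc W j.
Proof.
move=> fg; rewrite /xc -big_split; apply: eq_bigr => t _ /=.
by rewrite (dm_ses _ fg) PoszD mulrDr.
Qed.

Lemma xc_null N j : null_mod N -> xc N j = 0.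
Proof. by move=> h; rewrite /xc big1 // => t _; rewrite dm_null ?mulr0. Qed.

Lemma xc_nab a j : (a <= m)%N -> (j <= m)%N -> xc (nab a) j = (j == a)%:Z.
Proof.
move=> am jm; apply: (@xc_unique _ (fun j => (j == a)%:Z)); rewrite ?(leqW jm) //.
  by rewrite (_ : (m.+1 == a) = false) //; lia.
by move=> i im; rewrite dm_nab // PoszD.
Qed.

(** Written directly as the standard scalar product of coordinates; its homological meaning is
    [hdim_euler]. *)
Definition euler M N : int := \sum_(j < m.+1) xc M j * xc N j.

Lemma euler_ses_r M X Y W (f : rhom X Y) (g : rhom Y W) : ses f g ->
  euler M Y = euler M X + euler M W.
Proof.
move=> fg; rewrite /euler -big_split; apply: eq_bigr => j _ /=.
by rewrite (xc_ses _ fg) mulrDr.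
Qed.

Lemma euler_ses_l N X Y W (f : rhom X Y) (g : rhom Y W) : ses f g ->
  euler Y N = euler X N + euler W N.
Proof.
move=> fg; rewrite /euler -big_split; apply: eq_bigr => j _ /=.
by rewrite (xc_ses _ fg) mulrDl.
Qed.

Lemma euler_nab M a : (a <= m)%N -> euler M (nab a) = xc M a.
Proof.
move=> am; have am' : (a < m.+1)%N by [].
rewrite /euler (bigD1 (Ordinal am')) //= xc_nab // eqxx mulr1 big1 ?addr0 // => j ja.
have jm : (j <= m)%N by rewrite -ltnS.
rewrite xc_nab // (_ : (j == a :> nat) = false) ?mulr0 //.
by apply/negbTE; move: ja; rewrite -val_eqE.
Qed.

Hypothesis m_gt0 : (0 < m)%N.

Lemma nab_cogenerates : cogenerates Z (nab m) m.
Proof.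
suff h b : b = m -> cogenerates Z (nab b) m by exact: h.
case: b => [m0|b]; first by exfalso; lia.
exact: nabla_cogenerates.
Qed.

(** The numbers dim Hom(M, nab b) satisfy the recursion characterising [xc M]: neighbouring values
    add up to dim Hom(M, P b) = dim M e_b because P b is the injective of vertex b < m, and [nab m]
    is itself the injective of vertex m. *)
Lemma hdim_nab M a : projective M -> (a <= m)%N -> (hdim M (nab a))%:Z = xc M a.
Proof.
move=> pM am; pose y b : int := if (b <= m)%N then (hdim M (nab b))%:Z else 0.
suff -> : xc M a = y a by rewrite /y am.
apply: xc_unique; rewrite /y.
- by rewrite ltnn.
- move=> j jm; rewrite jm; case: ltnP => mj.
    have [f [g fg]] := nab_proj_ses Z mj.
    have lift (h : rhom M (nabla j)) : exists l : rhom M (P j), forall v, g (l v) = h v.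
      by case: fg => _ gs _; apply: pM.
    by rewrite -PoszD -(hdim_ses_r fg lift) (cogenerates_hdim _ (proj_cogenerates Z mj)).
  have -> : j = m by lia.
  by rewrite addr0 (cogenerates_hdim _ nab_cogenerates).
- exact: leqW.
Qed.

Lemma hdim_null M N : null_mod N -> hdim M N = 0%N.
Proof.
move=> h; apply/eqP; rewrite dimv_eq0 -subv0; apply/subvP => f _.
by rewrite memv0; apply/eqP/lfunP => v; rewrite [LHS]h [RHS]h.
Qed.

(** Both sides are additive in N, so simple N suffice; these follow inductively from L (j + 1) ->
    nab (j + 1) -> L j. *)
Lemma hdim_projective M N : projective M -> (hdim M N)%:Z = euler M N.
Proof.
move=> pM; elim/(devissage (Z := Z)): N => [N nN|j jm|X Y W f g fg hX hW].
- by rewrite hdim_null // /euler big1 // => j _; rewrite (xc_null _ nN) mulr0.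
- elim: j jm => [|j IH] jm; first by rewrite (hdim_nab pM (a := 0)) // -(euler_nab _ (a := 0)).
  have [f [g fg]] := nab_simple_ses Z jm.
  have lift (h : rhom M (L j)) : exists l : rhom M (nab j.+1), forall v, g (l v) = h v.
    by case: fg => _ gs _; apply: pM.
  have := hdim_nab pM jm; rewrite -euler_nab // (euler_ses_r _ fg) (hdim_ses_r fg lift).
  by rewrite PoszD IH ?(ltnW jm) // => /addIr.
- have lift (h : rhom M W) : exists l : rhom M Y, forall v, g (l v) = h v.
    by case: fg => _ gs _; apply: pM.
  by rewrite (euler_ses_r _ fg) (hdim_ses_r fg lift) PoszD hX hW.
Qed.

(** Taking the first syzygy K for Y, the cocycle R 1 -> K extends to a retraction of K -> R 0, so
    that M is a summand of R 0. *)
Lemma exact_at1_projective M (R : proj_resolution M) :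
  (forall Y, exact_at R Y 1) -> projective M.
Proof.
move=> ex; have [K [i [p [ii iK ps pE]]]] := exists_ses_sub (pr_exact0 R).
have [|r rE] := ex K p.
  by move=> y; apply: ii; rewrite pE pr_dd linear0.
have ri u : r (i u) = u by have [x <-] := ps u; rewrite pE -rE.
(* The lift h on R 0 is corrected to h - h i r, which vanishes on K and hence descends to M. *)
move=> X Y g f gs; have [h hE] := pr_proj R 0 (rcomp f (pr_aug R)) gs.
have [|l lE] := rhom_factor_surj (h := rsub h (rcomp h (rcomp i r))) (pr_surj R).
  by move=> x /iK[u <-] /=; rewrite ri subrr.
exists l => v; have [x <-] := pr_surj R v; rewrite lE /= linearB !hE /=.
have -> : pr_aug R (i (r x)) = 0 by apply/iK; exists (r x).
by rewrite linear0 subr0.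
Qed.

(** Induction on a bound d for the projective dimension. The tail of R resolves the syzygy K, and
    Ext^1(M, N) = 0 makes Hom(R 0, N) -> Hom(K, N) surjective, so dimensions are additive along K ->
    R 0 -> M. *)
Lemma hdim_euler N d M (R : proj_resolution M) :
  (forall t, exact_at R N t.+1) -> (forall Y, exact_at R Y d.+1) ->
  (hdim M N)%:Z = euler M N.
Proof.
elim: d M R => [|d IH] M R exN exY.
  exact/hdim_projective/(exact_at1_projective exY).
have [K [i [p [ii iK ps pE]]]] := exists_ses_sub (pr_exact0 R).
have iR : ses i (pr_aug R) by split=> //; exact: pr_surj.
have p0 x : p x = 0 <-> exists y, pr_d R 1 y = x.
  rewrite -pr_exactS -pE; split=> [->|]; first exact: linear0.
  by move=> h; apply: ii; rewrite h linear0.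
pose R' := @ProjRes k A K (fun t => R t.+1) (fun t => pr_d R t.+1) p
  (fun t => pr_proj R t.+1) ps p0 (fun t => pr_exactS R t.+1).
have hK : (hdim K N)%:Z = euler K N.
  by apply: (IH K R') => [t|Y]; [exact: (exN t.+1)|exact: (exY Y)].
have hP := hdim_projective N (pr_proj R 0).
have ext (h : rhom K N) : exists l : rhom (R 0%N) N, forall v, l (i v) = h v.
  have [|l lE] := exN 0%N (rcomp h p).
    move=> y /=; have -> : p (pr_d R 1 y) = 0 by apply/p0; exists y.
    exact: linear0.
  by exists l => v; have [x <-] := ps v; rewrite pE -lE.
have := hP; rewrite (euler_ses_l _ iR) (hdim_ses_l iR ext) PoszD hK.
by move/addrI.
Qed.

(** The injective dimension of nab a is at most m - a, by shifting along nab a -> P a -> nab (a +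
    1). *)
Lemma exact_at_nab M (R : proj_resolution M) a t : (a <= m)%N -> (m - a <= t)%N ->
  exact_at R (nab a) t.+1.
Proof.
move=> am; rewrite -{2}(subKn am); move: (m - a)%N (leq_subr a m) => {am}d dm.
elim: d dm t => [|d IH] dm t dt.
  by rewrite subn0; apply: exact_at_injective; apply: cogenerates_injective nab_cogenerates.
case: t dt => // t dt.
have [|f [g fg]] := @nab_proj_ses _ _ _ Z (m - d.+1); first by lia.
have iP : exact_at R (P (m - d.+1)) t.+2.
  by apply: exact_at_injective; apply: cogenerates_injective (proj_cogenerates Z _); lia.
apply: (exact_at_shift fg iP).
have -> : nabla (m - d.+1) = nab (m - d) by rewrite (_ : (m - d = (m - d.+1).+1)%N) //; lia.
by apply: IH; lia.
Qed.

(** The bound starts at m for L 0 = nab 0 and grows by one with each sequence L (j + 1) -> nab (j +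
    1) -> L j. *)
Lemma exact_at_L M (R : proj_resolution M) j t : (j <= m)%N -> (m + j <= t)%N ->
  exact_at R (L j) t.+1.
Proof.
elim: j t => [|j IH] t jm jt; first by apply: (@exact_at_nab M R 0); lia.
case: t jt => [|t] jt; first by lia.
have [f [g fg]] := nab_simple_ses Z jm.
by apply: (exact_at_shift fg); [apply: exact_at_nab|apply: IH]; lia.
Qed.

(** All simples have injective dimension at most m + m, so this bounds the global dimension. *)
Lemma exact_at_large M (R : proj_resolution M) N : exact_at R N (m + m).+1.
Proof.
elim/(devissage (Z := Z)): N => [N nN f fc|j jm|X Y W f g fg hX hW].
- by exists (rhom0 _ _) => x; apply: nN.
- by apply: exact_at_L => //; lia.
- exact: exact_at_ses fg hX hW.
Qed.

Lemma exceptional_euler M : exceptional M -> euler M M = 1.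
Proof.
move=> [brick ext]; have [R _] := ext 1%N isT.
rewrite -(@hdim_euler M (m + m) M R) ?(hdim_brick brick) // => [t|Y].
  exact/(ext_vanishesE R _ (riso_refl M) (riso_refl M))/ext.
exact: exact_at_large.
Qed.

Lemma sum_sqr1 (n : nat) (y : nat -> int) : \sum_(j < n) y j * y j = 1 ->
  exists2 a : nat, (a < n)%N & `|y a| = 1 /\ forall j, (j < n)%N -> j != a -> y j = 0.
Proof.
move=> s1; have [a ya] : exists a : 'I_n, y a != 0.
  apply: contrapT => h; move: s1; rewrite big1 // => j _.
  by apply/eqP; rewrite mulf_eq0 orbb; apply/negPn/negP => yj; apply: h; exists j.
have sq (b : int) : b != 0 -> 1 <= b * b by move=> b0; nia.
exists a => //; move: s1; rewrite (bigD1 a) //= => s1.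
have ge0 (S : pred 'I_n) : 0 <= \sum_(j < n | S j) y j * y j.
  by apply: sumr_ge0 => j _; rewrite -expr2 sqr_ge0.
split=> [|j jn ja].
  have yy : y a * y a = 1.
    apply/eqP; rewrite eq_le sq // andbT -s1 lerDl; exact: ge0.
  by move/eqP: yy; rewrite -expr2 sqrf_eq1 => /orP[] /eqP ->.
apply/eqP/negPn/negP => yj; move: s1.
rewrite (bigD1 (Ordinal jn)) /=; last by rewrite -val_eqE.
move=> s1; have := sq _ ya; rewrite -s1 gerDl => h.
have := le_trans (lerD (sq _ yj) (ge0 (fun i => (i != a) && (i != Ordinal jn)))) h.
by rewrite addr0.
Qed.

Lemma exceptional_dm M : exceptional M -> exists2 a, (a <= m)%N &
  forall i, dm M i = ((i == a) + (i.+1 == a))%N.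
Proof.
move=> /exceptional_euler/sum_sqr1[a am [ya y0]]; exists a => // i.
have [im|im] := leqP i m; last by rewrite dm_big //; lia.
have y0' j : j != a -> xc M j = 0.
  move=> ja; have [jm|jm] := leqP j m; first exact: y0.
  exact: xc_big.
(* The value -1 is impossible: as the coordinate at a + 1 vanishes, the one at a is the dimension of
   M e_a. *)
have ya1 : xc M a = 1.
  by have := xcS M a; rewrite (y0' a.+1) ?addr0; [lia|lia].
have := xcS M i.
have [->|ia] := eqVneq i a; first by rewrite ya1 y0'; lia.
rewrite y0' //; have [->|ia'] := eqVneq i.+1 a; first by rewrite ya1; lia.
by rewrite y0' //; lia.
Qed.

Lemma dm0_act M i (v : M) : dm M i = 0%N -> ract v (E i) = 0.
Proof.
move=> /eqP; rewrite dimv_eq0 => /eqP h; apply/eqP; rewrite -memv0 -h.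
by apply/(comp_spaceP _ (EE_id i)); rewrite ractE_id.
Qed.

Lemma dm1_gen M i : dm M i = 1%N -> exists2 g : M, g != 0 /\ ract g (E i) = g &
  forall v : M, exists c : k, ract v (E i) = c *: g.
Proof.
move=> d1; have n0 : comp_space M (E i) != 0%VS by rewrite -dimv_eq0 -[\dim _]/(dm M i) d1.
have gi := memv_pick (comp_space M (E i)).
exists (vpick (comp_space M (E i))).
  by rewrite vpick0 n0; split=> //; apply/(comp_spaceP _ (EE_id i)).
move=> v; apply/vlineP.
suff -> : <[vpick (comp_space M (E i))]>%VS = comp_space M (E i).
  by apply/(comp_spaceP _ (EE_id i)); rewrite ractE_id.
apply/eqP; rewrite eqEdim dim_vline vpick0 n0 -[\dim (comp_space _ _)]/(dm M i) d1.
by rewrite -memvE gi.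
Qed.

Lemma pair_indep M a b (s t : M) : a != b -> s != 0 -> t != 0 ->
  ract s (E a) = s -> ract t (E b) = t ->
  forall c d : k, c *: s + d *: t = 0 -> c = 0 /\ d = 0.
Proof.
move=> ab s0 t0 sE tE c d h.
have sb : ract s (E b) = 0 by exact: ractE_deg sE ab.
have ta : ract t (E a) = 0 by apply: (ractE_deg tE); rewrite eq_sym.
have := congr1 (fun v => ract v (E a)) h; have := congr1 (fun v => ract v (E b)) h.
rewrite /= !ractD !ractZ !ract0 sE tE sb ta !scaler0 add0r addr0.
move/eqP; rewrite scaler_eq0 (negbTE t0) orbF => /eqP->.
by move/eqP; rewrite scaler_eq0 (negbTE s0) orbF => /eqP->.
Qed.

Lemma Delta_of_basis M a (s t : M) (e : k) : (a < m)%N -> s != 0 -> t != 0 ->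
  ract s (E a) = s -> ract t (E a.+1) = t -> (forall v, exists c d, v = c *: s + d *: t) ->
  ract t U = 0 -> ract t D = e *: s -> e != 0 -> riso (Delta Z a.+1) M.
Proof.
move=> am s0 t0 sE tE Mgen tU eE e0.
have indep := pair_indep (negbT (ltn_eqF (ltnSn a))) s0 t0 sE tE.
have [|F FE] := @model_hom _ _ _ Z false true a.+1 M t tE.
  move=> x; rewrite ract_zpath /mok am /=.
  by case: x => [[] []] //= _; rewrite ?tU ?ract0.
have FfE x : F x = (mco 01 x * e) *: s + mco 00 x *: t.
  by rewrite {1}[x]Delta_expand linearD !linearZ rfunP /= FE eE scalerA addrC.
exists F; apply: bij_of_inj_surj => [x y|v].
  rewrite !FfE => /eqP; rewrite -subr_eq0 opprD addrACA -!scalerBl -mulrBl => /eqP/indep[h1 h2].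
  rewrite [x]Delta_expand [y]Delta_expand; move/eqP: h1.
  rewrite mulf_eq0 (negbTE e0) orbF subr_eq0 => /eqP ->.
  by move/eqP: h2; rewrite subr_eq0 => /eqP ->.
have [c [d ->]] := Mgen v.
exists (d *: mgen Z false true a.+1 + (c / e) *: ract (mgen Z false true a.+1) D).
by rewrite linearD !linearZ rfunP /= FE eE scalerA divfK // addrC.
Qed.

Lemma nabla_of_basis M a (s t : M) (e : k) : (a < m)%N -> s != 0 -> t != 0 ->
  ract s (E a) = s -> ract t (E a.+1) = t -> (forall v, exists c d, v = c *: s + d *: t) ->
  ract s D = 0 -> ract t D = 0 -> ract s U = e *: t -> e != 0 -> riso (nabla a) M.
Proof.
move=> am s0 t0 sE tE Mgen sD tD eE e0.
have indep := pair_indep (negbT (ltn_eqF (ltnSn a))) s0 t0 sE tE.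
have [|F FE] := @model_hom _ _ _ Z true false a M s sE.
  move=> x; rewrite ract_zpath /mok (ltnW am) am /=.
  by case: x => [[] []] //= _; rewrite ?sD // eE ractZ tD scaler0.
have FfE x : F x = mco 00 x *: s + (mco 10 x * e) *: t.
  by rewrite {1}[x]nabla_expand linearD !linearZ rfunP /= FE eE scalerA.
exists F; apply: bij_of_inj_surj => [x y|v].
  rewrite !FfE => /eqP; rewrite -subr_eq0 opprD addrACA -!scalerBl -mulrBl => /eqP/indep[h1 h2].
  rewrite [x]nabla_expand [y]nabla_expand; move/eqP: h2.
  rewrite mulf_eq0 (negbTE e0) orbF subr_eq0 => /eqP ->.
  by move/eqP: h1; rewrite subr_eq0 => /eqP ->.
have [c [d ->]] := Mgen v.
exists (c *: mgen Z true false a + (d / e) *: ract (mgen Z true false a) U).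
by rewrite linearD !linearZ rfunP /= FE eE scalerA divfK.
Qed.

(** M consists of lines at two neighbouring vertices, or of one line if a = 0. U and D between them
    cannot both be nonzero because UDU = 0, and cannot both vanish because M would decompose. *)
Lemma brick_model M a : (a <= m)%N ->
  (forall f : rhom M M, exists! c : k, forall v, f v = c *: v) ->
  (forall i, dm M i = ((i == a) + (i.+1 == a))%N) ->
  exists2 c : bool * nat, code_ok (m := m) c & riso (code_mod Z c) M.
Proof.
move=> am brick dmM.
have [|t [t0 tE] tgen] := @dm1_gen M a; first by rewrite dmM eqxx; lia.
have other i (v : M) : i != a -> i.+1 != a -> ract v (E i) = 0.
  by move=> ia ia'; apply: dm0_act; rewrite dmM (negbTE ia) (negbTE ia').
have tU : ract t U = 0 by rewrite -(ractU_deg tE) other //; lia.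
case: a am dmM tE tgen other => [|a] am dmM tE tgen other.
  have Mgen (v : M) : exists c, v = c *: t.
    have [c cE] := tgen v; exists c; rewrite -(ract_sumE Z v) (bigD1 ord0) //= cE.
    by rewrite big1 ?addr0 // => i i0; rewrite other //; move: i0; rewrite -val_eqE.
  have [F FE] := L_hom tE tU (etrans (congr1 (fun w => ract w D) (esym tE)) (ractD0 Z t)).
  have FfE x : F x = mco 00 x *: t by rewrite {1}[x]L_expand linearZ /= FE.
  have [|G GE] := @model_hom _ _ _ Z false true 0 M t tE.
    move=> x; rewrite ract_zpath /mok /=.
    by case: x => [[] []] //= _; rewrite ?tU ?ract0 // -tE ractD0.
  have GfE x : G x = mco 00 x *: t.
    rewrite {1}[x]Delta_expand linearD !linearZ rfunP /= GE -[in ract t D]tE ractD0.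
    by rewrite scaler0 addr0.
  exists (false, 0%N) => //; exists G; apply: bij_of_inj_surj => [x y|v].
    rewrite !GfE => /eqP; rewrite -subr_eq0 -scalerBl scaler_eq0 (negbTE t0) orbF subr_eq0.
    move=> /eqP h; rewrite [x]Delta_expand [y]Delta_expand h.
    by rewrite !(mco_out (x := 01)) // /mok /= andbF.
  have [c ->] := Mgen v; exists (c *: mgen Z false true 0).
  by rewrite linearZ /= GE.
have [|s [s0 sE] sgen] := @dm1_gen M a; first by rewrite dmM eqxx; lia.
have Mgen (v : M) : exists c d, v = c *: s + d *: t.
  have [c cE] := sgen v; have [d dE] := tgen v; exists c, d.
  have am' : (a < m.+1)%N by lia.
  rewrite -(ract_sumE Z v) (bigD1 (Ordinal am')) //= cE.
  rewrite (bigD1 (Ordinal (am : (a.+1 < m.+1)%N))) /=; last by rewrite -val_eqE /=; lia.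
  rewrite dE big1 ?addr0 // => i /andP[ia ia'].
  by apply: other; move: ia ia'; rewrite -!val_eqE /=; lia.
have sD : ract s D = 0.
  case: (a) sE other => [|a'] sE other; first by rewrite -sE ractD0.
  by rewrite -(ractD_deg sE) other //; lia.
have [sU0|sU0] := eqVneq (ract s U) 0.
  have [tD0|tD0] := eqVneq (ract t D) 0.
    (* The projection onto the component at one vertex is then an endomorphism; it fixes s and kills
       t, so it is not a scalar. *)
    exfalso.
    have tEa : ract t (E a) = 0 by rewrite -tE ractEE gtn_eqF.
    have pl : linear (fun v : M => ract v (E a)) by exact: ract_linl.
    have [|||p pE] := rhom_of_gen (Z := Z) pl.
    - by move=> i v; rewrite !ractEE eq_sym; case: eqP => // ->.
    - move=> v; have [c [d ->]] := Mgen v.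
      by rewrite !(ractD, ractZ) sE tEa sU0 tU !ract0 !scaler0.
    - move=> v; have [c [d ->]] := Mgen v.
      by rewrite !(ractD, ractZ) sE tEa sD tD0 !ract0 !scaler0.
    have [c [cE _]] := brick p.
    have cs : c = 1.
      have := cE s; rewrite pE sE => /eqP; rewrite -{1}[s]scale1r -subr_eq0 -scalerBl.
      by rewrite scaler_eq0 (negbTE s0) orbF subr_eq0 => /eqP.
    have := cE t; rewrite pE -{1}tE ractEE gtn_eqF // cs scale1r => h.
    by rewrite -h eqxx in t0.
  have [e eE] := sgen (ract t D); rewrite (ractD_deg tE) in eE.
  have e0 : e != 0 by apply: contraNneq tD0 => e0; rewrite eE e0 scale0r.
  exists (false, a.+1); first by rewrite /code_ok addn0.
  exact: (Delta_of_basis am s0 t0 sE tE Mgen tU eE e0).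
have [e eE] := tgen (ract s U); rewrite (ractU_deg sE) in eE.
have e0 : e != 0 by apply: contraNneq sU0 => e0; rewrite eE e0 scale0r.
(* U sends s to a nonzero multiple of t, so a nonzero t D would make s U D U nonzero. *)
have tD : ract t D = 0.
  have [d dE] := sgen (ract t D); rewrite (ractD_deg tE) in dE.
  have := ractUDU Z s; rewrite eE !ractZ dE ractZ eE !scalerA => /eqP.
  rewrite scaler_eq0 (negbTE t0) orbF !mulf_eq0 (negbTE e0) orbF /= => /eqP d0.
  by rewrite d0 scale0r.
exists (true, a); first by rewrite /code_ok addn1.
exact: (nabla_of_basis am s0 t0 sE tE Mgen sD tD eE e0).
Qed.

Lemma exceptional_model M : exceptional M ->
  exists2 c : bool * nat, code_ok (m := m) c & riso (code_mod Z c) M.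
Proof.
by move=> ex; have [a am dmM] := exceptional_dm ex; apply: brick_model dmM => //; case: ex.
Qed.

End EulerForm.

(** * Triangulated subcategories *)

Section Complexes.
Context {k : fieldType} {A : algType k}.
Implicit Types (M N : rmod A) (X Y W : @complex k A).

Definition null_complex X : Prop := forall i (x : X i), x = 0.

Lemma rsum_inl_lin M N : linear (fun x : M => (x, 0) : rsum M N).
Proof. by move=> c u v; congr (_, _); rewrite /= scaler0 addr0. Qed.
Definition rsum_inl M N : rhom M (rsum M N) :=
  mk_rhom (@rsum_inl_lin M N) (fun v a => congr1 (pair _) (esym (ract0 N a))).

Lemma rsum_inr_lin M N : linear (fun x : N => (0, x) : rsum M N).
Proof. by move=> c u v; congr (_, _); rewrite /= scaler0 addr0. Qed.
Lemma rsum_inr_act M N v a : (0, ract v a) = ract ((0, v) : rsum M N) a.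
Proof. by congr (_, _); rewrite /= ract0. Qed.
Definition rsum_inr M N : rhom N (rsum M N) :=
  mk_rhom (@rsum_inr_lin M N) (@rsum_inr_act M N).

Definition rsum_fst M N : rhom (rsum M N) M :=
  @mk_rhom k A (rsum M N) M fst (fun _ _ _ => erefl) (fun _ _ => erefl).
Definition rsum_snd M N : rhom (rsum M N) N :=
  @mk_rhom k A (rsum M N) N snd (fun _ _ _ => erefl) (fun _ _ => erefl).

Lemma rsum_ses M N : ses (rsum_inl M N) (rsum_snd M N).
Proof.
split=> [x y []//|y|[x y]]; first by exists (0, y).
by split=> [/= ->|[z [_ <-]]]; first by exists x.
Qed.

Definition cses X Y W (f : cmap X Y) (g : cmap Y W) : Prop :=
  forall i, ses (f i) (g i).

Section Cones.
Variables (X Y W : @complex k A) (f : cmap X Y) (g : cmap Y W).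
Hypothesis fg : cses f g.

Let fi i : injective (f i). Proof. by case: (fg i). Qed.
Let gs i : surjective_rhom (g i). Proof. by case: (fg i). Qed.
Let gk i y : g i y = 0 <-> exists x, f i x = y. Proof. by case: (fg i). Qed.
Let gf i x : g i (f i x) = 0. Proof. by apply/gk; exists x. Qed.

Definition cone_quot_fun i : rhom (cone f i) (W i) := rcomp (g i) (rsum_snd _ _).
Lemma cone_quotP i (x : cone f i) :
  cone_quot_fun (i + 1) (cx_d (cone f) i x) = cx_d W i (cone_quot_fun i x).
Proof. by case: x => x y /=; rewrite linearD gf add0r cmP. Qed.
Definition cone_quot : cmap (cone f) W := CMap cone_quotP.

(** In a short exact sequence of complexes the cone of the inclusion is the quotient, and the cone
    of the projection is the shifted subcomplex, up to quasi-isomorphism. Closure under cones thus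
    becomes a two-out-of-three property. *)
Lemma cone_quot_qiso : quasi_iso cone_quot.
Proof.
move=> i; split=> [[x y] [dx dy] [z zE]|z dz].
- have [y' y'E] := gs z.
  have /gk[x' x'E] : g (i + 1) (y - cx_d Y i y') = 0.
    by rewrite linearB cmP y'E zE subrr.
  exists (x', y'); congr (_, _) => /=; last by rewrite x'E subrK.
  apply: fi; rewrite linearN cmP x'E linearB cx_dd subr0.
  by apply/esym/eqP; rewrite -addr_eq0; apply/eqP.
- have [y yE] := gs z; have /gk[x xE] : g (i + 1 + 1) (cx_d Y (i + 1) y) = 0.
    by rewrite cmP yE dz.
  exists (- x, y), 0; split; last by rewrite linear0 addr0 /= yE.
  congr (_, _) => /=; last by rewrite linearN xE addNr.
  by apply: fi; rewrite !linearN opprK cmP xE cx_dd linear0.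
Qed.

Definition shift_cone_fun i : rhom (shift X i) (cone g i) :=
  rcomp (rsum_inl (Y (i + 1)) (W i)) (f (i + 1)).
Lemma shift_coneP i (x : shift X i) :
  shift_cone_fun (i + 1) (cx_d (shift X) i x) = cx_d (cone g) i (shift_cone_fun i x).
Proof.
congr (_, _) => /=; first by rewrite linearN cmP.
by rewrite gf linear0 addr0.
Qed.
Definition shift_cone : cmap (shift X) (cone g) := CMap shift_coneP.

Lemma shift_cone_qiso : quasi_iso shift_cone.
Proof.
move=> i; split=> [x dx [[y z] [y1 z1]]|[y z] [dy dz]].
- have [y0 y0E] := gs z; have /gk[w wE] : g (i + 1) (y + cx_d Y i y0) = 0.
    by rewrite linearD cmP y0E; exact: z1.
  exists w; apply: fi => /=; rewrite linearN cmP wE linearD cx_dd addr0.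
  exact: y1.
- have [y' y'E] := gs z.
  have /gk[x xE] : g (i + 1 + 1) (y + cx_d Y (i + 1) y') = 0.
    by rewrite linearD cmP y'E; exact: dz.
  exists x, (y', 0); split.
    apply: fi => /=; rewrite linearN cmP xE linearD cx_dd addr0 linear0.
    exact: dy.
  by congr (_, _) => /=; rewrite ?xE ?addrK // linear0 addr0 add0r y'E.
Qed.

Lemma cone_inrP i (y : Y i) :
  rsum_inr (X (i + 1 + 1)) (Y (i + 1)) (cx_d Y i y) = cx_d (cone f) i (rsum_inr (X (i + 1)) (Y i) y).
Proof. by congr (_, _) => /=; rewrite ?linear0 ?oppr0 ?add0r. Qed.
Definition cone_inr : cmap Y (cone f) :=
  @CMap k A Y (cone f) (fun i => rsum_inr (X (i + 1)) (Y i)) cone_inrP.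

Definition cone_fst : cmap (cone f) (shift X) :=
  @CMap k A (cone f) (shift X) (fun i => rsum_fst (X (i + 1)) (Y i)) (fun _ _ => erefl).

End Cones.

Lemma cone_cses X Y (f : cmap X Y) : cses (cone_inr f) (cone_fst f).
Proof.
move=> i; split=> [x y []//|x|[x y]]; first by exists (x, 0).
by split=> [/= ->|[z [<- _]]]; first by exists y.
Qed.

Section Triangulated.
Variables (S : @complex k A -> Prop) (trS : triangulated S).

Lemma tri_quot X Y W (f : cmap X Y) (g : cmap Y W) : cses f g -> S X -> S Y -> S W.
Proof.
by move=> fg sX sY; apply/(tr_quasi_iso trS (cone_quot_qiso fg)); apply: (tr_cone trS).
Qed.

Lemma tri_sub X Y W (f : cmap X Y) (g : cmap Y W) : cses f g -> S Y -> S W -> S X.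
Proof.
by move=> fg sY sW; apply/(tr_shift trS)/(tr_quasi_iso trS (shift_cone_qiso fg)); apply: (tr_cone trS).
Qed.

(** Y is the first term of Y -> cone f -> X[1], whose middle term is quasi-isomorphic to W. *)
Lemma tri_ext X Y W (f : cmap X Y) (g : cmap Y W) : cses f g -> S X -> S W -> S Y.
Proof.
move=> fg sX sW; apply: (tri_sub (cone_cses f)); last exact: (proj1 (tr_shift trS X) sX).
exact: (proj2 (tr_quasi_iso trS (cone_quot_qiso fg)) sW).
Qed.

(** With zero differentials any degreewise isomorphisms form a chain map. This spares transports
    between complexes that agree only degree by degree. *)
Lemma tri_iso X Y : (forall i, riso (X i) (Y i)) ->
  (forall i (x : X i), cx_d X i x = 0) -> (forall i (y : Y i), cx_d Y i y = 0) ->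
  S X -> S Y.
Proof.
move=> iXY dX dY; pose F i := projT1 (cid (iXY i)).
have Fb i : bijective (F i) := projT2 (cid (iXY i)).
have FP i (x : X i) : F (i + 1) (cx_d X i x) = cx_d Y i (F i x).
  by rewrite dX dY linear0.
suff qF : quasi_iso (CMap FP) by move/(tr_quasi_iso trS qF).
move=> i; have [G FG GF] := Fb (i + 1); split=> [x _ [z /= zE]|y _].
  by exists 0; rewrite linear0; apply: (can_inj FG); rewrite -zE dY linear0.
by exists (G y), 0; split; rewrite ?dX //= GF linear0 addr0.
Qed.

Lemma tri_null X : null_complex X -> S X.
Proof.
move=> X0; apply: (tri_iso _ _ _ (tr_zero trS)) => [i|i x|i x].
- exists (rhom0 _ _); apply: bij_of_inj_surj => [x y _|y].
    by move: x y; rewrite /= /stalk_obj; case: ifP => _ x y; rewrite [x]thinmx0 [y]thinmx0.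
  by exists 0; rewrite /= [y]X0.
- by [].
- exact: X0.
Qed.

End Triangulated.

Section Single.
Variable c : int.

Definition single_obj M (i : int) : rmod A := if i == c then M else rzero.

Lemma single_bounded M : exists b : nat, forall i, (b < `|i|)%N ->
  forall x : single_obj M i, x = 0.
Proof.
exists `|c|%N; rewrite /single_obj => i; case: eqP => [->|_ _ x]; first by rewrite ltnn.
exact: thinmx0.
Qed.

Definition single M : @complex k A := @Complex k A (single_obj M)
  (fun i => rhom0 _ _) (fun i x => erefl) (single_bounded M).

Definition single_fun M N (f : rhom M N) (i : int) : rhom (single M i) (single N i) :=
  if i == c as b return rhom (if b then M else rzero) (if b then N else rzero)
  then f else rid rzero.

Lemma single_funP M N (f : rhom M N) i (x : single M i) :
  single_fun f (i + 1) (cx_d (single M) i x) = cx_d (single N) i (single_fun f i x).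
Proof. exact: linear0. Qed.

Definition single_map M N (f : rhom M N) : cmap (single M) (single N) :=
  CMap (single_funP f).


Lemma single_ext S M N L (f : rhom M N) (g : rhom N L) : triangulated S ->
  ses f g -> [/\ S (single M) -> S (single N) -> S (single L),
                 S (single N) -> S (single L) -> S (single M) &
                 S (single M) -> S (single L) -> S (single N)].
Proof.
move=> trS fg.
have Lz : exists h : rhom rzero rzero, ses (rid (@rzero k A)) h.
  exists (rhom0 _ _); split=> [x y //|y|y]; first by exists 0; rewrite [y]thinmx0.
  by split=> // _; exists y.
have [h hz] := Lz.
pose G i : rhom (single N i) (single L i) :=
  if i == c as b return rhom (if b then N else rzero) (if b then L else rzero)
  then g else h.
have GP i (x : single N i) : G (i + 1) (cx_d (single N) i x) = cx_d (single L) i (G i x).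
  exact: linear0.
have FG : cses (single_map f) (CMap GP).
  by move=> i /=; rewrite /G /single_fun /single_obj; case: (i == c).
by split; [apply: tri_quot FG|apply: tri_sub FG|apply: tri_ext FG].
Qed.


End Single.

End Complexes.

(** * Devissage of bounded complexes *)

Section SingleComplexes.
Context {k : fieldType} {A : algType k}.
Implicit Types (M N : rmod A) (X Y W : @complex k A).

Lemma single_shift S c M : triangulated S ->
  S (single (c + 1) M) <-> S (single c M).
Proof.
move=> trS; rewrite (propext (tr_shift trS (single (c + 1) M))).
have e i : shift (single (c + 1) M) i = single c M i.
  by rewrite /= /shift_obj /= /single_obj (inj_eq (addIr 1)).
have d0 i (x : shift (single (c + 1) M) i) : cx_d (shift (single (c + 1) M)) i x = 0.
  by rewrite /= oppr0.
by split; apply: (tri_iso trS) => // i; rewrite e; exact: riso_refl.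
Qed.

Lemma single_anywhere S M : triangulated S -> S (single 0 M) -> forall c, S (single c M).
Proof.
move=> trS h; elim/int_ind => // n IH.
  by rewrite -addn1 PoszD; apply/(single_shift _ _ trS).
by apply/(single_shift _ _ trS); rewrite -addn1 PoszD opprD subrK.
Qed.

Lemma single_stalk S M : triangulated S -> S (stalk M) <-> S (single 0 M).
Proof. by move=> trS; split; apply: (tri_iso trS) => // i; exact: riso_refl. Qed.

Lemma single_iso S c M N : triangulated S -> riso M N -> S (single c M) -> S (single c N).
Proof.
move=> trS iMN; apply: (tri_iso trS) => // i; rewrite /= /single_obj.
by case: eqP => // _; exact: riso_refl.
Qed.

Lemma tri_concentrated S c X : triangulated S ->
  (forall i, i <> c -> forall x : X i, x = 0) -> S (single c (X c)) -> S X.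
Proof.
move=> trS conc; apply: (tri_iso trS) => // [i|i x].
  rewrite /= /single_obj; case: (eqVneq i c) => [->|/eqP ic]; first exact: riso_refl.
  exists (rhom0 _ _); apply: bij_of_inj_surj => [x y _|y].
    by rewrite [x]thinmx0 [y]thinmx0.
  by exists 0; rewrite [y]conc.
have [e|ne] := eqVneq i c; last by rewrite [x]conc ?linear0 //; apply/eqP.
by rewrite [LHS]conc //; lia.
Qed.

Lemma complex_sub X (F : forall i, {vspace X i}) :
  (forall i, submodule (F i)) -> (forall i x, x \in F i -> cx_d X i x \in F (i + 1)) ->
  exists Y W (f : cmap Y X) (g : cmap X W), cses f g /\
    forall i x, x \in F i <-> exists y, f i y = x.
Proof.
move=> sF dF.
pose sb i := cid (exists_sub (sF i)); pose Yo i := projT1 (sb i).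
pose fo i : rhom (Yo i) (X i) := projT1 (cid (projT2 (sb i))).
have [fi fF] : (forall i, injective (fo i)) /\ forall i v, v \in F i <-> exists x, fo i x = v.
  by split=> i; case: (projT2 (cid (projT2 (sb i)))).
pose qt i := cid (exists_quot (sF i)); pose Wo i := projT1 (qt i).
pose go i : rhom (X i) (Wo i) := projT1 (cid (projT2 (qt i))).
have [gs gF] : (forall i, surjective_rhom (go i)) /\ forall i v, go i v = 0 <-> v \in F i.
  by split=> i; case: (projT2 (cid (projT2 (qt i)))).
have dYe i : exists d : rhom (Yo i) (Yo (i + 1)), forall y, fo (i + 1) (d y) = rcomp (cx_d X i) (fo i) y.
  by apply: rhom_lift_inj => // y; apply/fF/dF/fF; exists y.
pose dY i := projT1 (cid (dYe i)).
have dYE i y : fo (i + 1) (dY i y) = cx_d X i (fo i y) := projT2 (cid (dYe i)) y.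
have dWe i : exists d : rhom (Wo i) (Wo (i + 1)), forall x, d (go i x) = rcomp (go (i + 1)) (cx_d X i) x.
  by apply: rhom_factor_surj => // x /gF xF; apply/gF/dF.
pose dW i := projT1 (cid (dWe i)).
have dWE i x : dW i (go i x) = go (i + 1) (cx_d X i x) := projT2 (cid (dWe i)) x.
have dYY i x : dY (i + 1) (dY i x) = 0 by apply: fi; rewrite !dYE cx_dd linear0.
have dWW i x : dW (i + 1) (dW i x) = 0.
  by have [y <-] := gs _ x; rewrite !dWE cx_dd linear0.
have [b bX] := cx_bounded X.
have bY : exists b : nat, forall i, (b < `|i|)%N -> forall x : Yo i, x = 0.
  by exists b => i bi x; apply: fi; rewrite (bX i bi (fo i x)) linear0.
have bW : exists b : nat, forall i, (b < `|i|)%N -> forall x : Wo i, x = 0.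
  by exists b => i bi x; have [y <-] := gs _ x; rewrite (bX i bi y) linear0.
exists (Complex dYY bY), (Complex dWW bW).
exists (@CMap k A (Complex dYY bY) X fo dYE), (@CMap k A X (Complex dWW bW) go (fun i x => esym (dWE i x))).
split=> //= i; split=> // y.
by rewrite gF fF.
Qed.

(** Induction on the width of the support: the term in the top degree a + n is a subcomplex, and the
    quotient by it has smaller width. *)
Lemma tri_all S : triangulated S -> (forall c M, S (single c M)) -> forall X, S X.
Proof.
move=> trS sS X; have [b bX] := cx_bounded X.
suff h (n : nat) (a : int) Y :
    (forall i, ~~ (a <= i < a + n%:Z)%R -> forall x : Y i, x = 0) -> S Y.
  apply: (h (b + b + 1)%N (- b%:Z)) => i ib; apply: bX.
  by move: ib; lia.
elim: n Y => [|n IH] Y suppY.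
  by apply: (tri_null trS) => i; apply: suppY; lia.
pose F i : {vspace Y i} := if (a + n%:Z <= i)%R then fullv else 0%VS.
have sF i : submodule (F i).
  by rewrite /F; case: ifP => _; [exact: submodulef|exact: submodule0].
have dF i x : x \in F i -> cx_d Y i x \in F (i + 1).
  rewrite /F; case: ifP => h1; case: ifP => h2; rewrite ?memvf // memv0.
  - by lia.
  - by move=> /eqP->; rewrite linear0 mem0v.
have [Y' [W [f [g [fg fF]]]]] := complex_sub sF dF.
apply: (tri_ext trS fg).
  apply: (@tri_concentrated S (a + n%:Z)) => // i ia x.
  have [fi _ _] := fg i; apply: fi; rewrite linear0.
  have [lt|le] := boolP (a + n%:Z <= i)%R; first by apply: suppY; lia.
  have : f i x \in F i by apply/fF; exists x.
  by rewrite /F (negbTE le) memv0 => /eqP.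
apply: IH => i ia x; have [_ gs gk] := fg i; have [y <-] := gs x.
have [le|lt] := boolP (a + n%:Z <= i)%R.
  by apply/gk/fF; rewrite /F le memvf.
have -> : y = 0 by apply: suppY; lia.
exact: linear0.
Qed.

End SingleComplexes.

(** * Generation from one module of each index *)

Section Generation.
Context {k : fieldType} {A : algType k} {m : nat} (Z : zigzag A m).
Implicit Types (M N : rmod A) (X Y W : @complex k A).

Local Notation D := (zD Z).
Local Notation "00" := (false, false).
Local Notation "01" := (false, true).
Local Notation L := (model Z false false).
Local Notation Delta := (Delta Z).

Lemma Delta_simple_ses a : (a < m)%N ->
  exists (f : rhom (L a) (Delta a.+1)) (g : rhom (Delta a.+1) (L a.+1)), ses f g.
Proof.
move=> am; pose p := mgen Z false true a.+1.
have [|||f fE] := @L_hom _ _ _ Z (Delta a.+1) a (ract p D).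
- by apply: ractD_deg; exact: mgenE.
- exact: Delta_U.
- exact: ractDD.
have [|g gE] := @model_hom _ _ _ Z false true a.+1 (L a.+1) (mgen Z false false a.+1) (mgenE Z _ _ _).
  move=> x; rewrite ract_zpath /mok am.
  by case: x => [[] []] //= _; rewrite ?L_U ?L_D.
have ffE x : f x = mco 00 x *: ract p D by rewrite {1}[x]L_expand linearZ /= fE.
have ggE x : g x = mco 00 x *: mgen Z false false a.+1.
  by rewrite {1}[x]Delta_expand linearD !linearZ rfunP /= gE L_D scaler0 addr0.
exists f, g; split=> [x y /(congr1 (mco 01))|y|y].
- rewrite !ffE !(mcoZ, mco_D, mco_gen) /mok /= am !mulr1 => h.
  by rewrite [x]L_expand [y]L_expand h.
- by exists (mco 00 y *: p); rewrite linearZ /= gE -L_expand.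
rewrite ggE; split=> [/(congr1 (mco 00))|[x <-]].
  rewrite mcoZ mco_gen mco0 /mok am mulr1 => h.
  exists (mco 01 y *: mgen Z false false a).
  by rewrite linearZ /= fE [RHS]Delta_expand h scale0r add0r.
by rewrite ffE mcoZ mco_D /= andbF mulr0 scale0r.
Qed.

(** The simple module L(1) is coded as Delta 0, so two kinds of code are enough. *)
Lemma Delta0_L0 : riso (Delta 0) (L 0).
Proof.
have [|g gE] := @model_hom _ _ _ Z false true 0 (L 0) (mgen Z false false 0) (mgenE Z _ _ _).
  by move=> x; rewrite ract_zpath; case: x => [[] []] //= _; rewrite ?L_U ?L_D.
have ggE x : g x = mco 00 x *: mgen Z false false 0.
  by rewrite {1}[x]Delta_expand linearD !linearZ rfunP /= gE L_D scaler0 addr0.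
exists g; apply: bij_of_inj_surj => [x y /(congr1 (mco 00))|y].
  rewrite !ggE !(mcoZ, mco_gen) /mok /= !mulr1 => h.
  rewrite [x]Delta_expand [y]Delta_expand h.
  by rewrite !(mco_out (x := 01)) // /mok /= andbF.
by exists (mco 00 y *: mgen Z false true 0); rewrite linearZ /= gE -L_expand.
Qed.

(* code_idx c is the larger vertex in the support of the module with code c. *)
Definition code_idx (c : bool * nat) : nat := (c.2 + c.1)%N.

(** The module of index j + 1 is an extension of L j and L (j + 1), in one order or the other.
    Starting from L 0, this puts all simples into S one after another, hence all modules and all
    complexes. *)
Lemma generates_of_codes S (cs : seq (bool * nat)) : triangulated S ->
  (forall c, c \in cs -> S (stalk (code_mod Z c))) ->
  (forall j, (j <= m)%N -> exists2 c, c \in cs & code_idx c = j) ->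
  forall X, S X.
Proof.
move=> trS hS cov.
have {}hS c : c \in cs -> forall d, S (single d (code_mod Z c)).
  by move=> /hS h; apply: single_anywhere => //; apply/single_stalk.
apply: (tri_all trS) => d N; elim/(devissage (Z := Z)): N => [N nN|j|X Y W f g fg sX sW].
- apply: (tri_null trS) => i x; move: x; rewrite /= /single_obj; case: eqP => _ x; first exact: nN.
  exact: thinmx0.
- elim: j => [|j IH] jm.
    have [[[] i] cc] := cov 0%N jm; rewrite /code_idx ?addn1 // addn0 => i0.
    apply: (single_iso trS Delta0_L0); rewrite -i0; exact: (hS _ cc).
  have [[[] i] cc] := cov j.+1 jm; rewrite /code_idx ?addn1 ?addn0 => ij.
    have [f [g fg]] := nab_simple_ses Z jm.
    have [_ h _] := single_ext d trS fg; apply: h; last exact: IH (ltnW jm).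
    by have := hS _ cc d; rewrite /code_mod /= (_ : i = j) //; case: ij.
  have [f [g fg]] := Delta_simple_ses jm.
  have [h _ _] := single_ext d trS fg; apply: h; first exact: IH (ltnW jm).
  by have := hS _ cc d; rewrite /code_mod /= (_ : i = j.+1).
- by have [_ _ h] := single_ext d trS fg; apply: h.
Qed.

End Generation.

(** * Parity of the total dimension as a triangulated invariant *)

Section Parity.
Context {k : fieldType} {A : algType k} (e : A).
Hypothesis ee : e * e = e.
Implicit Types (M N : rmod A) (X Y W : @complex k A).

Definition total X (b : nat) : nat :=
  (\sum_(t < (b + b).+1) wd (X (t%:Z - b%:Z)%R) e)%N.

(** For large b the window of degrees from -b to b contains the whole complex, so this speaks of the
    total dimension of X e without choosing a bound. *)
Definition even_complex X : Prop :=
  exists b0 : nat, forall b, (b0 <= b)%N -> ~~ odd (total X b).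

Lemma wd_zero M : (forall x : M, x = 0) -> wd M e = 0%N.
Proof.
move=> h; apply/eqP; rewrite dimv_eq0 -subv0; apply/subvP => v _.
by rewrite (h v) mem0v.
Qed.

Lemma wd_rsum M N : wd (rsum M N) e = (wd M e + wd N e)%N.
Proof. exact: wd_ses ee (rsum_ses M N). Qed.

Lemma total_shift X : exists b0 : nat, forall b, (b0 <= b)%N -> total (shift X) b = total X b.
Proof.
have [b0 bX] := cx_bounded X; exists b0.+1 => b bb.
pose h (t : nat) := wd (X (t%:Z - b%:Z)) e.
have -> : total (shift X) b = (\sum_(t < (b + b).+1) h t.+1)%N.
  by apply: eq_bigr => t _; rewrite /h /= /shift_obj; congr (wd (X _) e); lia.
have h0 : h 0%N = 0%N by apply/wd_zero/bX; lia.
have hn : h (b + b).+1 = 0%N by apply/wd_zero/bX; lia.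
have : (\sum_(t < (b + b).+2) h t = h 0 + \sum_(t < (b + b).+1) h t.+1)%N.
  by rewrite big_ord_recl.
by rewrite big_ord_recr /= h0 hn addn0 add0n => <-.
Qed.

Lemma total_cone X Y (f : cmap X Y) b : total (cone f) b = (total (shift X) b + total Y b)%N.
Proof. by rewrite -big_split; apply: eq_bigr => t _; rewrite /= wd_rsum. Qed.

Lemma odd_sum_telescope (z : nat -> nat) n :
  odd (\sum_(t < n) (z t + z t.+1)) = odd (z 0%N + z n).
Proof.
elim: n => [|n IH]; first by rewrite big_ord0 addnn odd_double.
by rewrite big_ord_recr /= oddD IH !oddD; case: (odd (z 0%N)) (odd (z n)) => [] [] //=; rewrite ?negbK.
Qed.

(** If z_i is the dimension of the cycles of X e in degree i, acyclicity gives dim X_i e = z_i +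
    z_(i+1). Modulo 2 the sum telescopes to its two ends, which lie outside the support. *)
Lemma acyclic_even X :
  (forall i (x : X (i + 1)), cx_d X (i + 1) x = 0 -> exists w, cx_d X i w = x) ->
  even_complex X.
Proof.
move=> ex; have [b0 bX] := cx_bounded X; exists b0.+1 => b bb.
pose K i : {vspace X i} := (comp_space (X i) e :&: lker (linfun (cx_d X i)))%VS.
have KE i : wd (X i) e = (\dim (K i) + \dim (K (i + 1)%R))%N.
  rewrite /wd -(limg_ker_dim (linfun (cx_d X i)) (comp_space (X i) e)); congr (_ + \dim _)%N.
  apply/vspaceP => x; rewrite memv_cap memv_ker lfunE.
  apply/memv_imgP/andP => [[w /(comp_spaceP _ ee) we ->]|[/(comp_spaceP _ ee) xe /eqP dx]].
    rewrite lfunE cx_dd eqxx; split=> //; apply/(comp_spaceP _ ee).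
    by rewrite -rfunP we.
  have [w wx] := ex i x dx; exists (ract w e).
    by apply/(comp_spaceP _ ee); rewrite -ractM ee.
  by rewrite lfunE rfunP wx.
have K0 i : (b < `|i|)%N || (`|i| == b)%N -> \dim (K i) = 0%N.
  move=> bi; apply/eqP; rewrite dimv_eq0 -subv0; apply/subvP => x _.
  have -> : x = 0 by apply: bX; lia.
  exact: mem0v.
have -> : total X b = (\sum_(t < (b + b).+1)
    (\dim (K (t%:Z - b%:Z)%R) + \dim (K (t.+1%:Z - b%:Z)%R)))%N.
  apply: eq_bigr => t _; rewrite KE; congr (_ + \dim (K _))%N; lia.
rewrite (odd_sum_telescope (fun t => \dim (K (t%:Z - b%:Z)))) !K0 //; lia.
Qed.

Lemma cone_acyclic X Y (f : cmap X Y) : quasi_iso f ->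
  forall i (x : cone f (i + 1)), cx_d (cone f) (i + 1) x = 0 ->
  exists w, cx_d (cone f) i w = x.
Proof.
move=> qf i [x y] [dx dy].
have dx0 : cx_d X (i + 1 + 1) x = 0 by apply/eqP; rewrite -oppr_eq0; apply/eqP.
have [w wx] : exists w, cx_d X (i + 1) w = x.
  apply: (proj1 (qf (i + 1)) _ dx0); exists (- y); rewrite linearN.
  by apply/esym/eqP; rewrite -addr_eq0; apply/eqP.
have [x1 [y' [dx1 yE]]] : exists x1 y', cx_d X (i + 1) x1 = 0 /\
    y + f (i + 1) w = f (i + 1) x1 + cx_d Y i y'.
  by apply: (proj2 (qf i)); rewrite linearD -cmP wx [LHS]addrC; exact: dy.
exists (x1 - w, y'); congr (_, _) => /=.
  by rewrite linearB dx1 sub0r opprK.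
by rewrite linearB addrAC -yE addrK.
Qed.

(** For a quasi-isomorphism X -> Y the cone is acyclic, hence even, and its total is that of X[1]
    plus that of Y; shifting does not change totals. *)
Lemma even_triangulated : triangulated even_complex.
Proof.
split.
- exists 0%N => b _; rewrite /total big1 // => t _; apply: wd_zero => x.
  by move: x; rewrite /= /stalk_obj; case: ifP => _ x; exact: thinmx0.
- move=> X Y f qf; have [b1 h1] := acyclic_even (cone_acyclic qf).
  have [b2 h2] := total_shift X.
  have eq b : (b1 <= b)%N -> (b2 <= b)%N -> odd (total X b) = odd (total Y b).
    move=> b1b b2b; have := h1 b b1b; rewrite total_cone h2 // oddD.
    by case: (odd _) (odd _) => [] [].
  by split=> [] [b0 h0]; exists (maxn b0 (maxn b1 b2)) => b; rewrite !geq_max => /and3P[? ? ?];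
    [rewrite -eq // h0 | rewrite eq // h0].
- move=> X; have [b2 h2] := total_shift X.
  by split=> [] [b0 h0]; exists (maxn b0 b2) => b; rewrite geq_max => /andP[? ?];
    [rewrite h2 // h0 | rewrite -h2 // h0].
- move=> X Y f [b0 h0] [b1 h1]; have [b2 h2] := total_shift X.
  exists (maxn b0 (maxn b1 b2)) => b; rewrite !geq_max => /and3P[? ? ?].
  by rewrite total_cone h2 // oddD (negbTE (h0 b _)) // (negbTE (h1 b _)).
Qed.

Lemma total_stalk M b : total (stalk M) b = wd M e.
Proof.
have bb : (b < (b + b).+1)%N by lia.
rewrite /total (bigD1 (Ordinal bb)) //= {1}/stalk_obj subrr eqxx big1 ?addn0 // => t tb.
rewrite /stalk_obj; case: eqP => h; last by apply: wd_zero => x; exact: thinmx0.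
by move: tb; rewrite -val_eqE /=; lia.
Qed.

Lemma even_stalk M : even_complex (stalk M) <-> ~~ odd (wd M e).
Proof.
split=> [[b0 /(_ b0 (leqnn _))]|h]; first by rewrite total_stalk.
by exists 0%N => b _; rewrite total_stalk.
Qed.

End Parity.

Section Cover.
Context {k : fieldType} {A : algType k} {m : nat} (Z : zigzag A m).
Implicit Types (M N : rmod A).

Local Notation E := (zE Z).
Local Notation L := (model Z false false).

(** For this idempotent e, dim M e is congruent to [xc M j] modulo 2, as the alternating sum loses
    its signs. *)
Definition tail_idem (j : nat) : A := \sum_(i < m.+1 | (j <= i)%N) E i.

Lemma tail_idem_sqr j : tail_idem j * tail_idem j = tail_idem j.
Proof.
rewrite /tail_idem mulr_suml; apply: eq_bigr => i ji; rewrite mulr_sumr (bigD1 i) //=.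
rewrite zEE eqxx big1 ?addr0 // => l /andP[_ li].
by rewrite zEE (_ : (i == l :> nat) = false) //; apply/negbTE; rewrite eq_sym; move: li; rewrite -val_eqE.
Qed.

Lemma wd_L i j : (i <= m)%N -> wd (L i) (tail_idem j) = (j <= i)%N.
Proof.
move=> im; pose g := mgen Z false false i.
have ge : ract g (tail_idem j) = if (j <= i)%N then g else 0.
  rewrite /tail_idem ractr_sum; have im' : (i < m.+1)%N by [].
  have off (l : 'I_m.+1) : l != Ordinal im' -> ract g (E l) = 0.
    by move=> li; apply: (ractE_deg (mgenE Z _ _ _)); rewrite eq_sym; move: li; rewrite -val_eqE.
  case: ifP => ji; last first.
    rewrite big1 // => l jl; apply: off; apply: contraFneq ji => e; by move: jl; rewrite e.
  rewrite (bigD1 (Ordinal im')) //= [ract g _]mgenE big1 ?addr0 // => l /andP[_ li].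
  exact: off.
case: (leqP j i) ge => ji ge; last first.
  apply/eqP; rewrite dimv_eq0 -subv0; apply/subvP => v.
  move=> /(comp_spaceP _ (tail_idem_sqr j)) <-; rewrite [v]L_expand ractZ.
  by rewrite [ract _ _]ge scaler0 mem0v.
rewrite /wd (_ : comp_space _ _ = <[g]>%VS).
  by rewrite dim_vline; case: eqP => // /(mgen_neq0 im).
apply/vspaceP => v; apply/idP/vlineP => [_|[c ->]].
  by exists (mco (false, false) v); rewrite -L_expand.
by apply/(comp_spaceP _ (tail_idem_sqr j)); rewrite ractZ ge.
Qed.

(** The composition factors of the module of index a lie at a and, if a > 0, at a - 1. The tail from
    j contains an odd number of them exactly when a = j. *)
Lemma wd_code c j : code_ok (m := m) c ->
  odd (wd (code_mod Z c) (tail_idem j)) = (code_idx c == j).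
Proof.
have ee := tail_idem_sqr j.
have step a : odd ((j <= a.+1)%N + (j <= a)%N) = (a.+1 == j).
  rewrite leq_eqVlt ltnS [j == _]eq_sym oddD !oddb.
  by case: (eqVneq a.+1 j) => [<-|_] /=; rewrite ?ltnn ?addbb.
case: c => [[] i]; rewrite /code_ok /code_idx /code_mod /= ?addn0 ?addn1 => im.
  have [f [g fg]] := nab_simple_ses Z im.
  by rewrite (wd_ses ee fg) !wd_L ?(ltnW im) // step.
case: i im => [|i] im.
  by rewrite (wd_iso ee (Delta0_L0 Z)) wd_L // leqn0 oddb eq_sym.
have [f [g fg]] := Delta_simple_ses Z im.
by rewrite (wd_ses ee fg) !wd_L ?(ltnW im) // addnC step.
Qed.

Lemma codes_of_generates (Ms : seq (rmod A)) (cs : seq (bool * nat)) :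
  generates Ms -> size cs = size Ms ->
  (forall t, (t < size Ms)%N -> code_ok (m := m) (nth (false, 0%N) cs t) /\
     riso (code_mod Z (nth (false, 0%N) cs t)) (nth rzero Ms t)) ->
  forall j, (j <= m)%N -> exists2 c, c \in cs & code_idx c = j.
Proof.
move=> gen sz h j jm; apply: contrapT => nj.
have ee := tail_idem_sqr j.
(* L j is the test object: it has dimension one under this idempotent. *)
have : even_complex (tail_idem j) (stalk (L j)).
  apply: (gen _ (even_triangulated ee)) => t tM; have [okt it] := h t tM.
  apply/even_stalk; rewrite -(wd_iso ee it) wd_code //.
  apply/eqP => cj; apply: nj; exists (nth (false, 0%N) cs t) => //.
  by apply: mem_nth; rewrite sz.
by move/even_stalk; rewrite wd_L // leqnn.
Qed.

End Cover.

(** * Recognition of simple and uniserial modules *)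

Section Recognition.
Context {k : fieldType} {A : algType k} {m : nat} (Z : zigzag A m).
Implicit Types (M N S T : rmod A).

Local Notation E := (zE Z).
Local Notation U := (zU Z).
Local Notation D := (zD Z).
Local Notation "00" := (false, false).
Local Notation L := (model Z false false).
Local Notation Delta := (Delta Z).
Local Notation nabla := (nabla Z).

(** Together with [length2_at], this copies [is_L] and [uniserial2] to an abstract zigzag algebra,
    with vertices counted from 0; [Bzigzag_idem] translates back. *)
Definition simple_at j M : Prop := simple_rmod M /\ exists v : M, ract v (E j) <> 0.

Definition length2_at M i j : Prop :=
  [/\ uniserial M, has_length M 2,
      exists2 T, simple_at i T & is_top M T
    & exists2 S, simple_at j S & is_socle M S].

Lemma image_submodule M N (f : rhom M N) : submodule (limg (linfun f)).
Proof.
move=> v a /memv_imgP[u _ ->]; rewrite lfunE /= -rfunP -[f _]lfunE.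
exact/memv_img/memvf.
Qed.

Lemma mem_image M N (f : rhom M N) v : v \in limg (linfun f) <-> exists u, f u = v.
Proof.
split=> [/memv_imgP[u _ ->]|[u <-]]; first by exists u; rewrite lfunE.
by rewrite -[f u]lfunE; exact/memv_img/memvf.
Qed.

Lemma simple_atP j M : (j <= m)%N -> simple_at j M <-> riso (L j) M.
Proof.
move=> jm; split.
  move=> [[_ nz simp] [v vj]].
  have nM : ~ null_mod M by move=> h; apply: vj; rewrite (h v) ract0.
  have [i [X [f [g [im [fi _ _]]]]]] := simple_sub Z nM.
  have [h|h] := simp _ (@image_submodule _ _ f) (subvf _).
    exfalso; apply: (@mgen_neq0 _ _ _ Z false false i im); apply: fi; rewrite linear0.
    by apply/eqP; rewrite -memv0 -h; apply/mem_image; exists (mgen Z false false i).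
  have fs u : exists x, f x = u by apply/mem_image; rewrite h memvf.
  suff -> : j = i by exists f; exact: bij_of_inj_surj.
  apply: contrapT => ji; apply: vj; have [x <-] := fs v.
  rewrite -rfunP [x]L_expand ractZ (ractE_deg (mgenE Z _ _ _)) ?scaler0 ?linear0 //.
  by rewrite eq_sym; apply/eqP.
move=> /riso_inv[f [g [fg gf]]].
have gn0 := @mgen_neq0 _ _ _ Z false false j jm; set x := mgen Z false false j in gn0.
have fx0 : f x <> 0 by move=> h; apply: gn0; apply: (can_inj fg); rewrite h linear0.
have Mgen v : exists c, v = c *: f x.
  by exists (mco 00 (g v)); rewrite -linearZ /= -L_expand gf.
split; last by exists (f x); rewrite -rfunP mgenE.
split=> [||W sW _].
- exact: submodulef.
- by move=> h; apply: fx0; apply/eqP; rewrite -memv0 -h memvf.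
have [W0|W0] := eqVneq W 0%VS; first by left.
right; apply/eqP; rewrite eqEsubv subvf; apply/subvP => v _.
have [c cE] := Mgen (vpick W).
have c0 : c != 0.
  by apply: contraNneq W0 => c0; move: cE; rewrite c0 scale0r => /eqP; rewrite vpick0.
have [d ->] := Mgen v.
have -> : f x = c^-1 *: vpick W by rewrite cE scalerA mulVf // scale1r.
by rewrite !rpredZ // memv_pick.
Qed.

Section Ladder.
Variables (M : rmod A) (i j : nat) (s t : M).
Hypotheses (im : (i <= m)%N) (jm : (j <= m)%N) (ij : i != j).
Hypotheses (s0 : s != 0) (t0 : t != 0) (tE : ract t (E i) = t) (sE : ract s (E j) = s).
Hypotheses (sU : ract s U = 0) (sD : ract s D = 0).
Hypotheses (tU : ract t U \in <[s]>%VS) (tD : ract t D \in <[s]>%VS).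
Hypothesis (Mgen : forall v, exists c d, v = c *: s + d *: t).
Hypothesis (ts : exists a, ract t a = s).

Let indep c d : c *: s + d *: t = 0 -> c = 0 /\ d = 0.
Proof. by apply: (pair_indep _ s0 t0 sE tE); rewrite eq_sym. Qed.

Let line_sub : submodule <[s]>%VS.
Proof.
apply: (submodule_of_gen (Z := Z)) => [l v|v|v] /vlineP[c ->]; rewrite ractZ.
- have [<-|jl] := eqVneq j l; first by rewrite sE rpredZ // memv_line.
  by rewrite (ractE_deg sE jl) scaler0 mem0v.
- by rewrite sU scaler0 mem0v.
- by rewrite sD scaler0 mem0v.
Qed.

Let line_neqf : <[s]>%VS <> fullv.
Proof.
move=> h; have : t \in <[s]>%VS by rewrite h memvf.
move=> /vlineP[c tc]; have [|_ /eqP] := @indep (- c) 1.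
  by rewrite tc scale1r scaleNr addNr.
by rewrite oner_eq0.
Qed.

Let line_neq0 : <[s]>%VS <> 0%VS.
Proof. by move=> h; move: s0; rewrite -memv0 -h memv_line. Qed.

(** A submodule containing t contains s = t a and is everything; one without t lies in the line of
    s, because e_i isolates the t-coordinate. Uniseriality, length, top and socle are read off these
    three submodules. *)
Let sub_cases (W : {vspace M}) : submodule W -> [\/ W = 0%VS, W = <[s]>%VS | W = fullv].
Proof.
move=> sW; have sj : ract s (E i) = 0 by apply: (ractE_deg sE); rewrite eq_sym.
have tj : ract t (E j) = 0 by exact: ractE_deg tE ij.
have [tW|tW] := boolP (t \in W).
  apply: Or33; apply/eqP; rewrite eqEsubv subvf; apply/subvP => v _.
  have [c [d ->]] := Mgen v; have [a <-] := ts.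
  by rewrite rpredD ?rpredZ // sW.
have WL : (W <= <[s]>)%VS.
  apply/subvP => v vW; have [c [d vE]] := Mgen v.
  suff d0 : d = 0 by rewrite vE d0 scale0r addr0 rpredZ // memv_line.
  apply/eqP; apply: contraNT tW => d0.
  have : ract v (E i) \in W by exact: sW.
  by rewrite vE ractD !ractZ sj tE scaler0 add0r rpredZeq (negbTE d0).
have [sW'|sW'] := boolP (s \in W).
  by apply: Or32; apply/eqP; rewrite eqEsubv WL -memvE.
apply: Or31; apply/eqP; rewrite -subv0; apply/subvP => v vW.
have /vlineP[c vE] := subvP WL v vW; move: vW; rewrite vE rpredZeq (negbTE sW') orbF => /eqP ->.
by rewrite scale0r mem0v.
Qed.

Let line_max : maximal_submodule_of fullv <[s]>%VS.
Proof.
split; [exact: line_sub|exact: subvf|exact: line_neqf|move=> W sW sLW _].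
case: (sub_cases sW) => h; [|by left|by right].
by move: sLW; rewrite h subv0 => /eqP.
Qed.

Let line_simple : simple_submodule <[s]>%VS.
Proof.
split; [exact: line_sub|exact: line_neq0|move=> W sW WL].
case: (sub_cases sW) => h; [by left|by right|].
by exfalso; apply: line_neqf; apply/eqP; rewrite eqEsubv subvf -h WL.
Qed.

Lemma ladder_length2 : length2_at M i j.
Proof.
split.
- move=> V W /sub_cases hV /sub_cases hW.
  case: hV => ->; [by left; rewrite sub0v| |by right; rewrite subvf].
  by case: hW => ->; [right; rewrite sub0v|left|left; rewrite subvf].
- exists (fun l => if l is l'.+1 then if l' is 0 then <[s]>%VS else fullv else 0%VS).
  split=> // [[|[|//]]] _ /=; last exact: line_max.
  split=> [||/esym//|W sW _ WL]; [exact: submodule0|exact: sub0v|].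
  by case: line_simple => _ _; apply.
- have [X [f [fs fk]]] := exists_quot line_sub.
  have fE : ract (f t) (E i) = f t by rewrite -rfunP tE.
  have [||F FE] := L_hom fE; [by rewrite -rfunP; apply/fk|by rewrite -rfunP; apply/fk|].
  have FfE x : F x = mco 00 x *: f t by rewrite {1}[x]L_expand linearZ /= FE.
  have ft0 : f t <> 0.
    move=> /fk /vlineP[c tc]; have [|_ /eqP] := @indep (- c) 1.
      by rewrite tc scale1r scaleNr addNr.
    by rewrite oner_eq0.
  exists X.
    apply/(simple_atP _ im); exists F; apply: bij_of_inj_surj => [x y|v].
      rewrite !FfE => /eqP; rewrite -subr_eq0 -scalerBl scaler_eq0 subr_eq0.
      by case/orP=> [/eqP h|/eqP //]; rewrite [x]L_expand [y]L_expand h.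
    have [u <-] := fs v; have [c [d ->]] := Mgen u.
    exists (d *: mgen Z false false i); rewrite linearZ /= FE linearD !linearZ /=.
    have -> : f s = 0 by apply/fk; exact: memv_line.
    by rewrite scaler0 add0r.
  exists f => // v; rewrite fk; split=> [vL W [sW _ Wf Wmax]|]; last by apply; exact: line_max.
  case: (sub_cases sW) => h; rewrite h ?memvf //.
  have [|||h'|h'] := Wmax <[s]>%VS => //; rewrite ?h ?sub0v ?subvf //.
  by exfalso; apply: line_neq0; rewrite h' h.
- have [f fE] := L_hom sE sU sD.
  have ffE x : f x = mco 00 x *: s by rewrite {1}[x]L_expand linearZ /= fE.
  exists (L j); first by apply/(simple_atP _ jm); exact: riso_refl.
  exists f => [x y|v].
    rewrite !ffE => /eqP; rewrite -subr_eq0 -scalerBl scaler_eq0 (negbTE s0) orbF subr_eq0.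
    by move=> /eqP h; rewrite [x]L_expand [y]L_expand h.
  split=> [h|[w <-] W sW h].
    have /vlineP[c ->] : v \in <[s]>%VS.
      apply: h => // W [sW W0 Wmin].
      case: (sub_cases sW) => e; [by rewrite e sub0v|by rewrite e|exfalso].
      have [|h'|h'] := Wmin _ line_sub; [by rewrite e subvf|exact: line_neq0|].
      by apply: line_neqf; rewrite h' e.
    by exists (c *: mgen Z false false j); rewrite linearZ /= fE.
  by rewrite ffE rpredZ //; apply: (subvP (h _ line_simple)); exact: memv_line.
Qed.

End Ladder.

Lemma Delta_length2 a M : (a < m)%N -> riso (Delta a.+1) M -> length2_at M a.+1 a.
Proof.
move=> am /riso_inv[f [g [fg gf]]]; pose p := mgen Z false true a.+1.
have fn0 x : x <> 0 -> f x != 0.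
  by move=> x0; apply/eqP => h; apply: x0; apply: (can_inj fg); rewrite h linear0.
have pD : ract p D <> 0.
  move=> /(congr1 (mco (false, true))); rewrite mco_D mco_gen mco0 /mok /= am.
  by move/eqP; rewrite oner_eq0.
have pDE : ract (ract p D) (E a) = ract p D by apply: ractD_deg; exact: mgenE.
apply: (@ladder_length2 M a.+1 a (f (ract p D)) (f p)) => //.
- exact: ltnW.
- by rewrite gtn_eqF.
- exact: fn0.
- exact/fn0/mgen_neq0.
- by rewrite -rfunP mgenE.
- by rewrite -rfunP pDE.
- by rewrite -rfunP Delta_U linear0.
- by rewrite -rfunP ractDD linear0.
- by rewrite -rfunP Delta_U linear0 mem0v.
- by rewrite -rfunP memv_line.
- move=> v; exists (mco (false, true) (g v)), (mco 00 (g v)).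
  by rewrite -!linearZ -linearD /= addrC -Delta_expand gf.
- by exists D; rewrite -rfunP.
Qed.

Lemma nabla_length2 a M : (a < m)%N -> riso (nabla a) M -> length2_at M a a.+1.
Proof.
move=> am /riso_inv[f [g [fg gf]]]; pose p := mgen Z true false a.
have fn0 x : x <> 0 -> f x != 0.
  by move=> x0; apply/eqP => h; apply: x0; apply: (can_inj fg); rewrite h linear0.
have pUE : ract (ract p U) (E a.+1) = ract p U by apply: ractU_deg; exact: mgenE.
apply: (@ladder_length2 M a a.+1 (f (ract p U)) (f p)) => //.
- exact: ltnW.
- by rewrite ltn_eqF.
- exact/fn0/nabla_genU.
- exact/fn0/mgen_neq0/ltnW.
- by rewrite -rfunP mgenE.
- by rewrite -rfunP pUE.
- by rewrite -rfunP ractUU linear0.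
- by rewrite -rfunP nabla_D linear0.
- by rewrite -rfunP memv_line.
- by rewrite -rfunP nabla_D linear0 mem0v.
- move=> v; exists (mco (true, false) (g v)), (mco 00 (g v)).
  by rewrite -!linearZ -linearD /= addrC -nabla_expand gf.
- by exists U; rewrite -rfunP.
Qed.

(** The two layers of the composition series give s and then t. Socle and top locate them at j and
    i. If U and D both killed t, the lines of s and t would be incomparable submodules, against
    uniseriality. *)
Lemma length2_basis M i j : (i <= m)%N -> (j <= m)%N -> length2_at M i j ->
  exists s t : M, [/\ s != 0, t != 0, ract s (E j) = s, ract t (E i) = t &
    [/\ forall v, exists c d, v = c *: s + d *: t,
        ract s U = 0, ract s D = 0,
        ract t U \in <[s]>%VS /\ ract t D \in <[s]>%VS &
        ~ (ract t U = 0 /\ ract t D = 0)]].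
Proof.
move=> im jm [uni [Us [U0 U2 Umax]] [T Ti [f fs fk]] [S Sj [g gi gk]]].
have [sub0 le01 ne01 max01] := Umax 0%N isT; have [sub1 le12 ne12 max12] := Umax 1%N isT.
rewrite U0 in sub0 le01 ne01 max01; rewrite U2 in le12 ne12 max12.
have [i1 [s [_ sU1 s0 sE [sU sD]]]] := @socle_mod _ _ _ Z M _ _ sub0 sub1 le01 ne01.
move: s0 sU sD; rewrite !memv0 => s0 /eqP sU /eqP sD.
have [i2 [t [_ _ tU1 tE [tU tD]]]] := @socle_mod _ _ _ Z M _ _ sub1 (@submodulef _ _ M) le12 ne12.
have line_sub (v : M) l : ract v (E l) = v -> ract v U = 0 -> ract v D = 0 -> submodule <[v]>%VS.
  move=> vE vU vD; apply: (submodule_of_gen (Z := Z)) => [b w|w|w] /vlineP[c ->]; rewrite ractZ.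
  - have [<-|jl] := eqVneq l b; first by rewrite vE rpredZ // memv_line.
    by rewrite (ractE_deg vE jl) scaler0 mem0v.
  - by rewrite vU scaler0 mem0v.
  - by rewrite vD scaler0 mem0v.
have ls := line_sub _ _ sE sU sD.
have U1E : Us 1%N = <[s]>%VS.
  have [|h|//] := max01 _ ls (sub0v _); first by rewrite -memvE.
  by move: s0; rewrite -memv0 -h memv_line.
rewrite U1E in tU1 tU tD sub1 le12 ne12 max12 max01.
have t0 : t != 0 by apply: contraNneq tU1 => ->; rewrite mem0v.
have Mgen v : exists c d, v = c *: s + d *: t.
  have sub2 : submodule (<[s]> + <[t]>)%VS.
    apply: (submodule_of_gen (Z := Z)) => [b w|w|w] /memv_addP[_ /vlineP[c ->] [_ /vlineP[d ->] ->]];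
      rewrite ractD !ractZ.
    + apply: memv_add.
        by rewrite rpredZ //; have [<-|jl] := eqVneq i1 b; rewrite ?sE ?memv_line // (ractE_deg sE jl) mem0v.
      by rewrite rpredZ //; have [<-|jl] := eqVneq i2 b; rewrite ?tE ?memv_line // (ractE_deg tE jl) mem0v.
    + by rewrite sU scaler0 add0r rpredZ //; apply: (subvP (addvSl _ _)).
    + by rewrite sD scaler0 add0r rpredZ //; apply: (subvP (addvSl _ _)).
  have [|h|h] := max12 _ sub2 (addvSl _ _); first exact: subvf.
    by move: tU1; rewrite -h (subvP (addvSr _ _)) // memv_line.
  have : v \in (<[s]> + <[t]>)%VS by rewrite h memvf.
  by move=> /memv_addP[_ /vlineP[c ->] [_ /vlineP[d ->] ->]]; exists c, d.
have small W : submodule W -> (W <= <[s]>)%VS -> W = 0%VS \/ W = <[s]>%VS.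
  by move=> sW WL; apply: max01 => //; exact: sub0v.
have s_simple : simple_submodule <[s]>%VS.
  by split=> // h; move: s0; rewrite -memv0 -h memv_line.
have [a [b [ab ba]]] := riso_inv (proj1 (simple_atP T im) Ti).
have [a' [b' [ab' ba']]] := riso_inv (proj1 (simple_atP S jm) Sj).
have degL l (x : L l) : ract x (E l) = x by rewrite [x]L_expand ractZ mgenE.
(* s lies in the socle, the image of S, and S is concentrated at vertex j. *)
have i1j : i1 = j.
  have : in_socle s by move=> W sW h; apply: (subvP (h _ s_simple)); exact: memv_line.
  move=> /gk[w gw]; have wj : ract w (E j) = w by rewrite -[w]ba' -rfunP degL.
  apply: contrapT => ne; move/eqP: s0; apply.
  rewrite -sE; apply: (@ractE_deg _ _ _ Z M s j); first by rewrite -gw -rfunP wj.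
  by rewrite eq_sym; apply/eqP.
(* s is in the radical: a maximal submodule is comparable with the line of s, and if it did not
   contain s it would be 0, which is not maximal since that line lies strictly between 0 and M. *)
have fs0 : f s = 0.
  apply/fk => W [sW _ Wf Wmax].
  have [WL|LW] := uni _ _ sW ls; last by apply: (subvP LW); exact: memv_line.
  have [h|->] := small _ sW WL; last exact: memv_line.
  have [||h'|//] := Wmax <[s]>%VS ls; rewrite ?h ?sub0v ?subvf //.
  by case: s_simple => _ []; rewrite h' h.
have ft0 : f t <> 0.
  move=> h; have T0 (x : T) : x = 0.
    by have [v <-] := fs x; have [c [d ->]] := Mgen v; rewrite linearD !linearZ /= fs0 h !scaler0 addr0.
  by case: Ti => _ [x]; rewrite (T0 x) ract0.
have i2i : i2 = i.
  apply: contrapT => ne; apply: ft0; rewrite -tE rfunP.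
  apply: (@ractE_deg _ _ _ Z T (f t) i); first by rewrite -[f t]ba -rfunP degL.
  by rewrite eq_sym; apply/eqP.
exists s, t; split=> //; [by rewrite -i1j|by rewrite -i2i|].
split=> // -[tU0 tD0]; have lt := line_sub _ _ tE tU0 tD0.
have [h|h] := uni _ _ ls lt.
  have /vlineP[c sc] : s \in <[t]>%VS by rewrite (subvP h) // memv_line.
  move/negP: tU1; apply; apply/vlineP; exists c^-1.
  rewrite sc scalerA mulVf ?scale1r //.
  by apply: contraNneq s0 => c0; rewrite sc c0 scale0r.
by move/negP: tU1; apply; rewrite (subvP h) // memv_line.
Qed.

Lemma length2_Delta a M : (a < m)%N -> length2_at M a.+1 a <-> riso (Delta a.+1) M.
Proof.
move=> am; split; last exact: Delta_length2.
move=> /(length2_basis am (ltnW am))[s [t [s0 t0 sE tE [Mgen sU sD [tU tD] nz]]]].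
have tU0 : ract t U = 0.
  have /vlineP[c cE] := tU; rewrite -(ractU_deg tE) cE ractZ.
  by rewrite (ractE_deg sE) ?scaler0 //; lia.
have /vlineP[c cE] := tD.
apply: (Delta_of_basis am s0 t0 sE tE Mgen tU0 cE).
by apply/eqP => c0; apply: nz; rewrite tU0 cE c0 scale0r.
Qed.

Lemma length2_nabla a M : (a < m)%N -> length2_at M a a.+1 <-> riso (nabla a) M.
Proof.
move=> am; split; last exact: nabla_length2.
move=> /(length2_basis (ltnW am) am)[s [t [s0 t0 sE tE [Mgen sU sD [tU tD] nz]]]].
have tD0 : ract t D = 0.
  case: a am tE sE {Mgen} => [|a] am tE sE; first by rewrite -tE ractD0.
  have /vlineP[c cE] := tD; rewrite -(ractD_deg tE) cE ractZ.
  by rewrite (ractE_deg sE) ?scaler0 //; lia.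
have /vlineP[c cE] := tU.
apply: (nabla_of_basis am t0 s0 tE sE _ tD0 sD cE).
  by move=> v; have [d [b ->]] := Mgen v; exists b, d; rewrite addrC.
by apply/eqP => c0; apply: nz; rewrite tD0 cE c0 scale0r.
Qed.

End Recognition.

(** * The algebra B_n *)

Section RepFacts.
Context {k : fieldType} {m : nat} {V : vectType k}.
Context {e : nat -> V -> V} {u d : V -> V} (H : zigzag_rep m e u d).

Lemma rep_u0 : u 0 = 0. Proof. exact: (linear0 (lin_of (zr_ulin H))). Qed.
Lemma rep_d0 : d 0 = 0. Proof. exact: (linear0 (lin_of (zr_dlin H))). Qed.

Lemma rep_big i v : (m < i)%N -> e i v = 0.
Proof.
move=> mi; rewrite -(zr_sum H v) -[e i _]/(lin_of (zr_elin H i) _) linear_sum /=.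
rewrite big1 // => l _; rewrite (zr_ee H); case: eqP => // li.
by have := ltn_ord l; rewrite li; lia.
Qed.

Lemma rep_udu i v : u (d (u (e i v))) = 0.
Proof.
case: i => [|i]; last by rewrite (zr_ud H) (zr_uu H).
by rewrite (zr_eu H) -(zr_ud H) -(zr_eu H) (zr_uu H) rep_d0.
Qed.

Lemma rep_dud i v : d (u (d (e i v))) = 0.
Proof.
case: i => [|i]; first by rewrite (zr_d0 H) rep_u0 rep_d0.
by rewrite -(zr_ud H) (zr_dd H).
Qed.

End RepFacts.

Section BnZigzag.
Variables (k : fieldType) (n : nat).
Local Notation m := n.-1.
Local Notation arr := (@Barrow n).
Local Notation kQ := (pathalg k arr).
Local Notation B := (Balg k n).
Implicit Types p q : walk arr.

Definition bwalk p : B := qpi (Bideal k n) (pbasis k p).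

Lemma bwalkM p q :
  bwalk p * bwalk q = if wtgt p == wsrc q then bwalk (wcat p q) else 0.
Proof.
rewrite /bwalk -[LHS]/(qmul _ _) -qpiM.
have -> : pbasis k p * pbasis k q = pbmul k p q by exact: bilmulbb.
rewrite /pbmul; case: eqP => // _.
by rewrite /qpi piE.
Qed.

Definition arrow_walk (x y : 'I_m.+1) : walk arr := insubd (wtriv arr x) (x, [:: y]).

Lemma arrow_walkE x y : arr x y ->
  wsrc (arrow_walk x y) = x /\ wseq (arrow_walk x y) = [:: y].
Proof.
move=> xy; have h : val (arrow_walk x y) = (x, [:: y]).
  by rewrite /arrow_walk insubdK // unfold_in /= xy.
by rewrite /wsrc /wseq h.
Qed.

(** The guards here and in the arrows matter: beyond the quiver [inord] alone would return vertex
    0. *)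
Definition bE (i : nat) : B := if (i <= m)%N then bwalk (wtriv arr (inord i)) else 0.
Definition bup (i : nat) : B :=
  if (i < m)%N then bwalk (arrow_walk (inord i) (inord i.+1)) else 0.
Definition bdn (i : nat) : B :=
  if (i < m)%N then bwalk (arrow_walk (inord i.+1) (inord i)) else 0.
Definition bU : B := \sum_(i < m) bup i.
Definition bD : B := \sum_(i < m) bdn i.

Lemma inord_eq i j : (i <= m)%N -> (j <= m)%N -> (inord i == inord j :> 'I_m.+1) = (i == j).
Proof. by move=> im jm; rewrite -val_eqE /= !inordK. Qed.

Lemma up_arrow i : (i < m)%N -> arr (inord i) (inord i.+1).
Proof. by move=> im; rewrite /Barrow !inordK ?eqxx //; lia. Qed.

Lemma dn_arrow i : (i < m)%N -> arr (inord i.+1) (inord i).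
Proof. by move=> im; rewrite /Barrow !inordK ?eqxx ?orbT //; lia. Qed.

Lemma bwalk_triv_l x p : bwalk (wtriv arr x) * bwalk p = if x == wsrc p then bwalk p else 0.
Proof.
rewrite bwalkM /=; case: (x =P wsrc p) => // xp; congr (bwalk _).
have e : wtgt (wtriv arr x) = wsrc p by [].
by apply: walk_eq; rewrite ?wsrc_cat ?wseq_cat.
Qed.

Lemma bwalk_triv_r x p : bwalk p * bwalk (wtriv arr x) = if wtgt p == x then bwalk p else 0.
Proof.
rewrite bwalkM /=; case: (wtgt p =P x) => // xp; congr (bwalk _).
by apply: walk_eq; rewrite ?wsrc_cat ?wseq_cat ?cats0.
Qed.

Lemma bEE i j : bE i * bE j = if i == j then bE i else 0.
Proof.
rewrite /bE; case: (leqP i m) => im; case: (leqP j m) => jm; rewrite ?mul0r ?mulr0 ?if_same //.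
- by rewrite bwalk_triv_l inord_eq //; case: eqP => // ->.
- by case: eqP => // ij; lia.
Qed.

Lemma bsum : \sum_(i < m.+1) bE i = 1.
Proof.
have q0 : qpi (Bideal k n) 0 = 0 by rewrite /qpi piE.
have qs (F : 'I_m.+1 -> kQ) : qpi (Bideal k n) (\sum_i F i) = \sum_i qpi (Bideal k n) (F i).
  exact: (big_morph _ (qpiD (Bideal k n)) q0).
rewrite [RHS](qs (fun x => pbasis k (wtriv arr x))).
by apply: eq_bigr => i _; rewrite /bE -ltnS ltn_ord inord_val.
Qed.

Lemma bE_up i j : bE i * bup j = if i == j then bup j else 0.
Proof.
rewrite /bE /bup; case: (ltnP j m) => jm; last by rewrite mulr0 if_same.
have [h _] := arrow_walkE (up_arrow jm).
case: (leqP i m) => im; last by rewrite mul0r; case: eqP => // ij; lia.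
by rewrite bwalk_triv_l h inord_eq //; lia.
Qed.

Lemma up_bE i j : bup j * bE i = if i == j.+1 then bup j else 0.
Proof.
rewrite /bE /bup; case: (ltnP j m) => jm; last by rewrite mul0r if_same.
have [h1 h2] := arrow_walkE (up_arrow jm).
case: (leqP i m) => im; last by rewrite mulr0; case: eqP => // ij; lia.
by rewrite bwalk_triv_r /wtgt h1 h2 /= inord_eq // eq_sym.
Qed.

Lemma bE_dn i j : bE i * bdn j = if i == j.+1 then bdn j else 0.
Proof.
rewrite /bE /bdn; case: (ltnP j m) => jm; last by rewrite mulr0 if_same.
have [h _] := arrow_walkE (dn_arrow jm).
case: (leqP i m) => im; last by rewrite mul0r; case: eqP => // ij; lia.
by rewrite bwalk_triv_l h inord_eq.
Qed.

Lemma dn_bE i j : bdn j * bE i = if i == j then bdn j else 0.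
Proof.
rewrite /bE /bdn; case: (ltnP j m) => jm; last by rewrite mul0r if_same.
have [h1 h2] := arrow_walkE (dn_arrow jm).
case: (leqP i m) => im; last by rewrite mulr0; case: eqP => // ij; lia.
by rewrite bwalk_triv_r /wtgt h1 h2 /= inord_eq ?(ltnW jm) // eq_sym.
Qed.

Lemma sum_delta (F : nat -> B) i : (forall j, (m <= j)%N -> F j = 0) ->
  \sum_(j < m) (if i == j :> nat then F j else 0) = F i.
Proof.
move=> F0; case: (ltnP i m) => im; last first.
  by rewrite F0 // big1 // => j _; case: eqP => // ij; have := ltn_ord j; lia.
rewrite (bigD1 (Ordinal im)) //= eqxx big1 ?addr0 // => j ji.
by case: eqP => // ij; move: ji; rewrite -val_eqE /= ij eqxx.
Qed.

Lemma bup_out j : (m <= j)%N -> bup j = 0. Proof. by rewrite /bup ltnNge => ->. Qed.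
Lemma bdn_out j : (m <= j)%N -> bdn j = 0. Proof. by rewrite /bdn ltnNge => ->. Qed.

Lemma bE_U i : bE i * bU = bup i.
Proof.
rewrite /bU mulr_sumr -(sum_delta i bup_out); apply: eq_bigr => j _.
exact: bE_up.
Qed.

Lemma bU_E i : bU * bE i.+1 = bup i.
Proof.
rewrite /bU mulr_suml -(sum_delta i bup_out); apply: eq_bigr => j _.
by rewrite up_bE eqSS.
Qed.

Lemma bU_E0 : bU * bE 0 = 0.
Proof. by rewrite /bU mulr_suml big1 // => j _; rewrite up_bE. Qed.

Lemma bE_D i : bE i.+1 * bD = bdn i.
Proof.
rewrite /bD mulr_sumr -(sum_delta i bdn_out); apply: eq_bigr => j _.
by rewrite bE_dn eqSS.
Qed.

Lemma bD_E i : bD * bE i = bdn i.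
Proof.
rewrite /bD mulr_suml -(sum_delta i bdn_out); apply: eq_bigr => j _.
exact: dn_bE.
Qed.

Lemma bE0_D : bE 0 * bD = 0.
Proof. by rewrite /bD mulr_sumr big1 // => j _; rewrite bE_dn. Qed.

Lemma brel_eq (x y : kQ) : Brel (x - y) -> qpi (Bideal k n) x = qpi (Bideal k n) y.
Proof. by move=> h; apply/qpi_eq => I _; apply. Qed.

Lemma brel0 p : Brel (pbasis k p) -> bwalk p = 0.
Proof.
by move=> h; rewrite /bwalk (@brel_eq _ 0) ?subr0 // /qpi piE.
Qed.

Lemma arrow_cat x y z : arr x y -> arr y z ->
  [/\ wtgt (arrow_walk x y) = wsrc (arrow_walk y z),
      wsrc (wcat (arrow_walk x y) (arrow_walk y z)) = x,
      wseq (wcat (arrow_walk x y) (arrow_walk y z)) = [:: y; z] &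
      wtgt (wcat (arrow_walk x y) (arrow_walk y z)) = z].
Proof.
move=> xy yz; have [a1 a2] := arrow_walkE xy; have [b1 b2] := arrow_walkE yz.
have h : wtgt (arrow_walk x y) = wsrc (arrow_walk y z) by rewrite /wtgt a1 a2 b1.
split=> //; first by rewrite wsrc_cat.
  by rewrite wseq_cat // a2 b2.
by rewrite wtgt_cat // /wtgt b1 b2.
Qed.

Lemma bup_up i : bup i * bup i.+1 = 0.
Proof.
rewrite /bup; case: (ltnP i.+1 m) => im; last by rewrite mulr0.
have im' : (i < m)%N by lia.
rewrite im' bwalkM; have [h1 h2 h3 h4] := arrow_cat (up_arrow im') (up_arrow im).
rewrite h1 eqxx; apply/brel0/Brel_noncycle; first by rewrite /wlen h3.
rewrite h2 h4 => /eqP; rewrite inord_eq; lia.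
Qed.

Lemma bdn_dn i : bdn i.+1 * bdn i = 0.
Proof.
rewrite /bdn; case: (ltnP i.+1 m) => im; last by rewrite mul0r.
have im' : (i < m)%N by lia.
rewrite im' bwalkM; have [h1 h2 h3 h4] := arrow_cat (dn_arrow im) (dn_arrow im').
rewrite h1 eqxx; apply/brel0/Brel_noncycle; first by rewrite /wlen h3.
rewrite h2 h4 => /eqP; rewrite inord_eq; lia.
Qed.

(** Below the last vertex this is the equality of the two cycles at i + 1. At the last vertex the
    upper cycle does not exist, and the lower one is zero by [Brel_last]. *)
Lemma bup_dn i : bup i.+1 * bdn i.+1 = bdn i * bup i.
Proof.
rewrite /bup /bdn; case: (ltnP i m) => im; last by rewrite (_ : (i.+1 < m)%N = false) //; lia.
have [a1 a2 a3 a4] := arrow_cat (dn_arrow im) (up_arrow im).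
rewrite [RHS]bwalkM a1 eqxx; case: (ltnP i.+1 m) => im'.
  have [b1 b2 b3 b4] := arrow_cat (up_arrow im') (dn_arrow im').
  rewrite bwalkM b1 eqxx; apply/brel_eq/Brel_cycles; rewrite ?/wlen ?a3 ?b3 ?a2 ?a4 ?b2 ?b4 //.
rewrite mul0r; apply/esym/brel0/Brel_last; first by rewrite /wlen a3.
  by rewrite a2; apply: val_inj; rewrite /= inordK; lia.
by rewrite a4; apply: val_inj; rewrite /= inordK; lia.
Qed.

Lemma bE_out i : (m < i)%N -> bE i = 0.
Proof. by rewrite /bE ltnNge => /negbTE ->. Qed.

Lemma bU_bU : bU * bU = 0.
Proof.
rewrite {1}/bU mulr_suml big1 // => i _.
have -> : bup i = bup i * bE i.+1 by rewrite up_bE eqxx.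
by rewrite -mulrA bE_U bup_up.
Qed.

Lemma bD_bD : bD * bD = 0.
Proof.
rewrite {1}/bD mulr_suml big1 // => i _.
have -> : bdn i = bdn i * bE i by rewrite dn_bE eqxx.
rewrite -mulrA; case: (i : nat) => [|j]; first by rewrite bE0_D mulr0.
by rewrite bE_D bdn_dn.
Qed.

Lemma bU_bD i : bE i.+1 * (bU * bD) = bE i.+1 * (bD * bU).
Proof.
rewrite !mulrA bE_U bE_D.
have -> : bup i.+1 = bup i.+1 * bE i.+2 by rewrite up_bE eqxx.
have -> : bdn i = bdn i * bE i by rewrite dn_bE eqxx.
rewrite -!mulrA bE_D bE_U; exact: bup_dn.
Qed.

(** A path is a product of arrows, and an arrow is cut out of U or D by the idempotent of its
    source. *)
Lemma bgen (S : B -> Prop) : (forall c a b, S a -> S b -> S (c *: a + b)) ->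
  (forall a b, S a -> S b -> S (a * b)) ->
  (forall i, S (bE i)) -> S bU -> S bD -> forall a, S a.
Proof.
move=> Sl Sm SE SU SD.
have S0 : S 0 by have := Sl (-1) _ _ (SE 0%N) (SE 0%N); rewrite scaleN1r addNr.
have Striv x : S (bwalk (wtriv arr x)).
  by have := SE x; rewrite /bE -ltnS ltn_ord inord_val.
have Sarr x y : arr x y -> S (bwalk (arrow_walk x y)).
  case/orP=> /eqP e.
    have xm : (x < m)%N by have := ltn_ord y; rewrite e.
    have := Sm _ _ (SE x) SU; rewrite bE_U /bup xm -e !inord_val; exact.
  have ym : (y < m)%N by have := ltn_ord x; rewrite e.
  have := Sm _ _ (SE y.+1) SD; rewrite bE_D /bdn ym -e !inord_val; exact.
have Swalk p : S (bwalk p).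
  have [s] : exists s, wseq p = s by exists (wseq p).
  elim: s p => [|y s IH] p ps.
    have -> : p = wtriv arr (wsrc p) by apply: walk_eq.
    exact: Striv.
  have := valP p; rewrite -/(wsrc p) -/(wseq p) ps /= => /andP[py ys].
  pose q : walk arr := @Walk m arr (y, s) ys.
  have [a1 a2] := arrow_walkE py.
  have h : wtgt (arrow_walk (wsrc p) y) = wsrc q by rewrite /wtgt a1 a2.
  have -> : p = wcat (arrow_walk (wsrc p) y) q.
    by apply: walk_eq; rewrite ?wsrc_cat ?wseq_cat ?a1 ?a2 ?ps.
  have -> : bwalk (wcat (arrow_walk (wsrc p) y) q) = bwalk (arrow_walk (wsrc p) y) * bwalk q.
    by rewrite bwalkM h eqxx.
  by apply: Sm; [exact: Sarr|exact: IH].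
move=> a; rewrite -(qpiK a); move: (repr a : kQ) => {}a.
elim/malg_lind: a => [|x y hx hy|c p].
- have -> : qpi (Bideal k n) 0 = 0 by rewrite /qpi piE.
  exact: S0.
- have -> : qpi (Bideal k n) (x + y) =
      1 *: qpi (Bideal k n) (x : kQ) + qpi (Bideal k n) (y : kQ).
    by rewrite scale1r; exact: qpiD.
  exact: Sl.
- have -> : qpi (Bideal k n) (c *: << p >>) = c *: bwalk p + 0.
    by rewrite addr0; exact: qpiZ.
  exact: Sl.
Qed.

(** * The universal property: representations of the quiver with relations as modules over B_n *)

Section Action.
Variables (V : vectType k) (e : nat -> V -> V) (u d : V -> V).
Hypothesis H : zigzag_rep m e u d.

Definition wstep (x y : 'I_m.+1) (v : V) : V := if y == x.+1 :> nat then u v else d v.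

Fixpoint wact_seq (x : 'I_m.+1) (s : seq 'I_m.+1) (v : V) : V :=
  if s is y :: s' then wact_seq y s' (wstep x y v) else v.

Definition wact p (v : V) : V := wact_seq (wsrc p) (wseq p) (e (wsrc p) v).

Lemma wstep_lin x y : linear (wstep x y).
Proof. by move=> c v w; rewrite /wstep; case: ifP => _; [exact: (zr_ulin H)|exact: (zr_dlin H)]. Qed.

Lemma wact_seq_lin x s : linear (wact_seq x s).
Proof.
by elim: s x => [|y s IH] x c v w //=; rewrite wstep_lin IH.
Qed.

Lemma wact_lin p : linear (wact p).
Proof. by move=> c v w; rewrite /wact (zr_elin H) wact_seq_lin. Qed.

Lemma wact_seq_cat x s t v :
  wact_seq x (s ++ t) v = wact_seq (last x s) t (wact_seq x s v).
Proof. by elim: s x v => //= y s IH x v. Qed.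

Lemma wstep_deg x y v : arr x y -> e x v = v -> e y (wstep x y v) = wstep x y v.
Proof.
rewrite /wstep => /orP[] /eqP xy vx; first by rewrite xy eqxx -(zr_eu H) vx.
have -> : (y == x.+1 :> nat) = false by lia.
by rewrite -(zr_ed H) -xy vx.
Qed.

Lemma wact_seq_deg x s v : path arr x s -> e x v = v ->
  e (last x s) (wact_seq x s v) = wact_seq x s v.
Proof.
elim: s x v => //= y s IH x v /andP[xy ys] vx.
by apply: IH => //; apply: wstep_deg.
Qed.

Lemma rep_ee_id i v : e i (e i v) = e i v.
Proof. by rewrite (zr_ee H) eqxx. Qed.

Lemma wact_deg p v : e (wtgt p) (wact p v) = wact p v.
Proof. by apply: wact_seq_deg; [exact: (valP p)|exact: rep_ee_id]. Qed.

Lemma wact_cat p q v :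
  wact q (wact p v) = if wtgt p == wsrc q then wact (wcat p q) v else 0.
Proof.
rewrite {1}/wact -wact_deg (zr_ee H); have [pq|pq] := eqVneq (wtgt p) (wsrc q).
  rewrite (introT eqP (congr1 val pq)) wact_deg /wact wsrc_cat // wseq_cat //.
  by rewrite wact_seq_cat -/(wtgt p) pq.
rewrite (_ : (wtgt p == wsrc q :> nat) = false); last by apply/negbTE.
exact: (linear0 (lin_of (wact_seq_lin _ _))).
Qed.

Definition pact (v : V) (a : {malg k[walk arr]}) : V := \sum_(p <- msupp a) a@_p *: wact p v.

Lemma pact_linr v : linear (pact v).
Proof. exact: sum_msupp_linear. Qed.

Lemma pact_linl a : linear (pact^~ a).
Proof.
move=> c v w; rewrite /pact scaler_sumr -big_split; apply: eq_bigr => p _ /=.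
by rewrite wact_lin scalerDr !scalerA mulrC.
Qed.

Lemma pact0 v : pact v 0 = 0.
Proof. by rewrite /pact msupp0 big_nil. Qed.

Lemma pactD v a b : pact v (a + b) = pact v a + pact v b.
Proof. by have := pact_linr v 1 a b; rewrite !scale1r. Qed.

Lemma pactZ v c a : pact v (c *: a) = c *: pact v a.
Proof. by have := pact_linr v c a 0; rewrite !addr0 pact0 addr0. Qed.

Lemma pactDl v w a : pact (v + w) a = pact v a + pact w a.
Proof. by have := pact_linl a 1 v w; rewrite !scale1r. Qed.

Lemma pact0l a : pact 0 a = 0.
Proof.
rewrite /pact big1 // => p _.
by rewrite -[wact p 0]/(lin_of (wact_lin p) 0) linear0 scaler0.
Qed.

Lemma pactZl c v a : pact (c *: v) a = c *: pact v a.
Proof. by have := pact_linl a c v 0; rewrite !addr0 pact0l addr0. Qed.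

Lemma pact_basis v p : pact v << p >> = wact p v.
Proof. by rewrite /pact msuppU oner_eq0 big_seq_fset1 mcoeffUU scale1r. Qed.

Lemma pactM v (a b : {malg k[walk arr]}) :
  pact v (bilmul (@pbmul k m arr) a b) = pact (pact v a) b.
Proof.
elim/malg_lind: a => [|x y hx hy|c p].
- by rewrite bilmul0l pact0 pact0l.
- by rewrite bilmulDl !pactD hx hy pactDl.
rewrite bilmulZl !pactZ pactZl; congr (_ *: _).
elim/malg_lind: b => [|x y hx hy|f q].
- by rewrite bilmul0r !pact0.
- by rewrite bilmulDr !pactD hx hy.
rewrite bilmulZr !pactZ bilmulbb !pact_basis wact_cat /pbmul; congr (_ *: _).
by case: ifP => _; rewrite ?pact0 ?pact_basis.
Qed.

(** Words of length three reduce to uu, dd, udu or dud; a path of length two that is no cycle is uu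
    or dd; the two cycles at a vertex agree by [zr_ud]. At the last vertex [zr_ud] turns the cycle
    into one through m + 1, where e is zero. *)
Lemma pact_rel v (a : kQ) : Brel a -> pact v a = 0.
Proof.
have len2 p : wlen p = 2%N -> exists x y z,
    [/\ wsrc p = x, wtgt p = z, wseq p = [:: y; z], arr x y & arr y z].
  rewrite /wlen; case ps : (wseq p) => [|y [|z []]] // _.
  have := valP p; rewrite -/(wsrc p) -/(wseq p) ps /= => /and3P[h1 h2 _].
  by exists (wsrc p), y, z; split=> //; rewrite /wtgt ps.
case=> [p lp|p lp ne|p q lp lq cp cq pq|p lp sp tp].
- rewrite pact_basis /wact; move: lp; rewrite /wlen.
  case ps : (wseq p) => [|y [|z [|t []]]] // _.
  have := valP p; rewrite -/(wsrc p) -/(wseq p) ps /= => /and4P[h1 h2 h3 _].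
  rewrite /wstep; case: eqP => a1; case: eqP => a2; case: eqP => a3;
    rewrite ?(zr_uu H) ?(zr_dd H) ?(rep_u0 H) ?(rep_d0 H) ?(zr_uu H) ?(zr_dd H)
      ?(rep_udu H) ?(rep_dud H) //.
- have [x [y [z [px pz ps h1 h2]]]] := len2 _ lp.
  rewrite pact_basis /wact ps /= /wstep px.
  case: eqP => a1; case: eqP => a2; rewrite ?(zr_uu H) ?(zr_dd H) //; exfalso; apply: ne;
    rewrite px pz; apply: val_inj => /=; move: h1 h2; rewrite /Barrow; lia.
- have [x [y [z [px pz ps h1 h2]]]] := len2 _ lp.
  have [x' [y' [z' [qx qz qs h1' h2']]]] := len2 _ lq.
  have -> : pact v (pbasis k p - pbasis k q) = wact p v - wact q v.
    by rewrite -scaleN1r addrC pact_linr !pact_basis scaleN1r addrC.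
  have zx : z = x by rewrite -pz -cp px.
  have xx : x' = x by rewrite -qx -pq px.
  have zx' : z' = x by rewrite -qz -cq qx.
  apply/eqP; rewrite subr_eq0; apply/eqP; rewrite /wact ps qs px qx /= /wstep.
  move: h1 h2 h1' h2'; rewrite xx zx zx' /Barrow => h1 h2 h1' h2'.
  case: eqP => a1; case: eqP => a2; case: eqP => a3; case: eqP => a4 //; try (exfalso; lia).
    by case: (x : nat) a3 h1' => [|i] a3 h1'; [lia|rewrite (zr_ud H)].
  by case: (x : nat) a1 h1 => [|i] a1 h1; [lia|rewrite (zr_ud H)].
- have [x [y [z [px pz ps h1 h2]]]] := len2 _ lp.
  rewrite pact_basis /wact ps /= /wstep px.
  have xm : x = m :> nat by rewrite -px sp.
  have zm : z = m :> nat by rewrite -pz tp.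
  move: h1 h2; rewrite /Barrow xm zm => h1 h2.
  have ym := ltn_ord y.
  have a1 : (y == m.+1 :> nat) = false by lia.
  have a2 : m = y.+1 by lia.
  have := zr_ud H y v; rewrite -a2 a1 eqxx => <-.
  by rewrite (zr_eu H) (rep_big H) ?(rep_d0 H).
Qed.

(** The generated ideal is an intersection of ideals, so it suffices that the annihilator of V is an
    ideal containing the relations. *)
Lemma pact_ideal v (a : kQ) : Bideal k n a -> pact v a = 0.
Proof.
move=> h; move: v; apply: (h (fun a : kQ => forall v, pact v a = 0)); last first.
  by move=> r hr v; exact: pact_rel.
split=> [v|x y hx hy v|b x hx v|x b hx v].
- exact: pact0.
- by rewrite pactD hx hy addr0.
- by rewrite [pact v _]pactM hx.
- by rewrite [pact v _]pactM hx pact0l.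
Qed.

Definition bact (v : V) (a : B) : V := pact v (repr a : kQ).

Lemma bact_qpi v (a : kQ) : bact v (qpi (Bideal k n) a) = pact v a.
Proof.
apply/eqP; rewrite -subr_eq0 -scaleN1r addrC -pact_linr; apply/eqP/pact_ideal.
by rewrite scaleN1r addrC; exact: repr_qpi.
Qed.

Lemma bact_walk v p : bact v (bwalk p) = wact p v.
Proof. by rewrite bact_qpi pact_basis. Qed.

Lemma bact_linr v : linear (bact v).
Proof.
move=> c a b; rewrite -(qpiK a) -(qpiK b).
have -> : c *: qpi (Bideal k n) (repr a) + qpi (Bideal k n) (repr b) =
    qpi (Bideal k n) (c *: (repr a : kQ) + repr b).
  by rewrite qpiD qpiZ.
by rewrite !bact_qpi pact_linr.
Qed.

Lemma bact0 v : bact v 0 = 0.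
Proof. exact: (linear0 (lin_of (bact_linr v))). Qed.

Lemma bact_sum v (I : Type) (r : seq I) (P : pred I) (F : I -> B) :
  bact v (\sum_(i <- r | P i) F i) = \sum_(i <- r | P i) bact v (F i).
Proof. exact: (linear_sum (lin_of (bact_linr v))). Qed.

Lemma bact_M v a b : bact v (a * b) = bact (bact v a) b.
Proof.
rewrite -(qpiK a) -(qpiK b) -[_ * _]/(qmul _ _) -qpiM !bact_qpi.
exact: pactM.
Qed.

Lemma bact_E v i : bact v (bE i) = e i v.
Proof.
rewrite /bE; case: leqP => im; first by rewrite bact_walk /wact /= inordK.
by rewrite bact0 (rep_big H).
Qed.

Lemma bact_1 v : bact v 1 = v.
Proof. by rewrite -bsum bact_sum -[RHS](zr_sum H); apply: eq_bigr => i _; rewrite bact_E. Qed.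

Lemma bact_U v : bact v bU = u v.
Proof.
rewrite -[in RHS](zr_sum H v) -[u _]/(lin_of (zr_ulin H) _) linear_sum /= big_ord_recr /=.
rewrite (zr_eu H m) (rep_big H) // addr0 bact_sum; apply: eq_bigr => i _.
have im := ltn_ord i.
have [h1 h2] := arrow_walkE (up_arrow im).
by rewrite /bup im bact_walk /wact h1 h2 /= /wstep !inordK ?eqxx //; lia.
Qed.

Lemma bact_D v : bact v bD = d v.
Proof.
rewrite -[in RHS](zr_sum H v) -[d _]/(lin_of (zr_dlin H) _) linear_sum /= big_ord_recl /=.
rewrite (zr_d0 H) add0r bact_sum; apply: eq_bigr => i _.
have im := ltn_ord i.
have [h1 h2] := arrow_walkE (dn_arrow im).
rewrite /bdn im bact_walk /wact h1 h2 /= /wstep !inordK; try lia.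
by rewrite (_ : (i == i.+2 :> nat) = false) //; lia.
Qed.

End Action.

Lemma bact_exists (V : vectType k) (e : nat -> V -> V) (u d : V -> V) :
  zigzag_rep m e u d -> exists act : V -> B -> V,
      [/\ forall a, linear (act^~ a), forall v, linear (act v),
          forall v, act v 1 = v, forall v a b, act v (a * b) = act (act v a) b
        & [/\ forall v i, act v (bE i) = e i v, forall v, act v bU = u v
            & forall v, act v bD = d v]].
Proof.
move=> H; exists (bact e u d); split.
- by move=> a; exact: pact_linl.
- exact: bact_linr.
- exact: bact_1.
- exact: bact_M.
- by split; [exact: bact_E|exact: bact_U|exact: bact_D].
Qed.

Definition Bzigzag : zigzag B m :=
  Zigzag bEE bsum bE_out (fun i => etrans (bE_U i) (esym (bU_E i))) bU_E0
    (fun i => etrans (bE_D i) (esym (bD_E i))) bE0_D bU_bU bD_bD bU_bD bgen bact_exists.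

Lemma Bzigzag_idem i : (i <= m)%N -> zE Bzigzag i = Bidem k n i.+1.
Proof. by move=> im; rewrite /= /bE im. Qed.

End BnZigzag.

(** * Exceptional sequences *)

Lemma Forall2_nthP (T T' : Type) (R : T -> T' -> Prop) (x0 : T) (y0 : T') s s' :
  List.Forall2 R s s' <-> size s = size s' /\
    forall t, (t < size s')%N -> R (nth x0 s t) (nth y0 s' t).
Proof.
elim: s s' => [|x s IH] [|y s']; split=> [h|[h1 h2]] //=; try by inversion h.
- inversion h as [|? ? ? ? xy ss']; subst; have [e1 e2] := (IH s').1 ss'.
  by split; [rewrite e1|case].
- constructor; first exact: (h2 0%N).
  apply/IH; split=> [|t ts]; first by case: h1.
  exact: (h2 t.+1).
Qed.

Lemma Forall2_map_l (T T1 T2 : Type) (R : T1 -> T2 -> Prop) (f : T -> T1) s s' :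
  List.Forall2 R (map f s) s' <-> List.Forall2 (fun x => R (f x)) s s'.
Proof.
elim: s s' => [|x s IH] s'; first by split=> h; inversion h.
by split=> h; inversion h; subst; constructor => //; apply/IH.
Qed.

Lemma Forall2_impl_mem (T : eqType) (T' : Type) (R R' : T -> T' -> Prop) s s' :
  (forall x y, x \in s -> R x y -> R' x y) -> List.Forall2 R s s' -> List.Forall2 R' s s'.
Proof.
move=> h h2; elim: h2 h => [|x y {}s {}s' xy _ IH] h; constructor.
  by apply: h; rewrite ?mem_head.
by apply: IH => a b sa; apply: h; rewrite inE sa orbT.
Qed.

Section Codes.
Context {k : fieldType} {A : algType k} {m : nat} (Z : zigzag A m).
Hypothesis m_gt0 : (0 < m)%N.

Definition iso_codes (cs : seq (bool * nat)) (Ms : seq (rmod A)) : Prop :=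
  List.Forall2 (fun c M => riso (code_mod Z c) M) cs Ms.

(* A pair of index lists (i, j) as in the theorem, with the paper's vertices
   2, ..., n = m + 1. *)
Definition index_pair (i j : seq nat) : Prop :=
  [/\ size i + size j = m, forall x, (x \in i ++ j) = (2 <= x <= m.+1),
      pairwise gtn i & pairwise ltn j]%N.

(** Codes name modules by their top vertex counted from 0: nabla(x) has top L(x - 1), hence x - 2,
    and Delta(y) has top L(y), hence y - 1. *)
Definition pair_codes (i j : seq nat) : seq (bool * nat) :=
  [seq (true, x - 2) | x <- i]%N ++ (false, 0%N) :: [seq (false, y.-1) | y <- j].

Lemma index_pair_uniq i j : index_pair i j -> uniq (i ++ j).
Proof.
move=> [sz mem _ _]; rewrite (@eq_uniq _ _ (iota 2 m)) ?iota_uniq //.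
  by rewrite size_cat size_iota.
by move=> x; rewrite mem mem_iota; lia.
Qed.

Lemma pair_codes_ok i j : index_pair i j -> all (@code_ok m) (pair_codes i j).
Proof.
move=> [_ mem _ _]; rewrite all_cat /= !all_map; apply/andP; split.
  by apply/allP => x xi; have := mem x; rewrite mem_cat xi /= /code_ok /=; lia.
by apply/allP => x xj; have := mem x; rewrite mem_cat xj orbT /= /code_ok /=; lia.
Qed.

(** Within each half the relation is monotonicity of the list. Across the halves the condition a !=
    b + 1 says that no index occurs in both, which is the uniqueness of i ++ j. *)
Lemma pair_codes_rel i j : index_pair i j -> pairwise code_rel (pair_codes i j).
Proof.
move=> ip; have un := index_pair_uniq ip; have [_ mem pi pj] := ip.
have hi x : x \in i -> (2 <= x <= m.+1)%N by move=> xi; rewrite -mem mem_cat xi.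
have hj x : x \in j -> (2 <= x <= m.+1)%N by move=> xj; rewrite -mem mem_cat xj orbT.
rewrite pairwise_cat /= !pairwise_map; apply/and3P; split.
- apply/allrelP => _ d /mapP[x xi ->]; rewrite inE => /orP[/eqP -> //|/mapP[y yj ->]] /=.
  have := hi _ xi; have := hj _ yj => hy hx; apply/eqP => xy.
  have e : x = y by lia.
  move: un; rewrite cat_uniq => /and3P[_ /hasPn h _].
  by have := h _ yj; rewrite /= -e xi.
- apply: (sub_in_pairwise (P := [in i])) pi => [x y xi yi /=|]; last exact/allP.
  by have := hi _ xi; have := hi _ yi; rewrite /gtn /=; lia.
- apply/andP; split; first by rewrite all_map; apply/allP => y yj /=; have := hj _ yj; lia.
  apply: (sub_in_pairwise (P := [in j])) pj => [x y xj yj /=|]; last exact/allP.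
  by have := hj _ xj; have := hj _ yj; lia.
Qed.

Lemma pair_codes_cover i j : index_pair i j -> forall a, (a <= m)%N ->
  exists2 c, c \in pair_codes i j & code_idx c = a.
Proof.
move=> [_ mem _ _] [|a] am.
  by exists (false, 0%N) => //; rewrite mem_cat inE eqxx orbT.
have := mem a.+2; rewrite mem_cat (_ : (2 <= a.+2 <= m.+1)%N = true); last by lia.
case/orP=> h.
  exists (true, a); last by rewrite /code_idx /= addn1.
  by rewrite mem_cat; apply/orP; left; apply/mapP; exists a.+2; rewrite // !subSS subn0.
exists (false, a.+1); last by rewrite /code_idx /= addn0.
by rewrite mem_cat inE; apply/orP; right; apply/orP; right; apply/mapP; exists a.+2.
Qed.

(** Before (false, 0) [code_rel] admits only costandard codes, after it only standard ones of
    positive index, so cutting the list there gives i and j. *)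
Lemma index_pair_of_codes cs : all (@code_ok m) cs -> pairwise code_rel cs ->
  (forall a, (a <= m)%N -> exists2 c, c \in cs & code_idx c = a) ->
  exists i j, index_pair i j /\ cs = pair_codes i j.
Proof.
move=> ok rel cov.
(* A costandard code (true, c) has index c + 1, so index 0 can only come from (false, 0). *)
have L0 : (false, 0%N) \in cs.
  by have [[[] c] cc] := cov 0%N isT; rewrite /code_idx /=; rewrite ?addn0 ?addn1 // => <-.
case/splitPr: L0 ok rel cov => cs1 cs2 ok rel cov.
move: rel; rewrite pairwise_cat allrel_consr => /and3P[/andP[r1 r12] p1 /= /andP[r2 p2]].
have c1 c : c \in cs1 -> c.1 by move=> /(allP r1); case: c => [[] b].
have c2 c : c \in cs2 -> ~~ c.1 /\ (0 < c.2)%N by move=> /(allP r2); case: c => [[] b].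
pose i := [seq c.2.+2 | c <- cs1]; pose j := [seq c.2.+1 | c <- cs2].
have cs1E : cs1 = [seq (true, x - 2)%N | x <- i].
  rewrite -map_comp -[LHS]map_id; apply/eq_in_map => c /c1.
  by case: c => [[] b] //= _; rewrite !subSS subn0.
have cs2E : cs2 = [seq (false, y.-1)%N | y <- j].
  rewrite -map_comp -[LHS]map_id; apply/eq_in_map => c /c2[].
  by case: c => [[] b].
have mi x : x \in i -> exists2 b, (true, b) \in cs1 & x = b.+2.
  by move=> /mapP[[s b] cc ->]; exists b => //; have := c1 _ cc; case: s cc.
have mj x : x \in j -> exists2 b, (false, b) \in cs2 & x = b.+1.
  by move=> /mapP[[s b] cc ->]; exists b => //; have [] := c2 _ cc; case: s cc.
have pi : pairwise gtn i.
  rewrite pairwise_map; apply: (sub_in_pairwise (P := [in cs1])) p1 => [c d cc dc|]; last exact/allP.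
  by have := c1 _ cc; have := c1 _ dc; case: c d {cc dc} => [[] b] [[] b'] //= _ _; rewrite /gtn /=; lia.
have pj : pairwise ltn j.
  rewrite pairwise_map; apply: (sub_in_pairwise (P := [in cs2])) p2 => [c d cc dc|]; last exact/allP.
  by have [h1 _] := c2 _ cc; have [h2 _] := c2 _ dc; case: c d h1 h2 {cc dc} => [[] b] [[] b'] //= _ _; lia.
have mem x : (x \in i ++ j) = (2 <= x <= m.+1)%N.
  apply/idP/idP; rewrite mem_cat.
    case/orP=> [/mi[b bc ->]|/mj[b bc ->]].
      have : code_ok (m := m) (true, b) by apply: (allP ok); rewrite mem_cat bc.
      by rewrite /code_ok /=; clear; lia.
    have : code_ok (m := m) (false, b) by apply: (allP ok); rewrite mem_cat inE bc !orbT.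
    by have [_ /=] := c2 _ bc; rewrite /code_ok /=; clear; lia.
  move=> xm; have [|[s b] cc] := cov x.-1; first by lia.
  rewrite /code_idx /= => bx; move: cc; rewrite mem_cat inE => /or3P[cc|/eqP[s0 b0]|cc].
  - have := c1 _ cc; case: s cc bx => // cc bx _.
    by rewrite (_ : x = b.+2) ?(map_f (fun c : bool * nat => c.2.+2) cc) //; move: bx xm; clear; lia.
  - by move: bx xm; rewrite s0 b0 addn0; clear; lia.
  - have [] := c2 _ cc; case: s cc bx => // cc bx _ _.
    by rewrite (_ : x = b.+1) ?(map_f (fun c : bool * nat => c.2.+1) cc) ?orbT //; move: bx xm; clear; lia.
have un : uniq (i ++ j).
  rewrite cat_uniq; apply/and3P; split.
  - apply: (sorted_uniq (leT := gtn)); [by clear=> a b c /=; lia|by clear=> a /=; lia|].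
    by rewrite sorted_pairwise //; clear=> a b c /=; lia.
  - apply/hasPn => x /mj[b bc xb] /=; apply/negP => /mi[b' bc' xb'].
    move/allrelP: r12 xb xb' => /(_ _ _ bc' bc) /=; clear; lia.
  - apply: (sorted_uniq ltn_trans ltnn); rewrite sorted_pairwise //; exact: ltn_trans.
exists i, j; split; last by rewrite /pair_codes -cs1E -cs2E.
split=> //; rewrite -size_cat -(size_iota 2 m).
apply: perm_size; apply: uniq_perm; rewrite ?iota_uniq // => x.
by rewrite mem mem_iota; clear; lia.
Qed.

Lemma full_exceptional_codes (Ms : seq (rmod A)) :
  full_exceptional_seq Ms <->
  exists i j, index_pair i j /\ iso_codes (pair_codes i j) Ms.
Proof.
split.
  move=> [[exc ext] gen].
  have [cs [sz csP]] : exists cs : seq (bool * nat), size cs = size Ms /\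
      forall t, (t < size Ms)%N -> code_ok (m := m) (nth (false, 0%N) cs t) /\
        riso (code_mod Z (nth (false, 0%N) cs t)) (nth rzero Ms t).
    pose pick M : bool * nat := if pselect (exists2 c : bool * nat,
      code_ok (m := m) c & riso (code_mod Z c) M) is left h then projT1 (cid2 h) else (false, 0%N).
    exists (map pick Ms); split=> [|t tM]; first by rewrite size_map.
    rewrite (nth_map rzero) // /pick; case: pselect => [h|[]].
      by case: (cid2 h).
    exact: exceptional_model (exc t tM).
  have [i [j [ip csE]]] : exists i j, index_pair i j /\ cs = pair_codes i j.
    apply: index_pair_of_codes.
    - by apply/(all_nthP (false, 0%N)) => t; rewrite sz => /csP[].
    - apply/(pairwiseP (false, 0%N)) => s t; rewrite !inE sz => sM tM st.
      have [oks isM] := csP s sM; have [okt it] := csP t tM.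
      by apply/(ext_code oks okt it isM) => l; apply: ext; rewrite st.
    - exact: codes_of_generates gen sz csP.
  exists i, j; split=> //; rewrite -csE; apply/(Forall2_nthP _ (false, 0%N) rzero).
  by split=> // t /csP[].
move=> [i [j [ip /(Forall2_nthP _ (false, 0%N) rzero)[sz iso]]]].
have ok t : (t < size Ms)%N -> code_ok (m := m) (nth (false, 0%N) (pair_codes i j) t).
  by move=> tM; apply: (all_nthP _ (pair_codes_ok ip)); rewrite sz.
split; first split.
- by move=> t tM; apply: exceptional_code (ok t tM) (iso t tM).
- move=> s t /andP[st tM] l; have sM := ltn_trans st tM; move: l.
  apply/(ext_code (ok s sM) (ok t tM) (iso t tM) (iso s sM)).
  by move/(pairwiseP (false, 0%N)): (pair_codes_rel ip); apply; rewrite // inE sz.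
- move=> S trS hS X; apply: (generates_of_codes trS _ (pair_codes_cover ip)).
  move=> c /(nthP (false, 0%N))[t]; rewrite sz => tM <-.
  apply/(single_stalk _ trS)/(single_iso trS (riso_sym (iso t tM)))/(single_stalk _ trS).
  exact: hS.
Qed.

(** The parity test makes the index an isomorphism invariant, and U acts as zero on standard modules
    but not on costandard ones. *)
Lemma code_mod_inj c d : code_ok (m := m) c -> code_ok (m := m) d ->
  riso (code_mod Z c) (code_mod Z d) -> c = d.
Proof.
have no a b : (a < m)%N -> ~ riso (nabla Z a) (Delta Z b).
  move=> am /riso_inv[f [g [fg gf]]]; apply: (nabla_genU (Z := Z) am).
  by apply: (can_inj fg); rewrite rfunP Delta_U linear0.
move=> okc okd cd; have : code_idx c = code_idx d.
  have := wd_code Z (code_idx c) okd; rewrite -(wd_iso (tail_idem_sqr Z _) cd) wd_code // eqxx.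
  by move/esym/eqP.
move: c d okc okd cd => [[] b] [[] b']; rewrite /code_ok /code_idx /code_mod /= ?addn0 ?addn1 => okc okd cd.
- by case=> ->.
- by case: (no b b').
- by case: (no b' b) => //; apply: riso_sym.
- by move=> ->.
Qed.

Lemma iso_codes_inj cs cs' : all (@code_ok m) cs -> all (@code_ok m) cs' ->
  seq_iso (map (code_mod Z) cs) (map (code_mod Z) cs') -> cs = cs'.
Proof.
elim: cs cs' => [|c cs IH] [|c' cs'] //= => [_ _ h|_ _ h|]; try by inversion h.
move=> /andP[okc okcs] /andP[okc' okcs'] h; inversion h; subst.
by rewrite (code_mod_inj okc okc') // (IH cs').
Qed.

(** f o decides whether the index o + 2 goes to the costandard part; the reversal makes that part
    decreasing. *)
Definition set_pair (f : {ffun 'I_m -> bool}) : seq nat * seq nat :=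
  let b x := if insub (x - 2)%N is Some o then f o else false in
  (rev [seq x <- iota 2 m | b x], [seq x <- iota 2 m | ~~ b x]).

Lemma set_pairP f : index_pair (set_pair f).1 (set_pair f).2.
Proof.
have ltn_tr := ltn_trans.
split=> [|x||] /=.
- by rewrite size_rev !size_filter count_predC size_iota.
- rewrite mem_cat mem_rev !mem_filter -andb_orl orbN mem_iota; lia.
- rewrite -(sorted_pairwise (leT := gtn)) => [|a b c /=]; last by lia.
  rewrite rev_sorted; apply: sorted_filter (iota_ltn_sorted _ _); exact: ltn_trans.
- rewrite -(sorted_pairwise ltn_trans).
  by apply: sorted_filter (iota_ltn_sorted _ _); exact: ltn_trans.
Qed.

Lemma set_pair_mem f (o : 'I_m) :
  ((true, o : nat) \in pair_codes (set_pair f).1 (set_pair f).2) = f o.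
Proof.
have bo : (if insub (o.+2 - 2)%N is Some o' then f o' else false) = f o.
  by rewrite subSS subSS subn0 valK.
rewrite mem_cat inE /= [X in _ || X](_ : _ = false) ?orbF; last first.
  by apply/negbTE/negP => /mapP[].
apply/mapP/idP => [[x]|fo].
  rewrite mem_rev mem_filter mem_iota => /andP[bx xm] [ox].
  by rewrite (_ : x = o.+2) ?bo // in bx; lia.
exists (o : nat).+2; last by rewrite !subSS subn0.
by rewrite mem_rev mem_filter bo fo mem_iota; have := ltn_ord o; lia.
Qed.

(** A strictly monotone list is determined by its set of members, and the set of j is the complement
    of that of i. *)
Lemma index_pair_set i j : index_pair i j -> exists f, set_pair f = (i, j).
Proof.
move=> ip; have un := index_pair_uniq ip; have [_ mem pi pj] := ip.
exists [ffun o : 'I_m => (o : nat).+2 \in i]; rewrite /set_pair.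
have bE x : x \in iota 2 m ->
    (if insub (x - 2)%N is Some o then [ffun o : 'I_m => (o : nat).+2 \in i] o else false) = (x \in i).
  rewrite mem_iota => xm; have xm' : (x - 2 < m)%N by lia.
  by rewrite (insubT (fun x => x < m)%N xm') ffunE /= (_ : (x - 2).+2 = x) //; lia.
congr (_, _).
- apply: (@irr_sorted_eq _ gtn) => [a b c /=|a /=|||x]; [lia|lia| | | ].
  + rewrite rev_sorted; apply: sorted_filter (iota_ltn_sorted _ _); exact: ltn_trans.
  + by rewrite sorted_pairwise //; clear=> a b c /=; lia.
  + rewrite mem_rev mem_filter andbC; case: (boolP (x \in iota 2 m)) => [xm|xm].
      by rewrite bE.
    apply/esym/negbTE; apply: contra xm => xi; rewrite mem_iota.
    by have := mem x; rewrite mem_cat xi /=; lia.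
- apply: (irr_sorted_eq ltn_trans ltnn) => [||x].
  + by apply: sorted_filter (iota_ltn_sorted _ _); exact: ltn_trans.
  + by rewrite (sorted_pairwise ltn_trans).
  + rewrite mem_filter andbC; case: (boolP (x \in iota 2 m)) => [xm|xm].
      rewrite bE //= ; move: un; rewrite cat_uniq => /and3P[_ /hasPn h _].
      have := mem x; rewrite mem_cat; move: xm; rewrite mem_iota => xm.
      case: (boolP (x \in j)) => xj; first by rewrite (negbTE (h _ xj)).
      by rewrite orbF => ->; rewrite negbF //; lia.
    apply/esym/negbTE; apply: contra xm => xj; rewrite mem_iota.
    by have := mem x; rewrite mem_cat xj orbT; lia.
Qed.

Lemma full_exceptional_count :
  exactly_up_to seq_iso (@full_exceptional_seq k A) (2 ^ m).
Proof.
have cardE : (2 ^ m)%N = #|{ffun 'I_m -> bool}| by rewrite card_ffun card_bool card_ord.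
pose r f := map (code_mod Z) (pair_codes (set_pair f).1 (set_pair f).2).
have rP f : full_exceptional_seq (r f).
  apply/full_exceptional_codes; exists (set_pair f).1, (set_pair f).2.
  split; first exact: set_pairP.
  rewrite /r; elim: (pair_codes _ _) => [|c cs IH]; constructor => //; exact: riso_refl.
exists (fun t => r (enum_val (cast_ord cardE t))); split=> [t|s t|Ms].
- exact: rP.
- move=> /iso_codes_inj h; have {h} := h (pair_codes_ok (set_pairP _)) (pair_codes_ok (set_pairP _)).
  move=> h; apply: (@cast_ord_inj _ _ cardE); apply: enum_val_inj; apply/ffunP => o.
  by rewrite -[LHS]set_pair_mem h set_pair_mem.
move=> /full_exceptional_codes[i [j [ip iso]]]; have [f fE] := index_pair_set ip.
exists (cast_ord (esym cardE) (enum_rank f)).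
rewrite cast_ordKV enum_rankK /r fE /=.
elim: iso => [|c M cs Ns cM _ IH] /=; constructor => //; exact: riso_sym.
Qed.

End Codes.

(** * Translation of codes into the modules over B_n *)

Section BnSequences.
Context {k : fieldType} {n : nat}.
Hypothesis hn : (2 <= n)%N.
Local Notation Z := (Bzigzag k n).
Implicit Types (M : rmod (Balg k n)).

Let nS : n = n.-1.+1. Proof. by rewrite prednK // (leq_trans _ hn). Qed.

Lemma is_L_simple i M : (i <= n.-1)%N -> is_L i.+1 M <-> simple_at Z i M.
Proof. by move=> im; rewrite /is_L /simple_at Bzigzag_idem. Qed.

Lemma uniserial2_length2 i j M : (i <= n.-1)%N -> (j <= n.-1)%N ->
  uniserial2 M i.+1 j.+1 <-> length2_at Z M i j.
Proof. by move=> im jm; rewrite /uniserial2 /length2_at /is_L /simple_at !Bzigzag_idem. Qed.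

Lemma is_L1_code M : is_L 1 M <-> riso (code_mod Z (false, 0%N)) M.
Proof.
rewrite (propext (is_L_simple M (leq0n _))) (propext (simple_atP Z M (leq0n _))).
by split; apply: riso_trans; [exact: Delta0_L0|exact/riso_sym/Delta0_L0].
Qed.

Lemma is_Delta_code y M : (2 <= y <= n)%N -> is_Delta y M <-> riso (code_mod Z (false, y.-1)) M.
Proof.
case: y => [|[|y]] // yn; have ym : (y < n.-1)%N by lia.
rewrite /is_Delta (propext (uniserial2_length2 M ym (ltnW ym))).
exact: length2_Delta.
Qed.

Lemma is_nabla_code x M : (2 <= x <= n)%N -> is_nabla x M <-> riso (code_mod Z (true, x - 2)%N) M.
Proof.
case: x => [|[|x]] // xn; have xm : (x < n.-1)%N by lia.
rewrite /is_nabla (propext (uniserial2_length2 M (ltnW xm) xm)) !subSS subn0.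
exact: length2_nabla.
Qed.

Lemma iso_codesP (i j : seq nat) (Ms : seq (rmod (Balg k n))) :
  index_pair (m := n.-1) i j ->
  iso_codes Z (pair_codes i j) Ms <->
  exists (Ns Ds : seq (rmod (Balg k n))) (L : rmod (Balg k n)),
    [/\ Ms = Ns ++ L :: Ds, List.Forall2 (fun x N => is_nabla x N) i Ns, is_L 1 L &
        List.Forall2 (fun y D => is_Delta y D) j Ds].
Proof.
move=> [_ mem _ _].
have hi x : x \in i -> (2 <= x <= n)%N by move=> xi; have := mem x; rewrite -nS mem_cat xi.
have hj x : x \in j -> (2 <= x <= n)%N by move=> xj; have := mem x; rewrite -nS mem_cat xj orbT.
split.
  move=> /List.Forall2_app_inv_l[Ns [l' [h1 [h2 ->]]]].
  inversion h2 as [|? L ? Ds cL hD]; subst.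
  exists Ns, Ds, L; split=> //; last 1 first.
  - apply: Forall2_impl_mem ((Forall2_map_l _ _ _ _).1 hD) => y D yj h.
    by apply/(is_Delta_code D (hj _ yj)).
  - apply: Forall2_impl_mem ((Forall2_map_l _ _ _ _).1 h1) => x N xi h.
    by apply/(is_nabla_code N (hi _ xi)).
  - exact/is_L1_code.
move=> [Ns [Ds [L [-> h1 hL hD]]]]; apply: List.Forall2_app; last constructor.
- apply/Forall2_map_l; apply: Forall2_impl_mem h1 => x N xi h.
  by apply/(is_nabla_code N (hi _ xi)).
- exact/is_L1_code.
- apply/Forall2_map_l; apply: Forall2_impl_mem hD => y D yj h.
  by apply/(is_Delta_code D (hj _ yj)).
Qed.

End BnSequences.

Local Close Scope ring_scope.

Theorem theorem3 (k : closedFieldType) (n : nat) (hn : (2 <= n)%N) :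
  exactly_up_to seq_iso (@full_exceptional_seq k (Balg k n)) (2 ^ (n - 1)) /\
  (forall Ms : seq (rmod (Balg k n)),
     full_exceptional_seq Ms <->
     exists (i j : seq nat) (Ns Ds : seq (rmod (Balg k n)))
       (L : rmod (Balg k n)),
       Ms = Ns ++ L :: Ds /\
       List.Forall2 (fun x N => is_nabla x N) i Ns /\
       is_L 1 L /\
       List.Forall2 (fun y D => is_Delta y D) j Ds /\
       size i + size j = (n - 1)%N /\
       (forall x : nat, (x \in i ++ j) = (2 <= x <= n)%N) /\
       pairwise gtn i /\
       pairwise ltn j).
Proof.
have m0 : (0 < n.-1)%N by lia.
have nS : n.-1.+1 = n by lia.
rewrite subn1; split; first exact: full_exceptional_count (Bzigzag k n) m0.
move=> Ms; rewrite (propext (full_exceptional_codes (Bzigzag k n) m0 Ms)); split.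
  move=> [i [j [ip /(iso_codesP hn _ ip)[Ns [Ds [L [-> h1 hL h2]]]]]]].
  by exists i, j, Ns, Ds, L; case: ip => sz mem pi pj; rewrite nS in mem.
move=> [i [j [Ns [Ds [L [-> [h1 [hL [h2 [sz [mem [pi pj]]]]]]]]]]]].
have ip : index_pair (m := n.-1) i j by split=> // x; rewrite nS.
by exists i, j; split=> //; apply/(iso_codesP hn _ ip); exists Ns, Ds, L.
Qed.
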